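(* Let $d\ge 1$ and let $\{X_e : e\in E\}$ be i.i.d. real random variables with $E[X_e]=0$ such that, for some $c_0>0$, $E[e^{cX_e}]<\infty$ for all $|c|<c_0$. Assume that for some positive $M_0<\infty$ there is a positive increasing function $f$ on $(0,\infty)$ so that $$\log P(X_e<x) = -(-x)^{d+1} f(-x),\qquad x<-M_0 .$$ Then for every sufficiently small $\varepsilon>0$, $$\limsup_{n\to\infty}\frac{1}{n^{d+1}}\log P\big(Z_n\le (\mu-\varepsilon)n\big)<0$$ if and only if $$\sum_{n=1}^{\infty}\frac{1}{f(2^n)^{1/d}}<\infty .$$
   Context: $\log$ denotes the logarithm to base 2. For $x\in\mathbb{Z}^d$ write $|x|_1=|x_1|+\dots+|x_d|$. Let $\Xi=\{(x,n)\in\mathbb{Z}^d\times\mathbb{Z}_+ : |x|_1+n\equiv 0 \bmod 2\}$ ($\mathbb{Z}_+$ includes $0$), and let $E$ be the set of directed edges from $(x,n)\in\Xi$ to $(x\pm e_i,n+1)$, $i=1,\dots,d$, where $e_i$ is the $i$-th standard basis vector. Let $\aleph_n$ be the set of directed nearest-neighbour paths in $(\Xi,E)$ with $n$ steps starting at $(0,0)$ (hence ending at a vertex with last coordinate $n$). Write $e\in\gamma$ if the edge $e$ is traversed by $\gamma$, and set $Z_n=\sup_{\gamma\in\aleph_n}\sum_{e\in\gamma}X_e$. The constant $\mu$ is the nonrandom almost sure limit $\mu=\lim_{n\to\infty} Z_n/n$. *)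

(* Defs.v *)
From mathcomp Require Import all_boot all_order all_algebra finmap.
From mathcomp Require Import all_classical all_reals all_analysis.

Set Implicit Arguments.
Unset Strict Implicit.
Unset Printing Implicit Defensive.

Import Order.TTheory GRing.Theory Num.Theory.
Import numFieldNormedType.Exports.

Local Open Scope classical_set_scope.
Local Open Scope ring_scope.

(* With extended-real values, so that log2 0 = -oo. *)
Definition log2 (R : realType) (p : \bar R) : \bar R :=
  (lne p * ((ln (2 : R))^-1)%:E)%E.

Definition norm1 (d : nat) (x : 'rV[int]_d) : nat :=
  (\sum_(i < d) `|x 0%R i|)%N.

Definition Xi (d : nat) (v : 'rV[int]_d * nat) : bool :=
  (norm1 v.1 + v.2 == 0 %[mod 2])%N.

(* The head of an edge is then automatically in Xi. *)
Definition is_edge (d : nat) (a : ('rV[int]_d * nat) * ('rV[int]_d * nat)) :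
    bool :=
  [&& Xi a.1, a.2.2 == a.1.2.+1 &
    [exists i : 'I_d, (a.2.1 == a.1.1 + delta_mx 0 i)
                   || (a.2.1 == a.1.1 - delta_mx 0 i)]].

Definition edge (d : nat) : Type :=
  {a : ('rV[int]_d * nat) * ('rV[int]_d * nat) | is_edge a}.

Definition source (d : nat) (e : edge d) : 'rV[int]_d * nat := (val e).1.
Definition target (d : nat) (e : edge d) : 'rV[int]_d * nat := (val e).2.

(* A directed path is given by the sequence of the edges it traverses. *)
Fixpoint path_from (d : nat) (v : 'rV[int]_d * nat) (s : seq (edge d)) : bool :=
  if s is e :: s' then (source e == v) && path_from (target e) s' else true.

Definition paths (d n : nat) : set (n.-tuple (edge d)) :=
  [set g | path_from (0, 0%N) g].

(* Time increases by one along each edge, so a path has no repeated edge and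
   the sum over the sequence is the sum over the set of traversed edges.
   The supremum is over a finite nonempty set when 0 < d. *)
Definition passage (d : nat) (R : realType) (T : Type) (X : edge d -> T -> R)
    (n : nat) (w : T) : R :=
  sup [set \sum_(e <- g) X e w | g in @paths d n].

Definition mutually_independent (disp : measure_display)
    (T : measurableType disp) (R : realType) (P : probability T R)
    (I : choiceType) (X : I -> {RV P >-> R}) : Prop :=
  forall (s : {fset I}) (A : I -> set R), (forall i, measurable (A i)) ->
    P (\bigcap_(i in [set` s]) X i @^-1` A i) =
    (\prod_(i <- s) P (X i @^-1` A i))%E.

Definition identically_distributed (disp : measure_display)
    (T : measurableType disp) (R : realType) (P : probability T R)
    (I : Type) (X : I -> {RV P >-> R}) : Prop :=
  forall (i j : I) (A : set R), measurable A ->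
    distribution P (X i) A = distribution P (X j) A.

(* Main.v *)
Require Import Defs.
From HB Require Import structures.
From mathcomp Require Import all_boot all_order all_algebra finmap.
From mathcomp Require Import zify ring lra.
From mathcomp Require Import all_classical all_reals all_analysis.
From mathcomp Require Import measurable_realfun.

(** Write [beta j = f (2 ^ j) ^ (- 1 / d)]; everything is done for the law of the
    environment on [edge d -> R].

    If the series converges, fix a short time [h] for which the best path of
    [h] steps from the origin back to itself has mean at least [(mu - eps) h]:
    a quadratic penalty on the end point costs almost nothing, by averaging over
    the reflection at the starting point, and keeps a long path close to the
    origin. Now send [r ^ d] paths along a flow that spreads them out linearly in
    time. After a time of order [r] they are far apart, and each of them continues
    with successive loops of length [h] in its own tube. The maximum [Z_n]
    dominates the average over the [r ^ d] paths, to which Chernoff's bound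
    applies: the loops in distinct tubes are independent and contribute
    [exp (- c n r ^ d)], while an edge at time [t] is shared by at most
    [(r d / t + 1) ^ d] paths of the flow, so that by the tail assumption the
    dyadic block [t ~ r / 2 ^ j] costs a factor [exp (C r ^ (d + 1) beta (j / 2))].
    As [sum_j beta j] is finite, the loops win once [n / r] is large.

    If the series diverges and [n = 2 ^ N], force all the weights at times
    [t < 2 ^ (N - j)] that a path can reach to be below [- rho 2 ^ j beta j], for
    [j < J]. Every path then loses order [rho n sum_j beta j], while the logarithm
    of the probability is at least of order [- rho ^ (d + 1) n ^ (d + 1) sum_j beta j].
    Choose [rho] small, then [J] such that [rho sum_j beta j] is a large constant. *)

Set Implicit Arguments.
Unset Strict Implicit.
Unset Printing Implicit Defensive.

Import Order.TTheory GRing.Theory Num.Theory.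
Import numFieldNormedType.Exports.

Local Open Scope classical_set_scope.
Local Open Scope ring_scope.

(** * Laws of random environments *)

(** The exponent [1 / d] comes from balancing gain and cost in one dyadic slab. Of order
    [T ^ (d + 1)] edges can be reached before time [T]. Pushing them all below [- x] costs about
    [T ^ (d + 1) x ^ (d + 1) f x] in the logarithm and lowers every path by about [T x]. With
    [T = n / 2 ^ j], [x = 2 ^ j b] and [b <= 1], the cost is at most of order
    [n ^ (d + 1) b ^ (d + 1) f (2 ^ j)] and the gain is [n b]. For [b = beta j] the factor
    [b ^ d f (2 ^ j)] equals 1, so cost and gain are both proportional to [beta j], and both
    directions turn on the same sum. The obstacle in the convergent case is that all paths leave one
    vertex. Near it a few edges carry many of the [r ^ d] paths, and an edge of multiplicity [k]
    enters with an exponential moment of order [kap k], far outside the range [|c| < c0]. Only the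
    negative part of the weight matters there, and the tail assumption gives it all exponential
    moments. Since [r] is a fixed fraction of [n], the gain [n r ^ d] from the tubes has the order
    [n ^ (d + 1)]. *)

Definition cylinder (I : choiceType) (R : realType) (s : {fset I})
    (A : I -> set R) : set (I -> R) :=
  [set c | forall i, i \in s -> A i (c i)].

Definition cylinders (I : choiceType) (R : realType) : set (set (I -> R)) :=
  [set C | exists s A, (forall i, measurable (A i)) /\ C = cylinder s A].

Definition conf (I : choiceType) (R : realType) : Type := I -> R.

Fact conf_display : measure_display.
Proof. exact: default_measure_display. Qed.

HB.instance Definition _ (I : choiceType) (R : realType) :=
  Pointed.on (conf I R).

HB.instance Definition _ (I : choiceType) (R : realType) :=
  @isMeasurable.Build conf_display (conf I R) <<s @cylinders I R >>
    (@sigma_algebra0 _ setT _) (@sigma_algebraC _ _)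
    (@sigma_algebra_bigcup _ setT _).

Section config.
Context (I : choiceType) (R : realType).
Local Notation conf := (conf I R).

Lemma cylinder_measurable (s : {fset I}) (A : I -> set R) :
  (forall i, measurable (A i)) -> measurable (cylinder s A : set conf).
Proof. by move=> mA; apply: sub_gen_smallest; exists s, A. Qed.

Lemma conf_eval_measurable (i : I) : measurable_fun setT (fun c : conf => c i).
Proof.
move=> _ Y mY; rewrite setTI.
rewrite (_ : _ @^-1` _ = cylinder [fset i]%fset (fun=> Y)); last first.
  apply/seteqP; split => c /=; rewrite /cylinder /=.
    by move=> Yc j /fset1P ->.
  by apply; exact/fset1P.
exact: cylinder_measurable.
Qed.

Lemma conf_measurableP d (T : measurableType d) (F : T -> conf) :
  (forall i, measurable_fun setT (fun t => F t i)) -> measurable_fun setT F.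
Proof.
move=> mF; apply: measurability; first by [].
move=> _ [_ [s [A [mA ->]]] <-]; rewrite setTI.
rewrite (_ : _ @^-1` _ = \bigcap_(i in [set` s]) ((fun t => F t i) @^-1` A i)) //.
apply: fin_bigcap_measurable => // i _; rewrite -[X in measurable X]setTI; exact: mF.
Qed.

(** Uniqueness of measures on a pi-system: two cylinders intersect in a cylinder once the
    coordinates missing from one index set are given the condition [setT]. *)
Lemma cylinder_unique (m1 m2 : probability conf R) :
  (forall (s : {fset I}) (A : I -> set R), (forall i, measurable (A i)) ->
    m1 (cylinder s A) = m2 (cylinder s A)) ->
  forall C : set conf, measurable C -> m1 C = m2 C.
Proof.
move=> m12.
pose G := @cylinders I R.
have GT : G setT.
  exists fset0, (fun=> setT); split => //; apply/seteqP; split => c //= _ i.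
move=> C mC; apply: (@measure_unique _ _ conf G (fun=> setT)) => //.
- move=> _ _ [s [A [mA ->]]] [t [B [mB ->]]].
  exists (s `|` t)%fset, (fun i => (if i \in s then A i else setT) `&`
     (if i \in t then B i else setT)); split.
    by move=> i; apply: measurableI; case: ifP.
  apply/seteqP; split => c /=; rewrite /cylinder /=.
    by move=> [Ac Bc] i _; split; case: ifPn => // ?; [exact: Ac|exact: Bc].
  move=> H; split => i si.
    by have := H i; rewrite inE si => /(_ isT) [].
  by have := H i; rewrite inE si orbT => /(_ isT) [].
- by rewrite bigcup_const.
- by move=> _ [s [A [mA ->]]]; exact: m12.
- by move=> n /=; rewrite probability_setT ltry.
Qed.

End config.

Section iid.
Context (I : choiceType) (R : realType).
Local Notation conf := (conf I R).
Variables (Q : probability conf R) (nu : set R -> \bar R).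
Hypothesis QE : forall (s : {fset I}) (A : I -> set R),
  (forall i, measurable (A i)) -> Q (cylinder s A) = (\prod_(i <- s) nu (A i))%E.

Definition relabel (rho : I -> I) (c : conf) : conf := fun i => c (rho i).

Lemma relabel_measurable rho : measurable_fun setT (relabel rho).
Proof. by apply: conf_measurableP => i; exact: conf_eval_measurable. Qed.

HB.instance Definition _ rho :=
  isMeasurableFun.Build _ _ _ _ (relabel rho) (relabel_measurable rho).

(** All coordinates have the same law, so it suffices that distinct indices read distinct
    coordinates. Lattice translations and reflections enter through this lemma. *)
Lemma relabel_law rho : injective rho ->
  forall C : set conf, measurable C -> Q (relabel rho @^-1` C) = Q C.
Proof.
move=> rho_inj C mC.
rewrite -[LHS]/(distribution Q (relabel rho) C); apply: cylinder_unique => //.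
move=> s A mA; rewrite [RHS]QE //.
(* The condition [A i] is moved to the index [rho i]; indices outside the range of [rho] are left
   free. *)
pose A' j := if pselect (exists i, rho i = j) is left H then A (projT1 (cid H))
             else setT.
have A'E i : A' (rho i) = A i.
  rewrite /A'; case: pselect => [H|[]]; last by exists i.
  by congr A; apply: rho_inj; exact: (projT2 (cid H)).
transitivity (Q (cylinder [fset rho i | i in s]%fset A')).
  congr (Q _); apply/seteqP; split => c /= sA.
    by move=> _ /imfsetP[i /= si ->]; rewrite A'E; exact: sA.
  by move=> i si; rewrite -A'E; apply: sA; rewrite in_imfset.
rewrite QE; last by move=> j; rewrite /A'; case: pselect.
rewrite big_imfset /=; last by move=> i j _ _; exact: rho_inj.
by apply: eq_bigr => i _; rewrite A'E.
Qed.

(* If c and c' are independent then mix A (c, c') has the law of c, which turns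
   independence into Fubini's theorem on the product space. *)
Definition mix (A : set I) (cc : conf * conf) : conf :=
  fun i => if `[< A i >] then cc.1 i else cc.2 i.

Lemma mix_measurable A : measurable_fun setT (mix A).
Proof.
apply: conf_measurableP => i; rewrite /mix; case: `[< A i >].
  by apply: (measurableT_comp (conf_eval_measurable i)); exact: measurable_fst.
by apply: (measurableT_comp (conf_eval_measurable i)); exact: measurable_snd.
Qed.

HB.instance Definition _ A :=
  isMeasurableFun.Build _ _ _ _ (mix A) (mix_measurable A).

Lemma mix_law A (C : set conf) : measurable C ->
  (Q \x Q)%E (mix A @^-1` C) = Q C.
Proof.
move=> mC.
rewrite -[LHS]/(distribution (Q \x Q)%E (mix A) C); apply: cylinder_unique => //.
move=> s B mB; rewrite [RHS]QE //.
transitivity ((Q \x Q)%E (cylinder [fset i in s | `[< A i >]]%fset B `*`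
              cylinder [fset i in s | ~~ `[< A i >]]%fset B)).
  congr ((Q \x Q)%E _); apply/seteqP; split => -[c c'] /=; rewrite /cylinder /=.
    move=> H; split => i; rewrite !inE /= => /andP[si Ai]; have := H i si; rewrite /mix.
      by rewrite Ai.
    by rewrite (negbTE Ai).
  move=> [H1 H2] i si; rewrite /mix; case: ifPn => Ai.
    by apply: H1; rewrite !inE /= si Ai.
  by apply: H2; rewrite !inE /= si Ai.
rewrite product_measure1E; [|exact: cylinder_measurable..].
rewrite [X in (X * _)%E]QE //.
rewrite [X in (_ * X)%E]QE //.
rewrite [RHS](bigID (fun i => `[< A i >])) /=; congr (_ * _)%E.
  by rewrite big_fset.
by rewrite big_fset.
Qed.


Lemma ge0_integral_relabel (rho : I -> I) (F : conf -> \bar R) : injective rho ->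
  measurable_fun setT F -> (forall c, 0 <= F c)%E ->
  (\int[Q]_c F (relabel rho c) = \int[Q]_c F c)%E.
Proof.
move=> rho_inj mF F0; rewrite -[LHS](@ge0_integral_pushforward _ _ _ _ R _ (relabel_measurable rho) Q setT) //.
by apply: eq_measure_integral => C mC _; exact: relabel_law.
Qed.

Lemma integral_relabel (rho : I -> I) (F : conf -> \bar R) : injective rho ->
  Q.-integrable setT F ->
  Q.-integrable setT (F \o relabel rho) /\
  (\int[Q]_c F (relabel rho c) = \int[Q]_c F c)%E.
Proof.
move=> rho_inj iF.
have mF : measurable_fun setT F by exact: measurable_int iF.
have iFr : Q.-integrable setT (F \o relabel rho).
  apply/integrableP; split; first exact: (measurableT_comp mF (relabel_measurable rho)).
  rewrite (ge0_integral_relabel (F := fun c => `|F c|%E) rho_inj) //.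
    by case/integrableP: iF.
  exact: measurableT_comp.
split => //.
rewrite -[LHS](@integral_pushforward _ _ _ _ R _ (relabel_measurable rho) Q setT) //.
by apply: eq_measure_integral => C mC _; exact: relabel_law.
Qed.

Lemma ge0_integral_mix A (F : conf -> \bar R) :
  measurable_fun setT F -> (forall c, 0 <= F c)%E ->
  (\int[Q \x Q]_cc F (mix A cc) = \int[Q]_c F c)%E.
Proof.
move=> mF F0; rewrite -[LHS](@ge0_integral_pushforward _ _ _ _ R _ (@mix_measurable A) (Q \x Q)%E setT) //.
by apply: eq_measure_integral => C mC _; exact: mix_law.
Qed.

Lemma integral_mix A (F : conf -> \bar R) :
  Q.-integrable setT F ->
  (Q \x Q)%E.-integrable setT (F \o mix A) /\
  (\int[Q \x Q]_cc F (mix A cc) = \int[Q]_c F c)%E.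
Proof.
move=> iF.
have mF : measurable_fun setT F by exact: measurable_int iF.
have iFr : (Q \x Q)%E.-integrable setT (F \o mix A).
  apply/integrableP; split; first exact: (measurableT_comp mF (@mix_measurable A)).
  rewrite (ge0_integral_mix A (F := fun c => `|F c|%E)) //.
    by case/integrableP: iF.
  exact: measurableT_comp.
split => //.
rewrite -[LHS](@integral_pushforward _ _ _ _ R _ (@mix_measurable A) (Q \x Q)%E setT) //.
by apply: eq_measure_integral => C mC _; exact: mix_law.
Qed.

Definition depends_on (U : Type) (A : set I) (F : conf -> U) : Prop :=
  forall c c', (forall i, A i -> c i = c' i) -> F c = F c'.

Lemma depends_mixl (U : Type) A (F : conf -> U) c c' :
  depends_on A F -> F (mix A (c, c')) = F c.
Proof. by move=> dF; apply: dF => i Ai; rewrite /mix /=; case: asboolP. Qed.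

Lemma depends_mixr (U : Type) A (F : conf -> U) c c' :
  depends_on (~` A) F -> F (mix A (c, c')) = F c'.
Proof. by move=> dF; apply: dF => i Ai; rewrite /mix /=; case: asboolP. Qed.

Lemma independent2 A (F G : conf -> \bar R) :
  measurable_fun setT F -> measurable_fun setT G ->
  (forall c, 0 <= F c)%E -> (forall c, 0 <= G c)%E ->
  depends_on A F -> depends_on (~` A) G ->
  (\int[Q]_c (F c * G c) = \int[Q]_c F c * \int[Q]_c G c)%E.
Proof.
move=> mF mG F0 G0 dF dG.
rewrite -(ge0_integral_mix A (F := fun c => (F c * G c)%E)); first last.
- by move=> c; exact: mule_ge0.
- exact: emeasurable_funM.
rewrite (fubini_tonelli1 (fun cc => F (mix A cc) * G (mix A cc))%E); first last.
- by move=> cc; exact: mule_ge0.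
- by apply: emeasurable_funM; apply: measurableT_comp => //; exact: mix_measurable.
rewrite /fubini_F.
transitivity (\int[Q]_x (F x * \int[Q]_c G c))%E.
  apply: eq_integral => c _.
  rewrite -ge0_integralZl //.
  by apply: eq_integral => c' _; rewrite (depends_mixl _ _ dF) (depends_mixr _ _ dG).
by rewrite ge0_integralZr //; exact: integral_ge0.
Qed.

(** Induction on [s]: by disjointness, the remaining factors depend only on the complement of [B j],
    which is the case of [independent2]. *)
Lemma independent_prod (J : eqType) (s : seq J) (B : J -> set I)
    (F : J -> conf -> \bar R) : uniq s ->
  (forall j, j \in s -> measurable_fun setT (F j)) ->
  (forall j c, 0 <= F j c)%E ->
  (forall j, j \in s -> depends_on (B j) (F j)) ->
  (forall j k, j \in s -> k \in s -> j != k -> B j `&` B k = set0) ->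
  (\int[Q]_c (\prod_(j <- s) F j c) = \prod_(j <- s) \int[Q]_c F j c)%E.
Proof.
elim: s => [_ _ _ _ _|j s IH /= /andP[js us] mF F0 dF disj].
  under eq_integral do rewrite big_nil.
  by rewrite big_nil integral_cst //= mul1e probability_setT.
have sub k : k \in s -> k \in j :: s by rewrite inE => ->; rewrite orbT.
rewrite big_cons -IH //; first last.
- by move=> k l /sub ks /sub ls; exact: disj.
- by move=> k /sub; exact: dF.
- by move=> k /sub; exact: mF.
under eq_integral do rewrite big_cons.
apply: (@independent2 (B j)).
- by apply: mF; exact: mem_head.
- have mprod t : {subset t <= s} ->
      measurable_fun setT (fun c => (\prod_(k <- t) F k c)%E).
    elim: t => [_|k t IHt ts].
      apply: (eq_measurable_fun (cst 1%E)); last exact: measurable_cst.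
      by move=> c _; rewrite big_nil.
    have mt : measurable_fun setT (fun c => \prod_(l <- t) F l c)%E.
      by apply: IHt => l lt; apply: ts; rewrite inE lt orbT.
    have mk : measurable_fun setT (F k) by apply: mF; apply: sub; apply: ts; exact: mem_head.
    apply: eq_measurable_fun (emeasurable_funM mk mt) => c _.
    by rewrite big_cons.
  exact: mprod.
- by move=> c; exact: F0.
- by move=> c; exact: prode_ge0.
- by apply: dF; exact: mem_head.
- move=> c c' cc'; rewrite !big_seq; apply: eq_bigr => k ks.
  apply: dF; first exact: sub.
  move=> i Bi; apply: cc' => Bji.
  have jk : j != k by apply: contraNneq js => ->.
  have := disj j k (mem_head _ _) (sub _ ks) jk.
  by move/seteqP => [/(_ i)] /(_ (conj Bji Bi)).
Qed.

End iid.

(** * Finite maxima and integrals of real functions on a probability space *)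

Lemma ln2_gt0 (R : realType) : 0 < ln (2 : R).
Proof. by rewrite ln_gt0 // ltr1n. Qed.

Lemma strict_sublevel_measurable (R : realType) (disp : measure_display)
    (T : measurableType disp) (g : T -> R) (x : R) :
  measurable_fun setT g -> measurable [set w | g w < x].
Proof.
move=> mg; rewrite (_ : mkset _ = g @^-1` `]-oo, x[); last first.
  by apply/seteqP; split => w /=; rewrite in_itv.
by rewrite -[X in measurable X]setTI; exact: mg.
Qed.

(** The seed [F t0] replaces a least element of [R]; it is harmless when [P t0] holds, since it is
    then one of the competing values. *)
Definition pmax (R : realType) (T : finType) (P : pred T) (t0 : T) (F : T -> R) : R :=
  \big[Num.max/F t0]_(t | P t) F t.

Section pmax.
Context (R : realType) (T : finType) (P : pred T) (t0 : T).
Implicit Types F G : T -> R.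

Lemma pmax_ge F t : P t -> F t <= pmax P t0 F.
Proof. by move=> Pt; rewrite /pmax; exact: le_bigmax_cond. Qed.

Lemma pmax_attained F : P t0 -> exists2 t, P t & pmax P t0 F = F t.
Proof.
move=> P0; rewrite /pmax; elim/big_ind : _ => [|x y [s Ps ->] [t Pt ->]|t Pt].
- by exists t0.
- by rewrite /Num.max; case: ifP => _; [exists t|exists s].
- by exists t.
Qed.

Lemma pmax_le F x : P t0 -> (forall t, P t -> F t <= x) -> pmax P t0 F <= x.
Proof. by move=> P0 H; have [t Pt ->] := pmax_attained F P0; exact: H. Qed.

Lemma le_pmax F G : P t0 -> (forall t, P t -> F t <= G t) ->
  pmax P t0 F <= pmax P t0 G.
Proof.
by move=> P0 FG; apply: pmax_le => // t Pt; exact: le_trans (FG _ Pt) (pmax_ge _ Pt).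
Qed.

Lemma eq_pmax F G : F =1 G -> pmax P t0 F = pmax P t0 G.
Proof. by move=> FG; congr pmax; exact/funext. Qed.

End pmax.

Section real_integrable.
Context d (T : measurableType d) (R : realType) (mu : probability T R).
Implicit Types f g : T -> R.

Definition rint f : Prop := mu.-integrable setT (EFin \o f).

Lemma rint_measurable f : rint f -> measurable_fun setT f.
Proof. by move=> /measurable_int /measurable_EFinP. Qed.

Lemma rint_le f g : measurable_fun setT f -> (forall x, `|f x| <= `|g x|) ->
  rint g -> rint f.
Proof.
move=> mf fg; apply: le_integrable => //; first exact/measurable_EFinP.
by move=> x _; rewrite /= lee_fin.
Qed.

Lemma rint_cst k : rint (fun=> k).
Proof. exact: finite_measure_integrable_cst. Qed.

Lemma rintD f g : rint f -> rint g -> rint (fun x => f x + g x).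
Proof. by move=> rf rg; exact: (integrableD measurableT rf rg). Qed.

Lemma rintZ k f : rint f -> rint (fun x => k * f x).
Proof. by move=> rf; exact: (integrableZl measurableT k rf). Qed.

Lemma rintN f : rint f -> rint (fun x => - f x).
Proof. by move=> rf; exact: (integrableN rf). Qed.

Lemma rintB f g : rint f -> rint g -> rint (fun x => f x - g x).
Proof. by move=> rf rg; apply: rintD => //; exact: rintN. Qed.

Lemma rint_norm f : rint f -> rint (fun x => `|f x|).
Proof. by move=> rf; exact: (integrable_norm rf). Qed.

Lemma rint_sum (I : Type) (s : seq I) (P : pred I) (F : I -> T -> R) :
  (forall i, P i -> rint (F i)) -> rint (fun x => \sum_(i <- s | P i) F i x).
Proof.
move=> rF; elim: s => [|i s IH].
  rewrite (_ : (fun x => _) = fun=> 0); first exact: rint_cst.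
  by apply/funext => x; rewrite big_nil.
rewrite (_ : (fun x => _) = fun x =>
    (if P i then F i x else 0) + \sum_(i <- s | P i) F i x); last first.
  by apply/funext => x; rewrite big_cons; case: ifP; rewrite ?add0r.
by apply: rintD => //; case: (boolP (P i)) => Pi; [exact: rF|exact: rint_cst].
Qed.

Lemma rint_max f g : rint f -> rint g -> rint (fun x => Num.max (f x) (g x)).
Proof.
move=> rf rg; apply: (@rint_le _ (fun x => `|f x| + `|g x|)).
- by apply: measurable_maxr; exact: rint_measurable.
- move=> x; rewrite [leRHS]ger0_norm ?addr_ge0// /Num.max.
  by case: ifP => _; rewrite ?lerDl ?lerDr.
- by apply: rintD; exact: rint_norm.
Qed.

Lemma rint_pmax (J : finType) (P : pred J) j0 (F : J -> T -> R) : P j0 ->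
  (forall j, P j -> rint (F j)) -> rint (fun x => pmax P j0 (F ^~ x)).
Proof.
move=> P0 rF; rewrite /pmax.
elim: (index_enum J) => [|i s IH].
  rewrite (_ : (fun x => _) = F j0); first exact: rF.
  by apply/funext => x; rewrite big_nil.
rewrite (_ : (fun x => _) = fun x => if P i then
    Num.max (F i x) (\big[Num.max/F j0 x]_(i <- s | P i) F i x)
    else \big[Num.max/F j0 x]_(i <- s | P i) F i x); last first.
  by apply/funext => x; rewrite big_cons.
by case: (boolP (P i)) => // Pi; apply: rint_max => //; exact: rF.
Qed.

Lemma EFin_Rintegral f : rint f ->
  (\int[mu]_x f x)%:E = (\int[mu]_x (f x)%:E)%E.
Proof. by move=> rf; rewrite /Rintegral fineK //; exact: integrable_fin_num. Qed.

Lemma Rintegral_const k : \int[mu]_x k = k.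
Proof. by rewrite Rintegral_cst //= probability_setT mulr1. Qed.

Lemma Rintegral_sum (I : Type) (s : seq I) (P : pred I) (F : I -> T -> R) :
  (forall i, P i -> rint (F i)) ->
  \int[mu]_x (\sum_(i <- s | P i) F i x) = \sum_(i <- s | P i) \int[mu]_x F i x.
Proof.
move=> rF; elim: s => [|i s IH].
  rewrite big_nil -[RHS](Rintegral_const 0); congr Rintegral.
  by apply/funext => x; rewrite big_nil.
rewrite big_cons; case: ifPn => Pi.
  rewrite -IH -RintegralD //; [|exact: rF|exact: rint_sum].
  by congr Rintegral; apply/funext => x; rewrite big_cons Pi.
rewrite -IH; congr Rintegral.
by apply/funext => x; rewrite big_cons (negbTE Pi).
Qed.

End real_integrable.

Section jensen.
Context (I : choiceType) (R : realType).
Local Notation conf := (conf I R).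
Variables (Q : probability conf R) (nu : set R -> \bar R).
Hypothesis QE : forall (s : {fset I}) (A : I -> set R),
  (forall i, measurable (A i)) -> Q (cylinder s A) = (\prod_(i <- s) nu (A i))%E.

Lemma Rintegral_relabel (rho : I -> I) (F : conf -> R) : injective rho ->
  rint Q F ->
  rint Q (fun c => F (relabel rho c)) /\
  \int[Q]_c F (relabel rho c) = \int[Q]_c F c.
Proof.
move=> rho_inj rF; have [? e] := integral_relabel QE rho_inj rF; split => //.
by rewrite /Rintegral e.
Qed.

(** Given the coordinates in [A], the [F j] are constants, and the maximum of the means of the [G j]
    is at most the mean of their maximum. The conditioning is the inner integral after [mix A]. *)
Lemma pmax_jensen (A : set I) (J : finType) (P : pred J) (j0 : J)
    (F G : J -> conf -> R) : P j0 ->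
  (forall j, P j -> rint Q (F j)) -> (forall j, P j -> rint Q (G j)) ->
  (forall j, P j -> depends_on A (F j)) ->
  (forall j, P j -> depends_on (~` A) (G j)) ->
  \int[Q]_c pmax P j0 (fun j => F j c + \int[Q]_c' G j c') <=
  \int[Q]_c pmax P j0 (fun j => F j c + G j c).
Proof.
move=> P0 rF rG dF dG.
pose H c := pmax P j0 (fun j => F j c + G j c).
have rH : rint Q H by apply: rint_pmax => // j Pj; apply: rintD; [exact: rF|exact: rG].
have rK : rint Q (fun c => pmax P j0 (fun j => F j c + \int[Q]_c' G j c')).
  by apply: rint_pmax => // j Pj; apply: rintD; [exact: rF|exact: rint_cst].
rewrite -lee_fin !EFin_Rintegral // -(integral_mix QE A rH).2.
have iHm := (integral_mix QE A rH).1.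
rewrite -(integral12_prod_meas1 iHm).
apply: le_integral => //; first exact: integrable_fubini_F.
move=> c _; rewrite /fubini_F /=.
have mixH c' : H (mix A (c, c')) = pmax P j0 (fun j => F j c + G j c').
  rewrite /H /pmax (depends_mixl _ _ (dF _ P0)) (depends_mixr _ _ (dG _ P0)).
  by apply: eq_bigr => j Pj; rewrite (depends_mixl _ _ (dF _ Pj)) (depends_mixr _ _ (dG _ Pj)).
under eq_integral do rewrite mixH.
have rFG j : P j -> rint Q (fun c' => F j c + G j c').
  by move=> Pj; apply: rintD; [exact: rint_cst|exact: rG].
have rHc : rint Q (fun c' => pmax P j0 (fun j => F j c + G j c')) by exact: rint_pmax.
rewrite -EFin_Rintegral // lee_fin.
apply: pmax_le => // j Pj.
rewrite -[X in X + _ <= _](Rintegral_const Q (F j c)) -RintegralD //; first last.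
- exact: rG.
- exact: rint_cst.
apply: le_Rintegral => //; first exact: rFG.
by move=> c' _; exact: (@pmax_ge _ _ P j0 (fun j => F j c + G j c')).
Qed.

End jensen.

(** * Lattice paths *)

Section lattice.
Context (d : nat).
Implicit Types (x y : 'rV[int]_d) (n : nat).

Lemma norm1N x : norm1 (- x) = norm1 x.
Proof. by apply: eq_bigr => i _; rewrite mxE; move: (x 0 i) => a; lia. Qed.

Lemma norm1_0 : norm1 (0 : 'rV[int]_d) = 0%N.
Proof. by rewrite /norm1 big1 // => i _; rewrite mxE. Qed.

Lemma norm1_eq0 x : norm1 x = 0%N -> x = 0.
Proof.
move=> /eqP; rewrite /norm1 sum_nat_eq0 => /forallP H.
by apply/rowP => i; have /eqP := H i; rewrite !mxE; move: (x 0 i) => a; lia.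
Qed.

Lemma norm1D_le x y : (norm1 (x + y) <= norm1 x + norm1 y)%N.
Proof.
rewrite /norm1 -big_split /=; apply: leq_sum => i _; rewrite mxE.
by move: (x 0 i) (y 0 i) => a b; lia.
Qed.

Lemma odd_norm1D x y : odd (norm1 (x + y)) = odd (norm1 x) (+) odd (norm1 y).
Proof.
rewrite /norm1 -oddD -big_split /=.
elim/big_ind2 : _ => // [a b c e|i _]; first by rewrite !oddD => -> ->.
by rewrite mxE; move: (x 0 i) (y 0 i) => a b; lia.
Qed.

Lemma le_norm1 x i : (`|x 0%R i| <= norm1 x)%N.
Proof. by rewrite /norm1 (bigD1 i) //= leq_addr. Qed.

Lemma norm1_delta i : norm1 (delta_mx 0 i : 'rV[int]_d) = 1%N.
Proof.
rewrite /norm1 (bigD1 i) //= mxE !eqxx big1 // => j ji.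
by rewrite mxE (negbTE ji) andbF.
Qed.

Definition vertex : Type := ('rV[int]_d * nat)%type.
Definition step : Type := ('I_d * bool)%type.
HB.instance Definition _ := Finite.on step.

Definition dir (s : step) : 'rV[int]_d :=
  if s.2 then delta_mx 0 s.1 else - delta_mx 0 s.1.

Definition move_to (v : vertex) (s : step) : vertex := (v.1 + dir s, v.2.+1).

Lemma norm1_dir s : norm1 (dir s) = 1%N.
Proof. by rewrite /dir; case: s.2; rewrite ?norm1N norm1_delta. Qed.

Lemma XiE (v : vertex) : Xi v = ~~ odd (norm1 v.1 + v.2).
Proof. by rewrite /Xi !modn2; case: odd. Qed.

Lemma Xi_move v s : Xi v -> Xi (move_to v s).
Proof.
by rewrite !XiE /= !oddD odd_norm1D norm1_dir /=; do 2 case: odd.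
Qed.

Lemma is_edge_step v s : Xi v -> is_edge (v, move_to v s).
Proof.
move=> Xv; apply/and3P; split => //=; apply/existsP; exists s.1.
by rewrite /move_to /dir /=; case: s.2; rewrite eqxx ?orbT.
Qed.

Lemma edge_stepP (e : edge d) : Xi (source e) /\
  exists s, target e = move_to (source e) s.
Proof.
have /and3P[Xa /eqP b2 /existsP[i ab]] := valP e; split => //.
case/orP : ab => /eqP ab; [exists (i, true)|exists (i, false)];
  rewrite /target /source /move_to /dir /= -ab -b2; exact: surjective_pairing.
Qed.

Definition disp (ss : seq step) : 'rV[int]_d := \sum_(s <- ss) dir s.
Definition endp (v : vertex) (ss : seq step) : vertex :=
  (v.1 + disp ss, (v.2 + size ss)%N).

Lemma endp_nil v : endp v [::] = v.
Proof. by case: v => x t; rewrite /endp /disp big_nil addr0 addn0. Qed.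

Lemma endp_cons v s ss : endp v (s :: ss) = endp (move_to v s) ss.
Proof. by rewrite /endp /disp big_cons /= addrA addSnnS. Qed.

Lemma endp_cat v s1 s2 : endp v (s1 ++ s2) = endp (endp v s1) s2.
Proof. by rewrite /endp /disp big_cat /= addrA size_cat addnA. Qed.

Lemma disp_cat s1 s2 : disp (s1 ++ s2) = disp s1 + disp s2.
Proof. by rewrite /disp big_cat. Qed.

Lemma norm1_disp ss : (norm1 (disp ss) <= size ss)%N.
Proof.
elim: ss => [|s ss IH]; first by rewrite /disp big_nil norm1_0.
rewrite /disp big_cons; apply: leq_trans (norm1D_le _ _) _.
by rewrite norm1_dir /= add1n ltnS.
Qed.

Lemma odd_norm1_disp ss : odd (norm1 (disp ss)) = odd (size ss).
Proof.
elim: ss => [|s ss IH]; first by rewrite /disp big_nil norm1_0.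
by rewrite /disp big_cons odd_norm1D IH norm1_dir.
Qed.

Lemma Xi_endp v ss : Xi v -> Xi (endp v ss).
Proof.
elim: ss v => [|s ss IH] v Xv; first by rewrite endp_nil.
by rewrite endp_cons; apply/IH/Xi_move.
Qed.

(* Move towards the origin, or away from it when already there. *)
Lemma return_steps (i0 : 'I_d) n x : (norm1 x <= n)%N -> odd (norm1 x) = odd n ->
  exists2 ss : seq step, size ss = n & x + disp ss = 0.
Proof.
elim: n x => [|n IH] x.
  rewrite leqn0 => /eqP /norm1_eq0 -> _; exists [::] => //.
  by rewrite /disp big_nil addr0.
have [x0|/rV0Pn[i xi]] := eqVneq x 0.
  rewrite x0 norm1_0 => _; case: n IH => [|n] IH on.
    by exists [::] => //; rewrite add0r /disp big_nil.
  have [||ss sz e0] := IH (delta_mx 0 i0); first by rewrite norm1_delta.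
    by move: on; rewrite norm1_delta /=; case: (odd n).
  exists ((i0, true) :: ss); first by rewrite /= sz.
  by rewrite add0r /disp big_cons.
move=> xn on; pose s : step := (i, x 0 i < 0).
have nx : (norm1 (x + dir s)).+1 = norm1 x.
  rewrite /norm1 (bigD1 i) //= [RHS](bigD1 i) //= -addSn; congr addn.
    rewrite /s /dir /=; case: ifPn; rewrite !mxE !eqxx /=; move: (x 0 i) xi => a; lia.
  apply: eq_bigr => j ji; rewrite /dir /=.
  by case: ifPn; rewrite !mxE (negbTE ji) andbF; move: (x 0 j) => a _; lia.
have [||ss sz e0] := IH (x + dir s); first by rewrite -ltnS nx.
  by move: on; rewrite -nx /= => /negb_inj.
exists (s :: ss); first by rewrite /= sz.
by rewrite /disp big_cons addrA.
Qed.

End lattice.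

Section paths.
Context (d : nat) (i0 : 'I_d).
Local Notation vertex := (vertex d).
Local Notation step := (step d).
Implicit Types (v : vertex) (ss : seq step).

Fact Xi_origin : Xi (0 : 'rV[int]_d, 0%N).
Proof. by rewrite XiE /= norm1_0. Qed.

Definition origin_edge : edge d :=
  exist _ ((0, 0%N), move_to (0, 0%N) (i0, true))
    (is_edge_step (i0, true) Xi_origin).

(* Equal to origin_edge when v is not in Xi. *)
Definition mkedge v s : edge d := insubd origin_edge (v, move_to v s).

Lemma val_mkedge v s : Xi v -> val (mkedge v s) = (v, move_to v s).
Proof. by move=> Xv; rewrite /mkedge val_insubd is_edge_step. Qed.

Lemma source_mkedge v s : Xi v -> source (mkedge v s) = v.
Proof. by move=> Xv; rewrite /source val_mkedge. Qed.

Lemma target_mkedge v s : Xi v -> target (mkedge v s) = move_to v s.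
Proof. by move=> Xv; rewrite /target val_mkedge. Qed.

Lemma edge_mkedge (e : edge d) : exists s, e = mkedge (source e) s.
Proof.
have [Xe [s es]] := edge_stepP e; exists s; apply: val_inj.
by rewrite val_mkedge // -es; exact: surjective_pairing.
Qed.

Fixpoint edges v ss : seq (edge d) :=
  if ss is s :: ss' then mkedge v s :: edges (move_to v s) ss' else [::].

Lemma size_edges v ss : size (edges v ss) = size ss.
Proof. by elim: ss v => //= s ss IH v; rewrite IH. Qed.

Lemma edges_cat v s1 s2 : edges v (s1 ++ s2) = edges v s1 ++ edges (endp v s1) s2.
Proof.
elim: s1 v => [|s s1 IH] v /=; first by rewrite endp_nil.
by rewrite IH endp_cons.
Qed.

Lemma path_from_edges v ss : Xi v -> path_from v (edges v ss).
Proof.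
elim: ss v => //= s ss IH v Xv.
rewrite source_mkedge // eqxx target_mkedge //=; apply: IH; exact: Xi_move.
Qed.

Lemma path_from_steps v (g : seq (edge d)) : Xi v -> path_from v g ->
  exists2 ss, size ss = size g & g = edges v ss.
Proof.
elim: g v => [|e g IH] v Xv /=; first by exists [::].
move=> /andP[/eqP ev]; have [s es] := edge_mkedge e; rewrite ev in es.
rewrite es target_mkedge // => /(IH _ (Xi_move s Xv))[ss sz ->].
by exists (s :: ss); rewrite //= size_edges.
Qed.

(** Locates a path in time and space; the independence of different time slabs and of different
    tubes rests on it. *)
Lemma mem_edges v ss (e : edge d) : Xi v -> e \in edges v ss ->
  [/\ (v.2 <= (source e).2)%N, ((source e).2 < v.2 + size ss)%N &
      (norm1 ((source e).1 - v.1) <= (source e).2 - v.2)%N].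
Proof.
elim: ss v => //= s ss IH v Xv; rewrite inE => /orP[/eqP ->|].
  by rewrite source_mkedge // leqnn addnS ltnS leq_addr subrr norm1_0.
move=> /(IH _ (Xi_move s Xv))[/= t1 t2 t3]; split; [lia|lia|].
have -> : (source e).1 - v.1 = (source e).1 - (v.1 + dir s) + dir s.
  by rewrite opprD addrA addrNK.
by apply: leq_trans (norm1D_le _ _) _; rewrite norm1_dir; lia.
Qed.

Lemma uniq_edges v ss : Xi v -> uniq (edges v ss).
Proof.
elim: ss v => //= s ss IH v Xv; rewrite (IH _ (Xi_move s Xv)) andbT.
apply/negP => /(mem_edges (Xi_move s Xv)) [+ _ _].
by rewrite source_mkedge //= ltnn.
Qed.

Section weight.
Context (R : realType).
Implicit Type c : conf (edge d) R.

Definition weight c v ss : R := \sum_(e <- edges v ss) c e.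

Lemma weightE c v s : weight c v s = \sum_(e <- edges v s) c e.
Proof. by []. Qed.

Lemma weight_nil c v : weight c v [::] = 0.
Proof. by rewrite /weight big_nil. Qed.

Lemma weight_cat c v s1 s2 :
  weight c v (s1 ++ s2) = weight c v s1 + weight c (endp v s1) s2.
Proof. by rewrite /weight edges_cat big_cat. Qed.

(** An arbitrary fixed path: the seed of the maxima below, and the fallback path in
    [longest_mean]. *)
Definition zigzag_step n : n.-tuple step := nseq_tuple n (i0, true).

(** [phi] is a reward at the end point: zero gives the passage time, and a negative quadratic
    function keeps the optimal path near the origin. *)
Definition best (phi : vertex -> R) n c v : R :=
  pmax predT (zigzag_step n)
    (fun ss : n.-tuple step => weight c v ss + phi (endp v ss)).

Lemma best_ge phi n c v ss : size ss = n ->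
  weight c v ss + phi (endp v ss) <= best phi n c v.
Proof.
move=> sz; pose t : n.-tuple step := tcast sz (in_tuple ss).
have -> : ss = t by rewrite val_tcast.
exact: (@pmax_ge _ _ predT (zigzag_step n)
  (fun ss : n.-tuple step => weight c v ss + phi (endp v ss))).
Qed.

Lemma best_attained phi n c v : exists2 ss, size ss = n &
  best phi n c v = weight c v ss + phi (endp v ss).
Proof.
have [ss _ e] := @pmax_attained _ _ predT (zigzag_step n)
  (fun ss : n.-tuple step => weight c v ss + phi (endp v ss)) isT.
by exists ss => //; rewrite size_tuple.
Qed.

Definition longest := best (fun=> 0).

Lemma longest_ge n c v ss : size ss = n -> weight c v ss <= longest n c v.
Proof. by move=> sz; have := best_ge (fun=> 0) c v sz; rewrite addr0. Qed.

Lemma longest_attained n c v : exists2 ss, size ss = n &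
  longest n c v = weight c v ss.
Proof.
by have [ss sz] := best_attained (fun=> 0) n c v; rewrite addr0; exists ss.
Qed.

(** Replaces a supremum over sequences of edges by a maximum over the finite type of step
    sequences. *)
Lemma passage_longest (T : Type) (X : edge d -> T -> R) n (w : T) :
  passage X n w = longest n (X ^~ w) (0, 0%N).
Proof.
have X0 := Xi_origin.
set S := [set \sum_(e <- g) X e w | g in @paths d n].
have Sge x : S x -> x <= longest n (X ^~ w) (0, 0%N).
  move=> [g gp <-]; have [ss sz ->] := path_from_steps X0 gp.
  by apply: longest_ge; rewrite sz size_tuple.
have SL : S (longest n (X ^~ w) (0, 0%N)).
  have [ss sz ->] := longest_attained n (X ^~ w) (0, 0%N).
  have sze : size (edges (0, 0%N) ss) = n by rewrite size_edges.
  exists (tcast sze (in_tuple (edges (0, 0%N) ss))).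
    by rewrite /paths /= val_tcast; exact: path_from_edges.
  by rewrite /weight val_tcast.
apply/eqP; rewrite eq_le; apply/andP; split.
  by apply: ge_sup => //; exists (longest n (X ^~ w) (0, 0%N)).
by apply: ub_le_sup => //; exists (longest n (X ^~ w) (0, 0%N)).
Qed.

End weight.

End paths.

(** * Invariance under lattice symmetries *)

Section symmetry.
Context (d : nat) (i0 : 'I_d) (R : realType).
Local Notation vertex := (vertex d).
Local Notation step := (step d).
Local Notation mkedge := (mkedge i0).
Local Notation edges := (edges i0).
Local Notation weight := (weight i0).

Lemma weight_depends (A : set (edge d)) (v : vertex) (ss : seq step) :
  (forall e, e \in edges v ss -> A e) ->
  depends_on A (fun c : conf (edge d) R => weight c v ss).
Proof.
by move=> sA c c' cc'; apply: eq_big_seq => e /sA; exact: cc'.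
Qed.

Section edge_map.
Variables (F : vertex -> vertex) (g : step -> step).
Hypothesis F_Xi : forall v, Xi v -> Xi (F v).
Hypothesis F_move : forall v s, F (move_to v s) = move_to (F v) (g s).

(** The action on edges of a lattice symmetry that acts by [F] on vertices and by [g] on steps, in
    the form that [relabel] expects. *)
Definition edge_map (e : edge d) : edge d :=
  insubd (origin_edge i0) (F (source e), F (target e)).

Lemma edge_map_mkedge v s : Xi v -> edge_map (mkedge v s) = mkedge (F v) (g s).
Proof.
move=> Xv; rewrite /edge_map source_mkedge // target_mkedge // F_move.
by [].
Qed.

Lemma edge_map_inj : injective F -> injective edge_map.
Proof.
move=> F_inj e e'.
have [s es] := edge_mkedge i0 e; have [s' es'] := edge_mkedge i0 e'.
have Xe := (edge_stepP e).1; have Xe' := (edge_stepP e').1.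
rewrite es es' !edge_map_mkedge // => /(congr1 val) H; apply: val_inj; move: H.
rewrite !val_mkedge //; try exact: F_Xi.
rewrite -!F_move => H.
by congr pair; [apply: F_inj; exact: (congr1 fst H)|
                apply: F_inj; exact: (congr1 snd H)].
Qed.

Lemma weight_relabel (c : conf (edge d) R) v ss : Xi v ->
  weight (relabel edge_map c) v ss = weight c (F v) (map g ss).
Proof.
elim: ss v => [|s ss IH] v Xv; first by rewrite !weight_nil.
have := IH _ (Xi_move s Xv); rewrite /weight /= !big_cons F_move => ->.
by rewrite /relabel edge_map_mkedge.
Qed.

End edge_map.

Definition vadd (u v : vertex) : vertex := (u.1 + v.1, (u.2 + v.2)%N).
Definition reflect_at (x : 'rV[int]_d) (v : vertex) : vertex := (x + x - v.1, v.2).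
Definition flip (s : step) : step := (s.1, ~~ s.2).

Lemma vadd_Xi u : Xi u -> forall v, Xi v -> Xi (vadd u v).
Proof. by move=> + v; rewrite !XiE /= !oddD odd_norm1D; do 4 case: odd. Qed.

Lemma vadd_move u v s : vadd u (move_to v s) = move_to (vadd u v) (id s).
Proof. by rewrite /vadd /move_to /= addrA addnS. Qed.

Lemma vadd_inj u : injective (vadd u).
Proof. by move=> [x t] [y r] [/addrI -> /addnI ->]. Qed.

Lemma reflect_Xi x v : Xi v -> Xi (reflect_at x v).
Proof. by rewrite !XiE /= !oddD !odd_norm1D norm1N addbb. Qed.

Lemma reflect_move x v s :
  reflect_at x (move_to v s) = move_to (reflect_at x v) (flip s).
Proof.
rewrite /reflect_at /move_to /dir /= opprD addrA; congr (_ + _, _).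
by case: s.2; rewrite //= opprK.
Qed.

Lemma reflect_inj x : injective (reflect_at x).
Proof. by move=> [y t] [z r] [/addrI/oppr_inj -> ->]. Qed.

Lemma disp_flip (ss : seq step) : disp (map flip ss) = - disp ss.
Proof.
rewrite /disp big_map -sumrN; apply: eq_bigr => s _.
by rewrite /dir /=; case: s.2 => //=; rewrite opprK.
Qed.

Definition sqnorm (x : 'rV[int]_d) : R := \sum_(i < d) ((x 0 i)%:~R) ^+ 2.

Lemma sqnorm_ge0 x : 0 <= sqnorm x.
Proof. by apply: sumr_ge0 => i _; exact: sqr_ge0. Qed.

Lemma sqnorm_parallelogram x z :
  sqnorm (x + z) + sqnorm (x - z) = 2 * sqnorm x + 2 * sqnorm z.
Proof.
rewrite /sqnorm -big_split /= !mulr_sumr -big_split /=; apply: eq_bigr => i _.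
by rewrite !mxE !rmorphD /= rmorphN /=; ring.
Qed.

Lemma sqnorm_le x : sqnorm x <= (norm1 x)%:R ^+ 2.
Proof.
rewrite /sqnorm /norm1 natr_sum expr2 mulr_suml; apply: ler_sum => i _.
have -> : ((x 0%R i)%:~R : R) ^+ 2 = `|x 0%R i|%N%:R * `|x 0%R i|%N%:R.
  by rewrite natr_absz -expr2 intr_norm real_normK ?num_real.
by apply: ler_wpM2l => //; rewrite -natr_sum ler_nat le_norm1.
Qed.

Lemma sqnorm_disp (ss : seq step) : sqnorm (disp ss) <= (size ss)%:R ^+ 2.
Proof.
apply: le_trans (sqnorm_le _) _.
by rewrite ler_sqr ?nnegrE ?ler0n// ler_nat norm1_disp.
Qed.

End symmetry.

(** * Exponential moments *)

Section coordinates.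
Context (I : choiceType) (R : realType).
Local Notation conf := (conf I R).
Variables (Q : probability conf R) (nu : set R -> \bar R).
Hypothesis QE : forall (s : {fset I}) (A : I -> set R),
  (forall i, measurable (A i)) -> Q (cylinder s A) = (\prod_(i <- s) nu (A i))%E.

Definition coord (i : I) (c : conf) : R := c i.
HB.instance Definition _ i :=
  isMeasurableFun.Build _ _ _ _ (coord i) (conf_eval_measurable i).

Lemma coord_law i (A : set R) : measurable A -> Q [set c | A (c i)] = nu A.
Proof.
move=> mA; transitivity (Q (cylinder [fset i]%fset (fun=> A))); last by rewrite QE // big_seq_fset1.
congr (Q _); apply/seteqP; split => c /=.
  by move=> Ac j /fset1P ->.
by apply; exact/fset1P.
Qed.

Lemma ge0_integral_coord i j (g : R -> \bar R) : measurable_fun setT g ->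
  (forall x, 0 <= g x)%E -> (\int[Q]_c g (c i) = \int[Q]_c g (c j))%E.
Proof.
move=> mg g0.
have := @ge0_integral_distribution _ _ _ _ R Q (coord i) g mg g0.
have := @ge0_integral_distribution _ _ _ _ R Q (coord j) g mg g0.
move=> /= <- <-; apply: eq_measure_integral => A mA _.
exact: etrans (coord_law i mA) (esym (coord_law j mA)).
Qed.

Lemma integral_exp_sum (s : seq I) (b : I -> R) : uniq s ->
  (\int[Q]_c (expR (\sum_(i <- s) b i * c i))%:E =
   \prod_(i <- s) \int[Q]_c (expR (b i * c i))%:E)%E.
Proof.
move=> us.
rewrite -(independent_prod QE (B := fun i => [set i])
  (F := fun i (c : conf) => (expR (b i * c i))%:E)) //.
- apply: eq_integral => c _; by rewrite prodEFin expR_sum.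
- move=> i _; apply/measurable_EFinP; apply: measurableT_comp => //.
  by apply: measurable_funM; [exact: measurable_cst|exact: conf_eval_measurable].
- by move=> i _ c c' cc' /=; rewrite cc'.
- move=> i j _ _ ij; apply/seteqP; split => // k [/= -> /eqP].
  by rewrite (negbTE ij).
Qed.

End coordinates.

Section exp_bounds.
Context (R : realType).
Implicit Types x y : R.

Lemma norm_le_expR x : `|x| <= expR x + expR (- x).
Proof.
have := expR_ge1Dx x; have := expR_ge1Dx (- x).
have := expR_gt0 x; have := expR_gt0 (- x).
by move=> ? ? ? ?; rewrite ler_norml; apply/andP; split; lra.
Qed.

Lemma sqr_le_expR x : x ^+ 2 <= 4 * (expR x + expR (- x)).
Proof.
have H y : 0 <= y -> y ^+ 2 <= 4 * expR y.
  move=> y0; have -> : expR y = expR (y / 2) ^+ 2.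
    by rewrite -expRM_natl -mulr_natl mulrCA divff ?mulr1.
  have h := expR_ge1Dx (y / 2).
  have -> : y ^+ 2 = 4 * (y / 2) ^+ 2 by field.
  by rewrite ler_pM2l // ler_sqr ?nnegrE; [lra|lra|exact: expR_ge0].
have [x0|x0] := leP 0 x.
  by apply: le_trans (H _ x0) _; rewrite ler_pM2l // lerDl expR_ge0.
rewrite -sqrrN; apply: le_trans (H (- x) _) _; first by lra.
by rewrite ler_pM2l // lerDr expR_ge0.
Qed.

(** Complete the square in [2 a |x| - 1]. A small [a] makes the quadratic term cheap. *)
Lemma norm_le_sqr (a : R) x : 0 < a -> `|x| <= a * x ^+ 2 + (4 * a)^-1.
Proof.
move=> a0; rewrite -(@ler_pM2l _ (4 * a)) ?mulr_gt0 //.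
rewrite mulrDr mulfV ?gt_eqF ?mulr_gt0 // -[x ^+ 2]real_normK ?num_real //.
by have := sqr_ge0 (2 * a * `|x| - 1); move: (`|x|) => y H; nra.
Qed.

End exp_bounds.

Section environment.
Context (d : nat) (i0 : 'I_d) (R : realType).
Local Notation conf := (conf (edge d) R).
Local Notation vertex := (vertex d).
Local Notation step := (step d).
Local Notation weight := (weight i0).
Local Notation best := (best i0).
Local Notation longest := (longest i0).
Local Notation edges := (edges i0).
Variables (Q : probability conf R) (nu : set R -> \bar R).
Hypothesis QE : forall (s : {fset edge d}) (A : edge d -> set R),
  (forall i, measurable (A i)) -> Q (cylinder s A) = (\prod_(i <- s) nu (A i))%E.
Variable c0 : R.
Hypothesis c0_gt0 : 0 < c0.
Hypothesis Q_exp : forall e (a : R), `|a| < c0 ->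
  (\int[Q]_c (expR (a * c e))%:E < +oo)%E.
Hypothesis Q_mean : forall e, \int[Q]_c c e = 0.

Lemma measurable_expR_coord (a : R) (e : edge d) :
  measurable_fun setT (fun c : conf => expR (a * c e)).
Proof.
apply: measurableT_comp => //.
by apply: measurable_funM; [exact: measurable_cst|exact: conf_eval_measurable].
Qed.

Lemma expR_coord_rint (a : R) e : `|a| < c0 -> rint Q (fun c => expR (a * c e)).
Proof.
move=> ac0; apply/integrableP; split.
  by apply/measurable_EFinP; exact: measurable_expR_coord.
by under eq_integral do rewrite /= ger0_norm ?expR_ge0//; exact: Q_exp.
Qed.

Let half_c0 : 0 < c0 / 2. Proof. by rewrite divr_gt0. Qed.

Let half_lt : c0 / 2 < c0.
Proof. by rewrite ltr_pdivrMr // ltr_pMr // ltr1n. Qed.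

Let cosh_rint e : rint Q (fun c => expR (c0 / 2 * c e) + expR (- (c0 / 2 * c e))).
Proof.
apply: rintD; first by apply: expR_coord_rint; rewrite gtr0_norm.
have -> : (fun c : conf => expR (- (c0 / 2 * c e))) = fun c => expR (- (c0 / 2) * c e).
  by apply/funext => c; rewrite mulNr.
by apply: expR_coord_rint; rewrite normrN gtr0_norm.
Qed.

Lemma coord_rint e : rint Q (fun c => c e).
Proof.
apply: (rint_le _ _ (rintZ (c0 / 2)^-1 (cosh_rint e))).
  exact: conf_eval_measurable.
move=> c; rewrite [leRHS]ger0_norm; last first.
  by rewrite mulr_ge0 ?invr_ge0 ?addr_ge0 ?expR_ge0 // ltW.
rewrite ler_pdivlMl // -[X in X * _]gtr0_norm // -normrM.
exact: norm_le_expR.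
Qed.

Lemma coord_sqr_rint e : rint Q (fun c => c e ^+ 2).
Proof.
apply: (rint_le _ _ (rintZ ((c0 / 2) ^+ 2)^-1 (rintZ 4 (cosh_rint e)))).
  by apply: measurable_funX; exact: conf_eval_measurable.
move=> c; rewrite [leRHS]ger0_norm; last first.
  by rewrite !mulr_ge0 ?invr_ge0 ?exprn_ge0 ?addr_ge0 ?expR_ge0 // ltW.
rewrite ger0_norm ?sqr_ge0 // ler_pdivlMl ?exprn_gt0 // -exprMn.
exact: sqr_le_expR.
Qed.

Lemma weight_measurable v ss : measurable_fun setT (fun c : conf => weight c v ss).
Proof. by apply: measurable_sum => e; exact: conf_eval_measurable. Qed.

Lemma weight_rint v ss : rint Q (fun c => weight c v ss).
Proof. by apply: rint_sum => e _; exact: coord_rint. Qed.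

Lemma Rintegral_weight v ss : \int[Q]_c weight c v ss = 0.
Proof.
rewrite (@Rintegral_sum _ _ _ Q _ (edges v ss) predT (fun e c => c e)).
  by rewrite big1 // => e _; exact: Q_mean.
by move=> e _; exact: coord_rint.
Qed.

Lemma best_rint phi n v : rint Q (fun c => best phi n c v).
Proof.
apply: (@rint_pmax _ _ _ Q _ predT (zigzag_step i0 n)
  (fun (ss : n.-tuple step) c => weight c v ss + phi (endp v ss))) => // ss _.
by apply: rintD; [exact: weight_rint|exact: rint_cst].
Qed.

Lemma longest_rint n v : rint Q (fun c => longest n c v).
Proof. exact: best_rint. Qed.

Lemma Rintegral_longest n v : Xi v ->
  \int[Q]_c longest n c v = \int[Q]_c longest n c (0, 0%N).
Proof.
move=> Xv; have inj := edge_map_inj (i0 := i0) (vadd_Xi Xv) (vadd_move v) (@vadd_inj _ v).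
have [_ <-] := Rintegral_relabel QE inj (longest_rint n (0, 0%N)).
congr Rintegral; apply/funext => c; apply: eq_pmax => ss.
rewrite (weight_relabel i0 (vadd_move v)) ?Xi_origin //.
have -> : vadd v (0, 0%N) = v by rewrite /vadd /= addr0 addn0 -surjective_pairing.
by rewrite map_id.
Qed.

Definition penalty (lam : R) (v : vertex) : R := - (lam * sqnorm R v.1).

(* Averaging over the reflection at the starting point cancels the cross term
   of the penalty at the end point. *)
Lemma best_penalty_step lam L v : 0 <= lam -> Xi v ->
  \int[Q]_c longest L c (0, 0%N) - lam * L%:R ^+ 2 + penalty lam v <=
  \int[Q]_c best (penalty lam) L c v.
Proof.
move=> lam0 Xv; pose F := reflect_at v.1.
have inj := edge_map_inj (i0 := i0) (@reflect_Xi _ v.1) (reflect_move v.1)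
  (@reflect_inj _ v.1).
set rho := edge_map _ _ in inj.
have [rb eb] := Rintegral_relabel QE inj (best_rint (penalty lam) L v).
have H c : 2 * (longest L c v + (penalty lam v - lam * L%:R ^+ 2)) <=
    best (penalty lam) L c v + best (penalty lam) L (relabel rho c) v.
  have [ss sz ->] := longest_attained i0 L c v.
  have h1 := best_ge i0 (penalty lam) c v sz.
  have sz' : size (map (@flip d) ss) = L by rewrite size_map.
  have h2 := best_ge i0 (penalty lam) (relabel rho c) v sz'.
  have Fv : F v = v by rewrite /F /reflect_at addrK; case: (v).
  rewrite (weight_relabel i0 (reflect_move v.1)) // -/F Fv in h2.
  rewrite -map_comp (@eq_map _ _ _ id) ?map_id in h2; last first.
    by move=> [i b]; rewrite /flip /= negbK.
  apply: le_trans (lerD h1 h2).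
  rewrite /penalty /endp /= disp_flip.
  have := sqnorm_parallelogram R v.1 (disp ss).
  have := sqnorm_disp R ss; rewrite sz.
  move: (sqnorm _ _) (sqnorm _ _) (sqnorm _ _) (sqnorm _ _) (_ ^+ 2) (weight _ _ _).
  by move=> a b' e g k w; nra.
have rL : rint Q (fun c => 2 * (longest L c v + (penalty lam v - lam * L%:R ^+ 2))).
  by apply/rintZ/rintD; [exact: longest_rint|exact: rint_cst].
have := le_Rintegral measurableT rL (rintD (best_rint (penalty lam) L v) rb) (fun c _ => H c).
rewrite RintegralD //; [|exact: best_rint].
rewrite eb RintegralZl //; last by apply: rintD; [exact: longest_rint|exact: rint_cst].
rewrite RintegralD //; [|exact: longest_rint|exact: rint_cst].
rewrite Rintegral_const Rintegral_longest //.
by move: (Rintegral _ _ _) (Rintegral _ _ _) (penalty _ _) (lam * _) => a b e g; lra.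
Qed.

(** The penalty acts as a potential along blocks of [L] steps: by [best_penalty_step] each block
    loses only [lam L ^ 2] and hands the penalty at its end point on to the next. As the later
    blocks use later edges, [pmax_jensen] replaces them by their mean. *)
Lemma best_penalty_chain lam L K v : 0 <= lam -> Xi v ->
  K%:R * (\int[Q]_c longest L c (0, 0%N) - lam * L%:R ^+ 2) + penalty lam v <=
  \int[Q]_c best (penalty lam) (L * K)%N c v.
Proof.
move=> lam0; elim: K v => [|K IH] v Xv.
  rewrite muln0 mul0r add0r -[leLHS](Rintegral_const Q).
  apply: le_Rintegral => //; [exact: rint_cst|exact: best_rint|move=> c _].
  by have := best_ge i0 (penalty lam) c v (erefl (size [::])); rewrite weight_nil add0r endp_nil.
set z := (_ - _) in IH *.
pose G (ss : L.-tuple step) (c : conf) := best (penalty lam) (L * K)%N c (endp v ss).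
pose A := [set e : edge d | ((source e).2 < v.2 + L)%N].
have dG ss : depends_on (~` A) (G ss).
  move=> c c' cc'; apply: eq_pmax => rr; congr (_ + _).
  apply: (weight_depends (A := ~` A)) cc' => e.
  move=> /(mem_edges (Xi_endp ss Xv))[+ _ _].
  by rewrite /A /= size_tuple => h; apply/negP; rewrite -leqNgt.
have dF (ss : L.-tuple step) : depends_on A (fun c : conf => weight c v ss).
  apply: weight_depends => e /(mem_edges Xv)[_ + _].
  by rewrite size_tuple.
have J := @pmax_jensen _ _ Q nu QE A _ predT (zigzag_step i0 L)
  (fun ss c => weight c v ss) G isT
  (fun ss _ => weight_rint v ss) (fun ss _ => best_rint _ _ _)
  (fun ss _ => dF ss) (fun ss _ => dG ss).
have rG : rint Q (fun c => pmax predT (zigzag_step i0 L) (fun ss => weight c v ss + G ss c)).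
  apply: rint_pmax => // ss _; apply: rintD; [exact: weight_rint|exact: best_rint].
have le1 : \int[Q]_c pmax predT (zigzag_step i0 L) (fun ss => weight c v ss + G ss c) <=
   \int[Q]_c best (penalty lam) (L * K.+1)%N c v.
  apply: le_Rintegral => //; first exact: best_rint.
  move=> c _; apply: pmax_le => // ss _.
  rewrite /G; have [rr sz ->] := best_attained i0 (penalty lam) (L * K) c (endp v ss).
  rewrite addrA -weight_cat -endp_cat; apply: best_ge.
  by rewrite size_cat size_tuple sz mulnS.
apply: le_trans le1; apply: le_trans J.
have rbz : rint Q (fun c => K%:R * z + best (penalty lam) L c v).
  by apply: rintD; [exact: rint_cst|exact: best_rint].
apply: (@le_trans _ _ (\int[Q]_c (K%:R * z + best (penalty lam) L c v))).
  rewrite RintegralD //; [|exact: rint_cst|exact: best_rint].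
  rewrite Rintegral_const; have := best_penalty_step L lam0 Xv.
  by rewrite -/z -natr1 => h; rewrite mulrDl mul1r -addrA lerD2l.
apply: le_Rintegral => //.
  apply: rint_pmax => // ss _; apply: rintD; [exact: weight_rint|exact: rint_cst].
move=> c _; have [ss sz ->] := best_attained i0 (penalty lam) L c v.
pose t : L.-tuple step := tcast sz (in_tuple ss).
have -> : ss = t by rewrite val_tcast.
apply: le_trans (@pmax_ge _ _ predT _ _ t isT) => /=.
by have := IH _ (Xi_endp t Xv); rewrite /G; move: (Rintegral _ _ _) => a; lra.
Qed.

End environment.

(** * Loops with large mean weight *)

Section tube.
Context (d : nat) (i0 : 'I_d) (R : realType).
Local Notation conf := (conf (edge d) R).
Local Notation step := (step d).
Local Notation weight := (weight i0).
Local Notation best := (best i0).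
Local Notation longest := (longest i0).
Local Notation edges := (edges i0).
Variables (Q : probability conf R) (nu : set R -> \bar R).
Hypothesis QE : forall (s : {fset edge d}) (A : edge d -> set R),
  (forall i, measurable (A i)) -> Q (cylinder s A) = (\prod_(i <- s) nu (A i))%E.
Variable c0 : R.
Hypothesis c0_gt0 : 0 < c0.
Hypothesis Q_exp : forall e (a : R), `|a| < c0 ->
  (\int[Q]_c (expR (a * c e))%:E < +oo)%E.
Hypothesis Q_mean : forall e, \int[Q]_c c e = 0.

Local Notation e0 := (origin_edge i0).

Definition mgf (b : R) : R := \int[Q]_c expR (b * c e0).

Lemma integral_expR_coord b e : `|b| < c0 ->
  (\int[Q]_c (expR (b * c e))%:E = (mgf b)%:E)%E.
Proof.
move=> bc; rewrite EFin_Rintegral; last by apply: (expR_coord_rint Q_exp).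
apply: (ge0_integral_coord QE e e0 (g := fun x => (expR (b * x))%:E)).
  apply/measurable_EFinP; apply: (measurableT_comp (f := @expR R) (g := *%R b)) => //.
by move=> x; rewrite lee_fin expR_ge0.
Qed.

Lemma integral_expR_weight b v ss : `|b| < c0 -> Xi v ->
  (\int[Q]_c (expR (b * weight c v ss))%:E = (mgf b ^+ size ss)%:E)%E.
Proof.
move=> bc Xv.
under eq_integral do rewrite weightE mulr_sumr.
rewrite (integral_exp_sum QE (fun=> b)) ?uniq_edges //.
rewrite (eq_bigr (fun=> (mgf b)%:E)); last by move=> e _; exact: integral_expR_coord.
by rewrite prodEFin big_const_seq count_predT iter_mulr_1 size_edges.
Qed.

Lemma mgf_ge0 b : 0 <= mgf b.
Proof. by apply: Rintegral_ge0 => c _; exact: expR_ge0. Qed.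

Lemma expR_weight_rint b v ss : `|b| < c0 -> Xi v ->
  rint Q (fun c => expR (b * weight c v ss)).
Proof.
move=> bc Xv; apply/integrableP; split.
  apply/measurable_EFinP; apply: measurableT_comp => //.
  by apply: measurable_funM; [exact: measurable_cst|exact: weight_measurable].
under eq_integral do rewrite /= ger0_norm ?expR_ge0//.
by rewrite integral_expR_weight // ltry.
Qed.

Lemma Rintegral_expR_weight b v ss : `|b| < c0 -> Xi v ->
  \int[Q]_c expR (b * weight c v ss) = mgf b ^+ size ss.
Proof. by move=> bc Xv; rewrite /Rintegral integral_expR_weight. Qed.

Variable mu : R.
Hypothesis lower_prob : forall eps del : R, 0 < eps -> 0 < del ->
  exists N, forall n, (N <= n)%N ->
    (Q [set c | longest n c (0, 0%N) < (mu - eps) * n%:R]%R <= del%:E)%E.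

Lemma Rintegral_coord_sqr e : \int[Q]_c (c e ^+ 2) = \int[Q]_c (c e0 ^+ 2).
Proof.
rewrite /Rintegral; congr fine.
apply: (ge0_integral_coord QE e e0 (g := fun x => (x ^+ 2)%:E)).
  by apply/measurable_EFinP; exact: measurable_funX.
by move=> x; rewrite lee_fin sqr_ge0.
Qed.

(** Convergence in probability alone does not control the mean. On the bad event [B] the maximum is
    bounded below by the weight of one fixed path, and [norm_le_sqr] splits this weight into a small
    multiple of squares and a multiple of the indicator of [B]. *)
Lemma longest_mean eps : 0 < eps -> exists N, forall L, (N <= L)%N ->
  (mu - eps) * L%:R <= \int[Q]_c longest L c (0, 0%N).
Proof.
move=> eps0; pose sig := \int[Q]_c (c e0 ^+ 2).
have sig0 : 0 <= sig by apply: Rintegral_ge0 => c _; exact: sqr_ge0.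
(* [eta] makes the squares cost at most [eps / 4] per step in mean. *)
pose m := mu - eps / 2; pose eta := eps / (4 * (sig + 1)).
have eta0 : 0 < eta by rewrite divr_gt0 // mulr_gt0 // ltr_wpDl.
(* The loss per step on [B]: the missing [m] and the constant of [norm_le_sqr]. The probability of
   [B] is taken at most [eps / (4 k)]. *)
pose k := `|m| + (4 * eta)^-1.
have k0 : 0 < k by rewrite ltr_wpDl // invr_gt0 mulr_gt0.
have [N HN] := lower_prob (divr_gt0 eps0 (ltr0n _ 2)) (divr_gt0 eps0 (mulr_gt0 (ltr0n R 4) k0)).
exists N => L /HN; rewrite -/m.
set B := [set c | _] => QB.
have rL := longest_rint i0 c0_gt0 Q_exp L (0, 0%N).
have mB : measurable B.
  rewrite (_ : B = setT `&` (fun c => longest L c (0, 0%N)) @^-1` `]-oo, m * L%:R[%classic).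
    by apply: (rint_measurable rL).
  by rewrite setTI; apply/seteqP; split => c /=; rewrite in_itv.
pose iB (c : conf) : R := \1_B c.
have riB : rint Q iB by exact: integrable_indic.
pose p := \int[Q]_c iB c.
have pE : p = fine (Q B).
  by rewrite /p /Rintegral integral_indic // setIT.
have p0 : 0 <= p by rewrite pE fine_ge0.
have pk : p * k <= eps / 4.
  rewrite -ler_pdivlMr // -mulrA -invfM -lee_fin pE fineK //.
  exact: fin_num_measure.
pose es := edges (0, 0%N) (zigzag_step i0 L).
pose g e c := eta * c e ^+ 2 + (4 * eta)^-1 * iB c.
have rg e : rint Q (g e).
  by apply: rintD; apply: rintZ => //; exact: (coord_sqr_rint c0_gt0 Q_exp).
have r1 : rint Q (fun c => m * L%:R * (1 - iB c)).
  by apply: rintZ; apply: rintB => //; exact: rint_cst.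
have r2 : rint Q (fun c => \sum_(e <- es) g e c) by apply: rint_sum => e _.
have H c : m * L%:R * (1 - iB c) - \sum_(e <- es) g e c <= longest L c (0, 0%N).
  rewrite /g /iB indicE; have [cB|cB] := boolP (c \in B).
    rewrite subrr mulr0 sub0r mulr1.
    apply: (@le_trans _ _ (weight c (0, 0%N) (zigzag_step i0 L))); last first.
      by apply: longest_ge; rewrite size_tuple.
    rewrite weightE -sumrN; apply: ler_sum => e _.
    have := norm_le_sqr (c e) eta0; rewrite lerNl; apply: le_trans.
    by rewrite -normrN ler_norm.
  rewrite subr0 mulr1 mulr0.
  have : m * L%:R <= longest L c (0, 0%N).
    by rewrite leNgt; apply: contra cB => h; rewrite inE.
  apply: le_trans; rewrite gerBl; apply: sumr_ge0 => e _.
  by rewrite addr0 mulr_ge0 ?sqr_ge0 // ltW.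
have := le_Rintegral measurableT (rintB r1 r2) rL (fun c _ => H c).
apply: le_trans.
rewrite RintegralB // RintegralZl //; last by apply: rintB => //; exact: rint_cst.
rewrite RintegralB //; last exact: rint_cst.
rewrite Rintegral_const (@Rintegral_sum _ _ _ Q _ es predT) //.
rewrite (eq_bigr (fun=> eta * sig + (4 * eta)^-1 * p)); last first.
  move=> e _; rewrite /g RintegralD //; try exact: rintZ.
    rewrite !RintegralZl // ?Rintegral_coord_sqr //.
    exact: (coord_sqr_rint c0_gt0 Q_exp).
  by apply: rintZ; exact: (coord_sqr_rint c0_gt0 Q_exp).
rewrite big_const_seq count_predT size_edges size_tuple iter_addr_0 -[X in _ <= _ - X]mulr_natr.
have es4 : eta * sig <= eps / 4.
  rewrite /eta -mulrA ler_pM2l // invfM -mulrA -[leRHS]mulr1 ler_pM2l ?invr_gt0 //.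
  by rewrite ler_pdivrMl ?ltr_wpDl // mulr1 lerDl.
have mp : m * p <= `|m| * p by rewrite ler_wpM2r // ler_norm.
rewrite -/p /k mulrDr in pk *.
rewrite mulrAC -mulrBl ler_wpM2r //.
have -> : mu - eps = m - eps / 4 - eps / 4 by rewrite /m; lra.
move: es4 pk mp; move: ((4 * eta)^-1) (eta * sig) (`|m|) (eps / 4) => a b' e q.
by move=> h1 h2 h3; lra.
Qed.

Definition loop_best h (t0 : h.-tuple step) (c : conf) v : R :=
  pmax (fun ss : h.-tuple step => disp ss == 0) t0 (fun ss => weight c v ss).

Lemma loop_best_rint h (t0 : h.-tuple step) v : disp t0 == 0 ->
  rint Q (fun c => loop_best t0 c v).
Proof. by move=> t00; apply: rint_pmax => // ss _; exact: (weight_rint i0 c0_gt0 Q_exp). Qed.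

(** One of the [d] coordinates exceeds [T / d] in absolute value. *)
Lemma sqnorm_far (y : 'rV[int]_d) T : (T < norm1 y)%N ->
  (T%:R / d%:R) ^+ 2 <= sqnorm R y.
Proof.
move=> Ty; have d0 : (0 < d)%N by exact: leq_ltn_trans (ltn_ord i0).
have [i Ti] : exists i, (T < `|y 0%R i| * d)%N.
  apply/existsP; apply: contraLR Ty; rewrite negb_exists -leqNgt => /forallP H.
  rewrite -(leq_pmul2r d0) /norm1 big_distrl /=.
  apply: (@leq_trans (\sum_(i < d) T)); last by rewrite sum_nat_const card_ord mulnC.
  by apply: leq_sum => i _; rewrite leqNgt.
have d0R : 0 < d%:R :> R by rewrite ltr0n.
apply: (@le_trans _ _ (((y 0 i)%:~R : R) ^+ 2)).
  rewrite -[leRHS]real_normK ?num_real // ler_sqr ?nnegrE ?divr_ge0 //.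
  rewrite ler_pdivrMr // -intr_norm -natr_absz -natrM ler_nat.
  exact: ltnW.
rewrite /sqnorm (bigD1 i) //= lerDl; apply: sumr_ge0 => j _; exact: sqr_ge0.
Qed.

Lemma zero_steps h : ~~ odd h -> exists t0 : h.-tuple step, disp t0 == 0.
Proof.
move=> oh; have [||ss sz] := @return_steps d i0 h 0; rewrite ?norm1_0 //=.
  by rewrite (negbTE oh).
rewrite add0r => ss0; exists (tcast sz (in_tuple ss)).
by rewrite val_tcast /= ss0.
Qed.

(** A path that ends within distance [T] is closed up by [T] further steps determined by its end
    point. Their edges come later and have mean zero, so by [pmax_jensen] the closing does not lower
    the mean of the maximum. The parities make an exact return possible. *)
Lemma loop_split N1 T (s0 : N1.-tuple step) (t0 : (N1 + T).-tuple step) :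
  ~~ odd N1 -> ~~ odd T -> disp s0 == 0 -> disp t0 == 0 ->
  \int[Q]_c pmax (fun ss : N1.-tuple step => norm1 (disp ss) <= T)%N s0
     (fun ss => weight c (0, 0%N) ss) <=
  \int[Q]_c loop_best t0 c (0, 0%N).
Proof.
move=> oN oT s00 t00; pose near := (fun ss : N1.-tuple step => norm1 (disp ss) <= T)%N.
have near0 : near s0 by rewrite /near (eqP s00) norm1_0.
have ret (ss : N1.-tuple step) : {rr : seq step | near ss ->
    size rr = T /\ disp ss + disp rr = 0}.
  apply: cid; have [h|h] := boolP (near ss); last first.
    by exists [::].
  have [|rr sz e] := @return_steps d i0 T (disp ss) h.
    by rewrite odd_norm1_disp size_tuple (negbTE oN) (negbTE oT).
  by exists rr => _.
pose rr ss := projT1 (ret ss).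
have rrE ss : near ss -> size (rr ss) = T /\ disp ss + disp (rr ss) = 0.
  exact: (projT2 (ret ss)).
pose A := [set e : edge d | ((source e).2 < N1)%N].
have X0 := Xi_origin d.
have rF (ss : N1.-tuple step) : rint Q (fun c => weight c (0, 0%N) ss) by exact: (weight_rint i0 c0_gt0 Q_exp).
have rG ss : rint Q (fun c => weight c (endp (0, 0%N) (ss : N1.-tuple step)) (rr ss)).
  exact: (weight_rint i0 c0_gt0 Q_exp).
have J := @pmax_jensen _ _ Q nu QE A _ near s0
  (fun ss c => weight c (0, 0%N) ss)
  (fun ss c => weight c (endp (0, 0%N) ss) (rr ss)) near0
  (fun ss _ => rF ss) (fun ss _ => rG ss).
apply: le_trans (le_trans (J _ _) _).
- apply: le_Rintegral => //; first exact: rint_pmax.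
    by apply: rint_pmax => // ss _; apply: rintD => //; exact: rint_cst.
  move=> c _; apply: le_pmax => // ss _.
  by rewrite (Rintegral_weight i0 c0_gt0 Q_exp Q_mean) addr0.
- move=> ss _; apply: weight_depends => e /(mem_edges X0)[_ + _].
  by rewrite size_tuple.
- move=> ss _; apply: weight_depends => e /(mem_edges (Xi_endp ss X0))[+ _ _].
  by rewrite /A /= size_tuple => h; apply/negP; rewrite -leqNgt.
apply: le_Rintegral => //; [|exact: loop_best_rint|].
  by apply: rint_pmax => // ss _; apply: rintD.
move=> c _; apply: pmax_le => // ss nss; have [sz e] := rrE ss nss.
have szt : size (ss ++ rr ss) = (N1 + T)%N by rewrite size_cat size_tuple sz.
pose t : (N1 + T).-tuple step := tcast szt (in_tuple (ss ++ rr ss)).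
have tE : t = ss ++ rr ss :> seq step by rewrite val_tcast.
rewrite -weight_cat -tE.
apply: (@pmax_ge _ _ (fun ss : (N1 + T).-tuple step => disp ss == 0) t0
  (fun ss => weight c (0, 0%N) ss) t).
by rewrite tE disp_cat e.
Qed.

Lemma expR_mul_le (p q : R) : expR (p + q) <= expR (2 * p) + expR (2 * q).
Proof.
rewrite expRD (mulrC 2 p) (mulrC 2 q) !expRM_natr.
have := expR_gt0 p; have := expR_gt0 q.
by move: (expR p) (expR q) => x y x0 y0; nra.
Qed.

(* Paths that end far away pay for the penalty: the exponential of their weight
   is integrable, so that the last sum is small in mean when lam T^2 is large
   compared with N1. *)
Lemma best_penalty_near N1 T (s0 : N1.-tuple step) (lam th : R) (c : conf) : disp s0 == 0 ->
  0 <= lam -> 0 < th ->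
  best (penalty lam) N1 c (0, 0%N) <=
  pmax (fun ss : N1.-tuple step => norm1 (disp ss) <= T)%N s0
     (fun ss => weight c (0, 0%N) ss) +
  \sum_(ss : N1.-tuple step) th^-1 * expR (- (th * (lam * (T%:R / d%:R) ^+ 2))) *
    (expR (2 * th * weight c (0, 0%N) ss) + expR (- (2 * th) * weight c (0, 0%N) s0)).
Proof.
move=> s00 lam0 th0; set W := pmax _ _ _; set a := lam * _ ^+ 2.
pose t (ss : seq step) := th^-1 * expR (- (th * a)) *
    (expR (2 * th * weight c (0, 0%N) ss) + expR (- (2 * th) * weight c (0, 0%N) s0)).
have t_ge0 ss : 0 <= t ss.
  by rewrite /t !mulr_ge0 ?invr_ge0 ?addr_ge0 ?expR_ge0 // ltW.
have near_le (ss : N1.-tuple step) : (norm1 (disp ss) <= T)%N -> weight c (0, 0%N) ss <= W.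
  by move=> h; exact: (@pmax_ge _ _ _ s0 (fun ss => weight c (0, 0%N) ss)).
apply: pmax_le => // ss _.
have pen0 : penalty lam (endp (0, 0%N) ss) <= 0.
  by rewrite /penalty oppr_le0 mulr_ge0 // sqnorm_ge0.
have [h|h] := leqP (norm1 (disp ss)) T.
  rewrite (le_trans (lerD (near_le _ h) pen0)) // addr0 lerDl.
  by apply: sumr_ge0 => rr _; exact: t_ge0.
apply: (@le_trans _ _ (W + t ss)); last first.
  rewrite lerD2l (bigD1 ss) //= lerDl.
  by apply: sumr_ge0 => rr _; exact: t_ge0.
have w0 : weight c (0, 0%N) s0 <= W by apply: near_le; rewrite (eqP s00) norm1_0.
have pa : penalty lam (endp (0, 0%N) ss) <= - a.
  by rewrite /penalty /endp /= add0r lerN2 ler_wpM2l // sqnorm_far.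
suff : weight c (0, 0%N) ss - weight c (0, 0%N) s0 - a <= t ss by move=> ?; lra.
rewrite /t; move: (weight c (0, 0%N) ss) (weight c (0, 0%N) s0) => w w'.
rewrite -mulrA ler_pdivlMl //.
have -> : th * (w - w' - a) = - (th * a) + (th * w + - (th * w')) by ring.
apply: le_trans (_ : _ <= expR (- (th * a) + (th * w + - (th * w')))) _.
  by apply: le_trans (expR_ge1Dx _); rewrite lerDr.
rewrite expRD ler_wpM2l ?expR_ge0 //.
apply: le_trans (expR_mul_le _ _) _.
have -> : 2 * - (th * w') = - (2 * th) * w' by ring.
by rewrite mulrA.
Qed.

(** Of the four quarters [e] of [eps], one is lost in [longest_mean] and one to the penalty; the
    others leave room for the way back and for the paths that end far away. *)
Lemma loop_mean eps : 0 < eps -> exists h (t0 : h.-tuple step),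
  [/\ (0 < h)%N, disp t0 == 0 &
      (mu - eps) * h%:R <= \int[Q]_c loop_best t0 c (0, 0%N)].
Proof.
move=> eps0; pose e := eps / 4; have e_gt0 : 0 < e by rewrite divr_gt0.
have [N HN] := longest_mean e_gt0.
pose L := (2 * N.+1)%N.
have zL := HN L (leq_trans (leqnSn N) (@leq_pmull N.+1 2 isT)).
have L0 : 0 < L%:R :> R by rewrite ltr0n.
(* With this [lam] the penalty loss [lam L ^ 2] of a block is [e L]; [th] keeps [2 th] below
   [c0]. *)
pose lam := e / L%:R; pose th := c0 / 3.
have lam0 : 0 < lam by rewrite divr_gt0.
have th0 : 0 < th by rewrite divr_gt0.
have th2 : `|2 * th| < c0.
  by rewrite gtr0_norm ?mulr_gt0 // /th; move: c0_gt0 => ?; lra.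
have th2' : `|- (2 * th)| < c0 by rewrite normrN.
have d0 : 0 < d%:R :> R by rewrite ltr0n (leq_ltn_trans _ (ltn_ord i0)).
pose M := mgf (2 * th) + mgf (- (2 * th)).
pose S := #|{: step}|%:R * M.
have S0 : 0 <= S by rewrite mulr_ge0 // addr_ge0 // mgf_ge0.
(* [r] is the ratio of the outward length [N1] to the return length [T]: large enough for the return
   to cost a small fraction of the loop. *)
pose r := Num.bound ((`|mu| + 2 / th) / e).
have er : `|mu| + 2 / th <= e * r%:R.
  rewrite -ler_pdivrMl // mulrC; apply/ltW/archi_boundP.
  by rewrite divr_ge0 ?addr_ge0 ?divr_ge0 // ltW.
(* The far paths contribute at most [2 / th] times [S ^ N1 expR (- (th a))]. As [N1 = r T] and
   [th a] is proportional to [k T], it is enough to compare bases: [S ^ r] against an exponential in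
   [k]. *)
pose k := (Num.bound (S ^+ r * (d%:R ^+ 2) / (th * e))).+1.
have Sk : S ^+ r <= expR (th * e * k%:R / d%:R ^+ 2).
  apply: le_trans (expR_ge1Dx _); rewrite -lerBlDl.
  apply: (@le_trans _ _ (S ^+ r)); first by rewrite gerBl.
  rewrite ler_pdivlMr ?exprn_gt0 // -ler_pdivrMl ?mulr_gt0 // mulrC.
  apply: le_trans (_ : _ <= (Num.bound (S ^+ r * (d%:R ^+ 2) / (th * e)))%:R) _.
    apply/ltW/archi_boundP.
    by rewrite divr_ge0 ?mulr_ge0 ?exprn_ge0 // ltW.
  by rewrite ler_nat.
pose K := (r * k)%N; pose T := (L * k)%N; pose N1 := (L * K)%N.
have N1T : N1 = (r * T)%N by exact: mulnCA.
have oN : ~~ odd N1 by rewrite /N1 /L !oddM.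
have oT : ~~ odd T by rewrite /T /L !oddM.
have T0 : (0 < T)%N by rewrite /T /L !muln_gt0.
have [s0 s00] := zero_steps oN.
have [t0 t00] : exists t0 : (N1 + T).-tuple step, disp t0 == 0.
  by apply: zero_steps; rewrite oddD (negbTE oN) (negbTE oT).
exists (N1 + T)%N, t0; split => //.
apply: le_trans (loop_split oN oT s00 t00).
set W := Rintegral _ _ _.
pose a := lam * (T%:R / d%:R) ^+ 2.
have aE : th * a = th * e * k%:R / d%:R ^+ 2 * T%:R.
  rewrite /a /lam /T natrM; field.
  by rewrite !gt_eqF.
have chain := @best_penalty_chain d i0 R Q nu QE c0 c0_gt0 Q_exp lam L K (0, 0%N) (ltW lam0) (Xi_origin d).
have pen0 : penalty lam (0 : 'rV[int]_d, 0%N) = 0.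
  by rewrite /penalty /sqnorm big1 ?mulr0 ?oppr0 // => i _; rewrite mxE expr0n.
rewrite pen0 addr0 -/N1 in chain.
have wr (ss : N1.-tuple step) : rint Q (fun c => expR (2 * th * weight c (0, 0%N) ss)).
  by apply: expR_weight_rint => //; exact: Xi_origin.
have wr0 : rint Q (fun c => expR (- (2 * th) * weight c (0, 0%N) s0)).
  by apply: expR_weight_rint => //; exact: Xi_origin.
have rW : rint Q (fun c => pmax (fun ss : N1.-tuple step => norm1 (disp ss) <= T)%N s0
     (fun ss => weight c (0, 0%N) ss)).
  apply: rint_pmax; first by rewrite (eqP s00) norm1_0.
  by move=> ss _; exact: (weight_rint i0 c0_gt0 Q_exp).
pose kk := th^-1 * expR (- (th * a)).
have rs : rint Q (fun c => \sum_(ss : N1.-tuple step) kk *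
    (expR (2 * th * weight c (0, 0%N) ss) + expR (- (2 * th) * weight c (0, 0%N) s0))).
  by apply: rint_sum => ss _; apply: rintZ; apply: rintD.
have := le_Rintegral measurableT (best_rint i0 c0_gt0 Q_exp (penalty lam) N1 (0, 0%N))
  (rintD rW rs) (fun c _ => best_penalty_near T c s00 (ltW lam0) th0).
move=> /(le_trans chain); rewrite RintegralD // -/W.
rewrite Rintegral_sum; last by move=> ss _; apply: rintZ; apply: rintD.
rewrite (eq_bigr (fun=> kk * (mgf (2 * th) ^+ N1 + mgf (- (2 * th)) ^+ N1))); last first.
  move=> ss _; rewrite RintegralZl //; last exact: rintD.
  rewrite RintegralD //; last exact: wr.
  by rewrite !Rintegral_expR_weight ?Xi_origin // !size_tuple.
rewrite sumr_const card_tuple => H.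
have {H} : K%:R * (\int[Q]_c longest L c (0, 0%N) - lam * L%:R ^+ 2) <= W + 2 / th.
  apply: le_trans H _; rewrite lerD2l -[X in X <= _]mulr_natl natrX.
  have -> : #|{: step}|%:R ^+ N1 * (kk * (mgf (2 * th) ^+ N1 + mgf (- (2 * th)) ^+ N1)) =
     (#|{: step}|%:R ^+ N1 * (mgf (2 * th) ^+ N1 + mgf (- (2 * th)) ^+ N1)) * kk.
    by rewrite mulrCA mulrC.
  apply: le_trans (_ : _ <= 2 * S ^+ N1 * kk) _.
    apply: ler_wpM2r; first by rewrite mulr_ge0 ?expR_ge0 // invr_ge0 ltW.
    rewrite /S exprMn [leRHS]mulrCA; apply: ler_wpM2l; first by rewrite exprn_ge0.
    have -> : 2 * M ^+ N1 = M ^+ N1 + M ^+ N1 by rewrite mulr_natl mulr2n.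
    by apply: lerD; apply: lerXn2r; rewrite ?nnegrE ?addr_ge0 ?mgf_ge0 // ?lerDl ?lerDr mgf_ge0.
  have -> : 2 * S ^+ N1 * kk = 2 / th * (S ^+ N1 * expR (- (th * a))).
    by rewrite /kk mulrACA.
  rewrite -[leRHS]mulr1 ler_pM2l ?divr_gt0 //.
  rewrite expRN ler_pdivrMr ?expR_gt0 // mul1r N1T exprM aE expRM_natr.
  by apply: lerXn2r => //; rewrite nnegrE ?exprn_ge0 ?expR_ge0.
have -> : lam * L%:R ^+ 2 = e * L%:R by rewrite /lam; field; rewrite gt_eqF.
have h1 : K%:R * ((mu - e) * L%:R - e * L%:R) <=
    K%:R * (\int[Q]_c longest L c (0, 0%N) - e * L%:R).
  by rewrite ler_wpM2l // lerD2r.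
move=> /(le_trans h1).
have -> : K%:R * ((mu - e) * L%:R - e * L%:R) = (mu - 2 * e) * N1%:R.
  by rewrite /N1 natrM; move: (K%:R) (L%:R) => x y; ring.
have T1 : 1 <= T%:R :> R by rewrite ler1n.
have t2 : 0 <= 2 / th by rewrite divr_ge0 // ltW.
have mun : mu <= `|mu| by exact: ler_norm.
rewrite natrD N1T natrM.
have -> : eps = 4 * e by rewrite /e; field.
have h2 : T%:R * (`|mu| + 2 / th) <= T%:R * (e * r%:R) by rewrite ler_wpM2l.
have h3 : T%:R * mu <= T%:R * `|mu| by rewrite ler_wpM2l.
have h4 : 1 * (2 / th) <= T%:R * (2 / th) by rewrite ler_wpM2r.
have h5 : 0 <= T%:R * e by rewrite mulr_ge0 // ltW.
have h6 : 0 <= T%:R * (e * r%:R) by rewrite !mulr_ge0 // ltW.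
move: h2 h3 h4 h5 h6; move: (2 / th) (`|mu|) (T%:R) (r%:R) W => A B C D W.
by move=> ? ? ? ? ? ?; lra.
Qed.

End tube.

(** * Exponential moments of loops and of the negative part of a weight *)

Lemma expR_quadratic (R : realType) (x : R) :
  expR x <= 1 + x + x ^+ 2 * expR `|x|.
Proof.
have [x0|x0] := leP 0 x.
  have h : 1 - x <= (expR x)^-1 by rewrite -expRN; exact: expR_ge1Dx.
  have p := expR_gt0 x.
  have {h} h : expR x * (1 - x) <= 1.
    by rewrite mulrC -ler_pdivlMr // div1r.
  rewrite (ger0_norm x0); move: (expR x) p h => y p h.
  have h' : 0 <= 1 - y * (1 - x) by rewrite subr_ge0.
  by have := mulr_ge0 x0 h'; lra.
have y0 : 0 < - x by rewrite oppr_gt0.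
have h := expR_ge1Dx (- x).
have p := expR_gt0 (- x).
rewrite -[x in leLHS]opprK expRN.
apply: (@le_trans _ _ (1 - x)^-1); first by rewrite lef_pV2 ?posrE //; lra.
apply: (@le_trans _ _ (1 + x + x ^+ 2)).
  rewrite -[leLHS]div1r ler_pdivrMr; last by lra.
  have : 0 <= x ^+ 2 * (- x) by rewrite mulr_ge0 ?sqr_ge0 // ltW.
  by move=> ?; nra.
rewrite lerD2l -[leLHS]mulr1 ler_wpM2l ?sqr_ge0 //.
by apply: le_trans (expR_ge1Dx _); rewrite lerDl.
Qed.

Section chernoff.
Context (d : nat) (i0 : 'I_d) (R : realType).
Local Notation conf := (conf (edge d) R).
Local Notation step := (step d).
Local Notation weight := (weight i0).
Variables (Q : probability conf R) (nu : set R -> \bar R).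
Hypothesis QE : forall (s : {fset edge d}) (A : edge d -> set R),
  (forall i, measurable (A i)) -> Q (cylinder s A) = (\prod_(i <- s) nu (A i))%E.
Variable c0 : R.
Hypothesis c0_gt0 : 0 < c0.
Hypothesis Q_exp : forall e (a : R), `|a| < c0 ->
  (\int[Q]_c (expR (a * c e))%:E < +oo)%E.


(** Expand the exponential to second order: the linear term gives the mean, and for small [kap] the
    quadratic term is at most [kap eps]. It is integrable because the maximum is the weight of some
    loop, so [Y] dominates [expR (2 th |W|)]. *)
Lemma chernoff_loop h (t0 : h.-tuple step) (m eps : R) : disp t0 == 0 -> 0 < eps ->
  m <= \int[Q]_c loop_best i0 t0 c (0, 0%N) ->
  exists2 kap : R, 0 < kap &
   (\int[Q]_c (expR (- (kap * loop_best i0 t0 c (0, 0%N))))%:E <=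
    (expR (- (kap * (m - eps))))%:E)%E.
Proof.
move=> t00 eps0 mW; pose th := c0 / 3.
have th0 : 0 < th by rewrite divr_gt0.
have th2 : `|2 * th| < c0.
  by rewrite gtr0_norm ?mulr_gt0 // /th; move: c0_gt0 => ?; lra.
have th2' : `|- (2 * th)| < c0 by rewrite normrN.
pose W (c : conf) := loop_best i0 t0 c (0, 0%N).
pose Y (c : conf) := \sum_(ss : h.-tuple step)
  (expR (2 * th * weight c (0, 0%N) ss) + expR (- (2 * th) * weight c (0, 0%N) ss)).
have rW : rint Q W by exact: (loop_best_rint i0 c0_gt0 Q_exp).
have rY : rint Q Y.
  by apply: rint_sum => ss _; apply: rintD; apply: (expR_weight_rint i0 QE Q_exp) => //; exact: Xi_origin.
have YW c : expR (2 * th * `|W c|) <= Y c.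
  have [ss _ e] := @pmax_attained _ _ (fun ss : h.-tuple step => disp ss == 0) t0
    (fun ss => weight c (0, 0%N) ss) t00.
  rewrite /W /loop_best e /Y (bigD1 ss) //=.
  apply: ler_wpDr; first by apply: sumr_ge0 => ? _; rewrite addr_ge0 ?expR_ge0.
  move: (weight _ _ _) => w; have [w0|w0] := ger0P w.
    by rewrite lerDl expR_ge0.
  by rewrite mulrN mulNr lerDr expR_ge0.
pose C := \int[Q]_c Y c; have C0 : 0 <= C.
  by apply: Rintegral_ge0 => c _; apply: sumr_ge0 => ? _; rewrite addr_ge0 ?expR_ge0.
pose C' := 8 * C / th ^+ 2 + 1.
have C'0 : 0 < C' by rewrite ltr_wpDl //; apply: divr_ge0; [exact: mulr_ge0|exact: sqr_ge0].
(* The bound [th] puts the quadratic remainder under [Y]; the bound [eps / C'] makes its mean at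
   most [kap eps]. *)
pose kap := Num.min th (eps / C').
have kap0 : 0 < kap by rewrite lt_min th0 divr_gt0.
have kth : kap <= th by rewrite ge_min lexx.
have kC : kap * C' <= eps by rewrite -ler_pdivlMr // ge_min lexx orbT.
exists kap => //.
have pw c : expR (- (kap * W c)) <= 1 + - (kap * W c) + kap ^+ 2 * (8 / th ^+ 2) * Y c.
  apply: le_trans (expR_quadratic _) _; rewrite lerD2l normrN normrM gtr0_norm //.
  rewrite sqrrN exprMn -[leLHS]mulrA -[leRHS]mulrA; apply: ler_wpM2l; first exact: sqr_ge0.
  apply: le_trans (_ : _ <= 8 / th ^+ 2 * expR (2 * th * `|W c|)) _; last first.
    by rewrite ler_wpM2l // divr_ge0 // sqr_ge0.
  rewrite [leRHS]mulrAC ler_pdivlMr ?exprn_gt0 // -[W c ^+ 2]real_normK ?num_real //.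
  move: (`|W c|) (normr_ge0 (W c)) => w w0.
  have h1 := sqr_le_expR (th * w).
  have thw : 0 <= th * w by rewrite mulr_ge0 // ltW.
  have h2 : expR (- (th * w)) <= expR (th * w) by rewrite ler_expR; lra.
  have h3 : expR (kap * w) <= expR (th * w) by rewrite ler_expR ler_wpM2r.
  have -> : 2 * th * w = th * w + th * w by ring.
  have h4 : (th * w) ^+ 2 <= 8 * expR (th * w) by lra.
  rewrite expRD [leLHS]mulrAC -exprMn (mulrC w) mulrA.
  by apply: ler_pM => //; rewrite ?sqr_ge0 ?expR_ge0.
have r1 : rint Q (fun c => 1 + - (kap * W c)).
  by apply: rintD; [exact: rint_cst|apply: rintN; exact: rintZ].
have r2 : rint Q (fun c => kap ^+ 2 * (8 / th ^+ 2) * Y c) by exact: rintZ.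
apply: (@le_trans _ _ (\int[Q]_c (1 + - (kap * W c) + kap ^+ 2 * (8 / th ^+ 2) * Y c)%:E)%E).
  apply: ge0_le_integral => //.
  - apply/measurable_EFinP; apply: measurableT_comp => //.
    exact: (rint_measurable (rintN (rintZ kap rW))).
  - exact: measurable_int (rintD r1 r2).
  - by move=> c _; rewrite lee_fin; exact: pw.
rewrite -(EFin_Rintegral (rintD r1 r2)) lee_fin RintegralD //.
rewrite RintegralD //; [|exact: rint_cst|exact: rintN (rintZ kap rW)].
rewrite Rintegral_const RintegralZl //.
have -> : \int[Q]_c (- (kap * W c)) = - (kap * \int[Q]_c W c).
  under eq_Rintegral do rewrite -mulNr.
  by rewrite RintegralZl // mulNr.
apply: le_trans (expR_ge1Dx _); rewrite -addrA lerD2l.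
have h1 : kap * m <= kap * \int[Q]_c W c by rewrite ler_pM2l.
have h2 : kap ^+ 2 * (8 / th ^+ 2) * C <= kap * eps.
  have -> : kap ^+ 2 * (8 / th ^+ 2) * C = kap * (kap * (8 * C / th ^+ 2)) by ring.
  rewrite ler_pM2l //; apply: le_trans kC; rewrite ler_pM2l // /C'.
  by rewrite lerDl.
by rewrite mulrBr; move: h1 h2; rewrite /C; lra.
Qed.

Variables (M0 : R) (f : R -> R).
Hypothesis f_gt0 : forall x, 0 < x -> 0 < f x.
Hypothesis f_incr : forall x y, 0 < x -> x <= y -> f x <= f y.
Hypothesis M0_gt0 : 0 < M0.
Hypothesis Q_tail : forall e (x : R), M0 < x ->
  Q [set c | c e < - x] = (expR (- (ln 2 * (x ^+ d.+1 * f x))))%:E.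

(** Unlike the moment generating function of [- c e], this is monotone in [s], so the number of
    paths through an edge may be replaced by an upper bound. *)
Definition neg_mgf (s : R) : \bar R :=
  (\int[Q]_c (expR (s * Num.max (- c (origin_edge i0)) 0))%:E)%E.

Lemma measurable_neg_part (s : R) :
  measurable_fun setT (fun x : R => expR (s * Num.max (- x) 0)).
Proof.
apply: measurableT_comp => //; apply: measurable_funM; first exact: measurable_cst.
by apply: measurable_maxr => //; exact: measurableT_comp.
Qed.

Lemma neg_mgfE s e : (\int[Q]_c (expR (s * Num.max (- c e) 0))%:E = neg_mgf s)%E.
Proof.
apply: (ge0_integral_coord QE e (origin_edge i0)
  (g := fun x => (expR (s * Num.max (- x) 0))%:E)).
  by apply/measurable_EFinP; exact: measurable_neg_part.
by move=> x; rewrite lee_fin expR_ge0.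
Qed.

Lemma le_neg_mgf s t : s <= t -> (neg_mgf s <= neg_mgf t)%E.
Proof.
move=> st; have me u : measurable_fun setT (fun c : conf =>
    (expR (u * Num.max (- c (origin_edge i0)) 0))%:E).
  apply/measurable_EFinP.
  by apply: (measurableT_comp (measurable_neg_part u)); exact: conf_eval_measurable.
apply: ge0_le_integral => //.
- by move=> c _; rewrite lee_fin ler_expR ler_wpM2r // le_max lexx orbT.
Qed.

(* Split the negative part into multiples of B; the choice of B makes the tail
   beat the exponential on each slice. *)
Lemma neg_mgf_le (s B : R) : 0 <= s -> 1 <= B -> M0 < B ->
  4 * (s + 1) <= ln 2 * (B ^+ d * f B) ->
  (neg_mgf s <= (2 * expR (s * B))%:E)%E.
Proof.
move=> s0 B1 MB HB; set e0 := origin_edge i0.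
have B0 : 0 < B by exact: lt_le_trans B1.
(* Slice [i] consists of the values of [- c e0] between [x i] and [x i + B]; there the exponential
   is at most [a i]. *)
pose x i : R := B * i.+1%:R.
pose S i : set conf := [set c | c e0 < - x i].
have xM i : M0 < x i by rewrite (lt_le_trans MB) // ler_peMr ?ler1n // ltW.
have mS i : measurable (S i).
  rewrite (_ : S i = setT `&` (fun c : conf => c e0) @^-1` `]-oo, - x i[%classic).
    exact: conf_eval_measurable.
  by rewrite setTI; apply/seteqP; split => c /=; rewrite in_itv.
pose a i : R := expR (s * (x i + B)).
pose t i (c : conf) : \bar R := (a i * \1_(S i) c)%:E.
have t0 i c : (0 <= t i c)%E by rewrite lee_fin mulr_ge0 ?expR_ge0.
have mt i : measurable_fun setT (t i).
  by apply/measurable_EFinP; apply: measurable_funM; [exact: measurable_cst|exact: measurable_indic].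
have pw c : ((expR (s * Num.max (- c e0) 0))%:E <=
     (expR (s * B))%:E + \sum_(0 <= i <oo) t i c)%E.
  pose y := - c e0; have [yB|yB] := leP y B.
    apply: le_trans (leeDl _ _); last exact: nneseries_ge0.
    by rewrite lee_fin ler_expR ler_wpM2l // ge_max yB ltW.
  have ex : exists n, y <= x n.
    exists (Num.bound (y / B)); apply/ltW; rewrite /x mulrC -ltr_pdivrMr //.
    apply: lt_le_trans (archi_boundP _) _; last by rewrite ler_nat.
    by rewrite divr_ge0 // ltW // (lt_trans B0).
  have [n yn min] := ex_minnP ex.
  have n0 : (0 < n)%N.
    by rewrite lt0n; apply: contraTN yB => /eqP n0; rewrite -leNgt; move: yn; rewrite n0 /x mulr1.
  have yn1 : x n.-1 < y.
    by rewrite ltNge; apply/negP => /min; rewrite -ltnS prednK // ltnn.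
  apply: le_trans (leeDr _ _); last by rewrite lee_fin expR_ge0.
  apply: (@le_trans _ _ (t n.-1 c)); last first.
    apply: le_trans (nneseries_lim_ge n (fun n _ _ => t0 n c)).
    by rewrite big_mkord; case: (n) n0 => // m _; rewrite big_ord_recr /= leeDr // sume_ge0.
  rewrite /t indicE mem_set; last by rewrite /S /= ltrNr.
  rewrite mulr1 lee_fin ler_expR ler_wpM2l // ge_max; apply/andP; split.
    rewrite -/y; apply: le_trans yn _.
    by rewrite /x prednK // -natr1 mulrDr mulr1.
  by rewrite addr_ge0 ?mulr_ge0 // ltW.
apply: (@le_trans _ _ (\int[Q]_c ((expR (s * B))%:E + \sum_(0 <= i <oo) t i c))%E).
  apply: ge0_le_integral => //.
  - apply/measurable_EFinP.
    by apply: (measurableT_comp (measurable_neg_part s)); exact: conf_eval_measurable.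
  - by apply: emeasurable_funD; [exact: measurable_cst|exact: ge0_emeasurable_sum].
rewrite ge0_integralD //; try exact: ge0_emeasurable_sum;
  try by move=> c _; exact: nneseries_ge0.
rewrite integral_cst //= probability_setT mule1 integral_nneseries //.
(* The slices have geometrically decreasing contributions of total at most 1, absorbed by the factor
   2 of the conclusion. *)
have ti i : (\int[Q]_c t i c <= (1 / (2 ^ i.+1)%:R)%:E)%E.
  have -> : (\int[Q]_c t i c = (a i)%:E * Q (S i))%E.
    under eq_integral do rewrite /t EFinM.
    rewrite ge0_integralZl //; first by rewrite integral_indic // setIT.
      by apply/measurable_EFinP; exact: measurable_indic.
    by rewrite lee_fin expR_ge0.
  rewrite Q_tail // -EFinM lee_fin /a -expRD.
  have -> : 1 / (2 ^ i.+1)%:R = (2^-1 : R) ^+ i.+1 by rewrite natrX div1r exprVn.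
  apply: le_trans (_ : _ <= expR (i.+1%:R * - 1)) _; last first.
    rewrite expRM_natl; apply: lerXn2r; rewrite ?nnegrE ?expR_ge0 ?invr_ge0 //.
    have e1 : 2 <= expR (1 : R) by have := expR_ge1Dx (1 : R); lra.
    by rewrite expRN lef_pV2 ?posrE ?expR_gt0 //.
  rewrite ler_expR.
  have h1 : B ^+ d * f B <= x i ^+ d * f (x i).
    have Bx : B <= x i by rewrite ler_peMr ?ler1n // ltW.
    apply: ler_pM; [by rewrite exprn_ge0 // ltW|exact/ltW/f_gt0| |exact: f_incr].
    by apply: lerXn2r; rewrite // nnegrE ltW // (lt_le_trans B0).
  have x1 : i.+1%:R <= x i by rewrite ler_peMl.
  have i1 : 1 <= i.+1%:R :> R by rewrite ler1n.
  have Bx : B <= x i by rewrite ler_peMr // ltW.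
  have ln20 := ln2_gt0 R.
  have h2 : 4 * (s + 1) <= ln 2 * (x i ^+ d * f (x i)).
    by apply: le_trans HB _; rewrite ler_pM2l.
  have -> : ln 2 * (x i ^+ d.+1 * f (x i)) = x i * (ln 2 * (x i ^+ d * f (x i))).
    by rewrite exprS; ring.
  have h3 : x i * (4 * (s + 1)) <= x i * (ln 2 * (x i ^+ d * f (x i))).
    by rewrite ler_wpM2l // (le_trans (ltW B0)).
  have h4 : s * B <= s * x i by rewrite ler_wpM2l.
  have h5 : 0 <= s * x i by rewrite mulr_ge0 // (le_trans (ltW B0)).
  by move: h3 h4 h5 x1 i1; move: (ln 2 * _) => z ? ? ? ? ?; lra.
apply: (@le_trans _ _ ((expR (s * B))%:E + (1 : R)%:E)%E).
  rewrite leeD2l //.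
  apply: le_trans (epsilon_trick0 xpredT (@ler01 R)).
  by apply: lee_nneseries => [i _ _|i _]; [exact: integral_ge0|exact: ti].
rewrite -EFinD lee_fin mulr2n mulrDl mul1r lerD2l.
by rewrite -[leLHS]expR0 ler_expR mulr_ge0 // ltW.
Qed.

End chernoff.

(** * The spreading flow *)

Section flow.
Context (d : nat) (i0 : 'I_d) (r : nat).
Hypothesis r_gt0 : (0 < r)%N.
Local Notation step := (step d).
Local Notation labels := {ffun 'I_d -> 'I_r}.
Implicit Types (k : labels) (t q : nat).

Let d_gt0 : (0 < d)%N. Proof. exact: leq_ltn_trans (ltn_ord i0). Qed.

Definition axis t : 'I_d := Ordinal (ltn_pmod t d_gt0).

(* Number of s < t with s = i modulo d: the flow moves along each axis in turn. *)
Definition moves (i : 'I_d) t : nat := (t %/ d + (i < t %% d))%N.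

Lemma moves_axis t : moves (axis t) t = (t %/ d)%N.
Proof. by rewrite /moves /= ltnn addn0. Qed.

Lemma movesS i t : moves i t.+1 = (moves i t + (i == axis t))%N.
Proof.
rewrite /moves divnS // modnS.
have dE : (d %| t.+1)%N = ((t %% d).+1 == d).
  rewrite {1}(divn_eq t d) -addnS dvdn_addr ?dvdn_mull //.
  apply/idP/eqP => [/dvdn_leq h|->//].
  by apply/eqP; rewrite eqn_leq ltn_pmod //= h.
rewrite -val_eqE /= dE; case: eqP => [e|ne] /=.
  have : (i <= t %% d)%N by rewrite -ltnS e.
  by rewrite leq_eqVlt; case: ltngtP => //= _ _; lia.
by rewrite ltnS leq_eqVlt; case: ltngtP => //= _; lia.
Qed.

(** The number of positive moves among the first [q] moves along an axis: the line of slope [a / r]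
    rounded down. *)
Definition level (a q : nat) : nat := (a * q %/ r)%N.

Lemma levelS a q : (a < r)%N ->
  level a q.+1 = (level a q + (level a q < level a q.+1))%N.
Proof.
move=> ar; have h1 : (level a q <= level a q.+1)%N by rewrite leq_div2r // leq_mul2l leqnSn orbT.
have h2 : (level a q.+1 <= (level a q).+1)%N.
  rewrite /level mulnS; apply: leq_trans (leq_div2r r (leq_add (ltnW ar) (leqnn _))) _.
  by rewrite -{1}[r]mul1n divnMDl.
by move: h1 h2; case: ltngtP; rewrite ?addn0 ?addn1 // => *; lia.
Qed.

Lemma level_le a q : (a < r)%N -> (level a q <= q)%N.
Proof.
by move=> ar; rewrite /level -[leqRHS](mulKn _ r_gt0) leq_div2r // leq_mul2r ltnW ?orbT.
Qed.

(** The slopes differ by at least [1 / r], hence the lines by at least [l] after [r l] moves;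
    rounding loses nothing because the guaranteed difference is an integer. *)
Lemma level_gap a b q l : (a < b)%N -> (r * l <= q)%N ->
  (level a q + l <= level b q)%N.
Proof.
move=> ab rlq; rewrite /level addnC -divnMDl //; apply: leq_div2r.
apply: (@leq_trans (q + a * q)); last by rewrite -mulSn leq_mul2r ab orbT.
by rewrite leq_add2r mulnC.
Qed.

(* Coordinate i of the path with label k is near (2 k_i / r - 1) q after its q
   moves, see disp_flow. *)
Definition flow_step k t : step :=
  (axis t, level (k (axis t)) (t %/ d) < level (k (axis t)) (t %/ d).+1)%N.

Definition flow k t : seq step := [seq flow_step k s | s <- iota 0 t].

Lemma size_flow k t : size (flow k t) = t.
Proof. by rewrite size_map size_iota. Qed.

Lemma flowS k t : flow k t.+1 = rcons (flow k t) (flow_step k t).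
Proof. by rewrite /flow -addn1 iotaD map_cat /= cats1. Qed.

Lemma disp_flow k t i : disp (flow k t) 0 i =
  (2 * level (k i) (moves i t))%:Z - (moves i t)%:Z.
Proof.
elim: t => [|t IH].
  by rewrite /disp big_nil mxE /moves div0n mod0n /level muln0 div0n.
rewrite flowS /disp -cats1 big_cat big_seq1 mxE.
rewrite -/(disp (flow k t)) IH movesS; case: eqP => [->|/eqP ne] /=; last first.
  rewrite /dir; by case: ifP => _; rewrite !mxE (negbTE ne) andbF ?oppr0 addr0 addn0.
rewrite moves_axis addn1 levelS // /dir /flow_step /=.
by case: ifP => _; rewrite !mxE !eqxx /=; lia.
Qed.

Definition flow_end k t : vertex d := endp (0, 0%N) (flow k t).
Definition flow_edge k t : edge d := mkedge i0 (flow_end k t) (flow_step k t).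

Lemma flow_end_Xi k t : Xi (flow_end k t).
Proof. exact/Xi_endp/Xi_origin. Qed.

Lemma flow_end2 k t : (flow_end k t).2 = t.
Proof. by rewrite /flow_end /endp /= size_flow. Qed.

Lemma flow_edge_time k t : (source (flow_edge k t)).2 = t.
Proof. by rewrite source_mkedge ?flow_end_Xi // flow_end2. Qed.

Lemma edges_flow k t :
  edges i0 (0, 0%N) (flow k t) = [seq flow_edge k s | s <- iota 0 t].
Proof.
elim: t => // t IH; rewrite flowS -cats1 edges_cat IH -[in RHS]addn1 iotaD map_cat.
by [].
Qed.

Lemma flow_edge_level k k' t i : flow_edge k t = flow_edge k' t ->
  level (k i) (moves i t) = level (k' i) (moves i t).
Proof.
move=> /(congr1 (@source d)); rewrite !source_mkedge ?flow_end_Xi //.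
move=> /(congr1 fst); rewrite /flow_end /endp /= !add0r => /rowP /(_ i).
by rewrite !disp_flow; lia.
Qed.

(** Bounds the number of labels with a common level after [q] moves; [maxn] covers [q = 0], where
    all [r] labels coincide. *)
Definition crowd q : nat := (r %/ maxn q 1).+1.

Lemma le_crowd q q' : (q <= q')%N -> (crowd q' <= crowd q)%N.
Proof. by move=> qq; rewrite ltnS leq_div2l //; lia. Qed.

(** The products [a q] with a common quotient by [r] differ by less than [r], so the labels lie
    within [r / q] of the smallest one. *)
Lemma card_level q u : (#|[pred a : 'I_r | level a q == u]| <= crowd q)%N.
Proof.
have [->|q0] := posnP q; first by rewrite /crowd divn1 (leq_trans (max_card _)) // card_ord.
have -> : crowd q = (r %/ q).+1 by rewrite /crowd (maxn_idPl q0).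
have [a0 /= a0u|none] := pickP [pred a : 'I_r | level a q == u]; last by rewrite (eq_card0 none).
case: (arg_minnP (fun a : 'I_r => val a) (P := [pred a : 'I_r | level a q == u]) a0u) => b /= /eqP bu bmin.
rewrite -[(r %/ q).+1]card_ord.
have lt a : level a q == u -> (a - b < (r %/ q).+1)%N.
  move=> /eqP au; rewrite ltnS leq_divRL // mulnBl leq_subLR.
  have := divn_eq (a * q) r; have := divn_eq (b * q) r.
  have := ltn_pmod (a * q) r_gt0; rewrite /level in au bu; rewrite au bu.
  by move: (_ %% _)%N (_ %% _)%N (u * r)%N => *; lia.
apply: (@leq_card_in _ _ (fun a : 'I_r => inord (a - b) : 'I_(r %/ q).+1)).
move=> a a' /= au au' /(congr1 val); rewrite /= !inordK ?lt //.
by move=> e; apply: val_inj => /=; have := bmin _ au; have := bmin _ au'; lia.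
Qed.

(** Sharing an edge forces equal levels on every axis, so the count is at most a product over the
    axes, each of which has had at least [t / d] moves. *)
Lemma card_flow_edge t (e : edge d) :
  (#|[pred k : labels | flow_edge k t == e]| <= crowd (t %/ d) ^ d)%N.
Proof.
have [k0 /= /eqP k0e|none] := pickP [pred k : labels | flow_edge k t == e]; last by rewrite (eq_card0 none).
pose F i := [pred a : 'I_r | level a (moves i t) == level (k0 i) (moves i t)].
apply: (@leq_trans #|family F|).
  apply: subset_leq_card; apply/fintype.subsetP => k; rewrite inE => /eqP ke.
  by apply/familyP => i; rewrite inE; apply/eqP/flow_edge_level; rewrite ke.
rewrite card_family.
have -> : (crowd (t %/ d) ^ d)%N = foldr muln 1%N [seq crowd (t %/ d) | i : 'I_d].
  rewrite /image_mem -[X in (_ ^ X)%N](size_enum_ord d).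
  by elim: (enum _) => //= _ s <-; rewrite expnS.
rewrite /image_mem; elim: (enum _) => //= i s IH; apply: leq_mul => //.
by apply: leq_trans (card_level _ _) (le_crowd _); rewrite leq_addr.
Qed.

(** An edge of the flow at time [t] is coded by its [d] levels and the sign of the step; the axis of
    the step is a function of [t]. *)
Lemma size_flow_edges t :
  (size (undup [seq flow_edge k t | k <- enum {: labels}]) <= 2 * (t %/ d + 2) ^ d)%N.
Proof.
pose G (ub : {ffun 'I_d -> 'I_(t %/ d + 2)} * bool) : edge d :=
  mkedge i0 (\row_i ((2 * ub.1 i)%:Z - (moves i t)%:Z), t) (axis t, ub.2).
apply: (@leq_trans (size [seq G ub | ub <- enum {: {ffun 'I_d -> 'I_(t %/ d + 2)} * bool}])).
  apply: uniq_leq_size; first exact: undup_uniq.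
  move=> e; rewrite mem_undup => /mapP[k _ ->].
  have lt i : (level (k i) (moves i t) < t %/ d + 2)%N.
    apply: leq_ltn_trans (level_le _ (ltn_ord _)) _; rewrite /moves.
    by rewrite ltn_add2l ltnS leq_b1.
  apply/mapP; exists ([ffun i => Ordinal (lt i)], (flow_step k t).2); first by rewrite mem_enum.
  rewrite /G /flow_edge; congr mkedge.
  rewrite /flow_end /endp size_flow /= !add0r; congr pair; apply/rowP => i.
  by rewrite disp_flow mxE /= ffunE.
by rewrite size_map -cardE card_prod card_ffun card_bool !card_ord mulnC.
Qed.

End flow.

Lemma prode_le_expR (R : realType) (J : eqType) (s : seq J) (F : J -> \bar R)
    (a : J -> R) :
  (forall j, j \in s -> 0 <= F j)%E ->
  (forall j, j \in s -> F j <= (expR (a j))%:E)%E ->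
  (\prod_(j <- s) F j <= (expR (\sum_(j <- s) a j))%:E)%E.
Proof.
elim: s => [|j s IH] F0 Fb; first by rewrite !big_nil expR0.
rewrite !big_cons expRD EFinM.
have js : j \in j :: s by rewrite mem_head.
have h k : k \in s -> k \in j :: s by rewrite inE => ->; rewrite orbT.
have IHs := IH (fun k ks => F0 k (h k ks)) (fun k ks => Fb k (h k ks)).
apply: lee_pmul => //; [exact: F0| |exact: Fb].
rewrite big_seq_cond; apply: prode_ge0 => k; rewrite andbT => ks.
exact/F0/h.
Qed.

Lemma sum_undup_count (R : realType) (J : eqType) (s : seq J) (F : J -> R) :
  \sum_(j <- s) F j = \sum_(j <- undup s) (count_mem j s)%:R * F j.
Proof.
rewrite -big_undup_iterop_count; apply: eq_bigr => j _.
by rewrite Monoid.iteropE iter_addr_0 mulr_natl.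
Qed.

(** * Exponential moments along the flow *)

Section assembly.
Context (d : nat) (i0 : 'I_d) (R : realType).
Local Notation conf := (conf (edge d) R).
Local Notation weight := (weight i0).
Variables (Q : probability conf R) (nu : set R -> \bar R).
Hypothesis QE : forall (s : {fset edge d}) (A : edge d -> set R),
  (forall i, measurable (A i)) -> Q (cylinder s A) = (\prod_(i <- s) nu (A i))%E.

Local Notation neg_mgf := (@neg_mgf _ i0 R Q).
Variables (r : nat).
Hypothesis r_gt0 : (0 < r)%N.
Local Notation labels := {ffun 'I_d -> 'I_r}.
Local Notation flow := (@flow _ i0 r).
Local Notation flow_edge := (@flow_edge _ i0 r).
Local Notation crowd := (@crowd r).

(** Grouping equal edges turns the sum over labels into a sum over distinct, independent edges.
    Their multiplicities are at most [crowd (t %/ d) ^ d], and [size_flow_edges] bounds their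
    number. *)
Lemma flow_mgf_time (kap G : R) t : 0 <= kap -> 0 <= G ->
  (neg_mgf (kap * (crowd (t %/ d) ^ d)%:R) <= (expR G)%:E)%E ->
  (\int[Q]_c (expR (- (kap * \sum_(k : labels) c (flow_edge k t))))%:E <=
   (expR (G * (2 * (t %/ d + 2) ^ d)%:R))%:E)%E.
Proof.
move=> kap0 G0 HG; set s := [seq flow_edge k t | k <- enum {: labels}].
have e1 (c : conf) : - (kap * \sum_(k : labels) c (flow_edge k t)) =
    \sum_(e <- undup s) - (kap * (count_mem e s)%:R) * c e.
  rewrite -big_enum -(big_map (fun k => flow_edge k t) predT (fun e => c e)) -/s.
  rewrite sum_undup_count mulr_sumr -sumrN; apply: eq_bigr => e _.
  by rewrite mulNr mulrA.
under eq_integral do rewrite e1.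
rewrite (integral_exp_sum QE (fun e => - (kap * (count_mem e s)%:R))) ?undup_uniq //.
apply: le_trans (_ : _ <= (expR (\sum_(e <- undup s) G))%:E)%E _.
  apply: prode_le_expR => e _; first by apply: integral_ge0 => c _; rewrite lee_fin expR_ge0.
  apply: le_trans HG; rewrite -(neg_mgfE i0 QE _ e).
  apply: ge0_le_integral => //.
  - by apply/measurable_EFinP; exact: measurable_expR_coord.
  - apply/measurable_EFinP.
    by apply: (measurableT_comp (measurable_neg_part _)); exact: conf_eval_measurable.
  move=> c _; rewrite lee_fin ler_expR mulNr -mulrN.
  apply: (@le_trans _ _ (kap * (count_mem e s)%:R * Num.max (- c e) 0)).
    by rewrite ler_wpM2l ?mulr_ge0 // le_max lexx.
  rewrite ler_wpM2r ?le_max ?lexx ?orbT // ler_wpM2l // ler_nat.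
  apply: leq_trans (card_flow_edge i0 r_gt0 t e).
  rewrite /s count_map -sum1_count -sum1_card big_enum_cond /=.
  by rewrite eq_leq //; apply: eq_bigl => k; rewrite !inE.
rewrite lee_fin ler_expR big_const_seq count_predT iter_addr_0 -[leLHS]mulr_natr.
by rewrite ler_wpM2l // ler_nat size_flow_edges.
Qed.

Lemma flow_mgf (kap : R) (G : nat -> R) m : 0 <= kap -> (forall t, 0 <= G t) ->
  (forall t, (t < m)%N -> neg_mgf (kap * (crowd (t %/ d) ^ d)%:R) <= (expR (G t))%:E)%E ->
  (\int[Q]_c (expR (- (kap * \sum_(k : labels) weight c (0, 0%N) (flow k m))))%:E <=
   (expR (\sum_(t < m) G t * (2 * (t %/ d + 2) ^ d)%:R))%:E)%E.
Proof.
move=> kap0 G0 HG.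
have e1 (c : conf) : expR (- (kap * \sum_(k : labels) weight c (0, 0%N) (flow k m))) =
    \prod_(t <- iota 0 m) expR (- (kap * \sum_(k : labels) c (flow_edge k t))).
  rewrite -expR_sum sumrN -mulr_sumr exchange_big /=.
  congr (expR (- (kap * _))); apply: eq_bigr => k _.
  by rewrite weightE edges_flow big_map.
under eq_integral do rewrite e1 -prodEFin.
rewrite (independent_prod QE (B := fun t => [set e : edge d | (source e).2 = t])
  (F := fun t (c : conf) => (expR (- (kap * \sum_(k : labels) c (flow_edge k t))))%:E)) //.
- rewrite -[in leRHS](big_mkord xpredT (fun t => G t * (2 * (t %/ d + 2) ^ d)%:R)).
  rewrite /index_iota subn0; apply: prode_le_expR => t.
    by move=> _; apply: integral_ge0 => c _; rewrite lee_fin expR_ge0.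
  by rewrite mem_iota => tm; apply: flow_mgf_time => //; exact: HG.
- exact: iota_uniq.
- move=> t _; apply/measurable_EFinP; apply: measurableT_comp => //.
  apply: measurableT_comp => //; apply: measurable_funM; first exact: measurable_cst.
  by apply: measurable_sum => k; exact: conf_eval_measurable.
- move=> t _ c c' cc'; congr (expR (- (kap * _)))%:E.
  by apply: eq_bigr => k _; apply: cc'; exact: flow_edge_time.
- move=> t u _ _ tu; apply/seteqP; split => // e [/= -> /eqP].
  by rewrite (negbTE tu).
Qed.

End assembly.

(** * The Chernoff bound *)

Section tubes.
Context (d : nat) (i0 : 'I_d) (R : realType).
Local Notation conf := (conf (edge d) R).
Local Notation vertex := (vertex d).
Local Notation step := (step d).
Local Notation weight := (weight i0).
Local Notation longest := (longest i0).
Variables (Q : probability conf R) (nu : set R -> \bar R).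
Hypothesis QE : forall (s : {fset edge d}) (A : edge d -> set R),
  (forall i, measurable (A i)) -> Q (cylinder s A) = (\prod_(i <- s) nu (A i))%E.
Variable c0 : R.
Hypothesis c0_gt0 : 0 < c0.
Hypothesis Q_exp : forall e (a : R), `|a| < c0 ->
  (\int[Q]_c (expR (a * c e))%:E < +oo)%E.

Local Notation neg_mgf := (@neg_mgf _ i0 R Q).
Local Notation loop_best := (loop_best i0).
Variables (r : nat).
Hypothesis r_gt0 : (0 < r)%N.
Local Notation labels := {ffun 'I_d -> 'I_r}.
Local Notation flow := (@flow _ i0 r).
Local Notation flow_end := (@flow_end _ i0 r).
Local Notation crowd := (@crowd r).
Variables (h : nat) (t0 : h.-tuple step).
Hypothesis t00 : disp t0 == 0.

Definition later (v : vertex) (b : nat) : vertex := (v.1, (v.2 + b * h)%N).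

Lemma later_Xi v b : Xi v -> Xi (later v b).
Proof.
have oh : ~~ odd h by rewrite -(size_tuple t0) -odd_norm1_disp (eqP t00) norm1_0.
by rewrite !XiE /= !oddD oddM (negbTE oh) andbF addbF.
Qed.

Lemma loop_best_le (c : conf) v : exists2 ss : seq step, size ss = h &
  disp ss = 0 /\ loop_best t0 c v = weight c v ss.
Proof.
have [ss ss0 e] := @pmax_attained _ _ (fun ss : h.-tuple step => disp ss == 0) t0
  (fun ss => weight c v ss) t00.
by exists ss; rewrite ?size_tuple //; split => //; exact/eqP.
Qed.

Lemma loop_chain (c : conf) v B : exists2 ss : seq step, size ss = (B * h)%N &
  disp ss = 0 /\ \sum_(b < B) loop_best t0 c (later v b) = weight c v ss.
Proof.
elim: B => [|B [ss sz [ss0 e]]].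
  by exists [::]; rewrite ?mul0n // big_ord0 weight_nil /disp big_nil.
have [rr sz' [rr0 e']] := loop_best_le c (later v B).
exists (ss ++ rr); first by rewrite size_cat sz sz' mulSn addnC.
split; first by rewrite disp_cat ss0 rr0 addr0.
rewrite big_ord_recr /= e e' weight_cat; congr (_ + weight c _ _).
by rewrite /endp ss0 addr0 sz.
Qed.

(* A lower bound for the same quantity for each of the r^d labels k, hence also
   for their average. *)
Lemma flow_loops_longest (c : conf) m B (k : labels) :
  weight c (0, 0%N) (flow k m) + \sum_(b < B) loop_best t0 c (later (flow_end k m) b)
  <= longest (m + B * h) c (0, 0%N).
Proof.
have [ss sz [_ ->]] := loop_chain c (flow_end k m) B.
by rewrite -weight_cat; apply: longest_ge; rewrite size_cat size_flow sz.
Qed.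

Lemma loop_best_measurable v : measurable_fun setT (fun c : conf => loop_best t0 c v).
Proof. exact: rint_measurable (loop_best_rint i0 c0_gt0 Q_exp v t00). Qed.

Lemma measurable_expR_loop (kap : R) v :
  measurable_fun setT (fun c : conf => (expR (- (kap * loop_best t0 c v)))%:E).
Proof.
apply/measurable_EFinP; apply: measurableT_comp => //.
apply: measurableT_comp => //; apply: measurable_funM; first exact: measurable_cst.
exact: loop_best_measurable.
Qed.

Lemma integral_loop_best (kap : R) v : Xi v ->
  (\int[Q]_c (expR (- (kap * loop_best t0 c v)))%:E =
   \int[Q]_c (expR (- (kap * loop_best t0 c (0, 0%N))))%:E)%E.
Proof.
move=> Xv; have inj := edge_map_inj (i0 := i0) (vadd_Xi Xv) (vadd_move v) (@vadd_inj _ v).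
rewrite -[RHS](ge0_integral_relabel QE
  (F := fun c => (expR (- (kap * loop_best t0 c (0, 0%N))))%:E) inj); first last.
- by move=> c; rewrite lee_fin expR_ge0.
- exact: measurable_expR_loop.
apply: eq_integral => c _; congr (expR (- (kap * _)))%:E; apply: eq_pmax => ss.
rewrite (weight_relabel i0 (vadd_move v)) ?Xi_origin //.
have -> : vadd v (0, 0%N) = v by rewrite /vadd /= addr0 addn0 -surjective_pairing.
by rewrite map_id.
Qed.

Definition tube m (kb : labels * nat) : set (edge d) :=
  [set e | [/\ (m + kb.2 * h <= (source e).2)%N,
     ((source e).2 < m + kb.2.+1 * h)%N &
     (norm1 ((source e).1 - (flow_end kb.1 m).1)%R <= h)%N]].

Lemma loop_best_depends m (k : labels) b :
  depends_on (tube m (k, b)) (fun c : conf => loop_best t0 c (later (flow_end k m) b)).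
Proof.
move=> c c' cc'; apply: eq_pmax => ss.
apply: weight_depends cc' => e /(mem_edges (later_Xi b (flow_end_Xi _ _ _)))[].
rewrite [(later _ _).2]/(_ + _)%N flow_end2 size_tuple => h1 h2 h3.
split => //=; first by rewrite mulSn addnCA addnC.
by apply: leq_trans h3 _; rewrite leq_subLR; exact: ltnW.
Qed.

(** If two labels differ on an axis, their levels there differ by at least [h + 1] at time [m],
    hence the positions by [2 (h + 1)], more than the sum of the radii. Different loop numbers are
    separated by time. *)
Lemma tube_disjoint m (kb kb' : labels * nat) : (r * h.+1 <= m %/ d)%N ->
  kb != kb' -> tube m kb `&` tube m kb' = set0.
Proof.
move=> mr; case: kb kb' => [k b] [k' b'] ne; apply/seteqP; split => // e [].
move=> [/= a1 a2 a3] [/= b1 b2 b3].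
have bb : b = b'.
  apply/eqP; rewrite eqn_leq; apply/andP; split; rewrite leqNgt; apply/negP => bl.
    have : (b'.+1 * h <= b * h)%N by rewrite leq_mul2r bl orbT.
    by lia.
  have : (b.+1 * h <= b' * h)%N by rewrite leq_mul2r bl orbT.
  by lia.
have [i ki] : exists i, k i != k' i.
  apply/existsP; apply: contraNT ne; rewrite negb_exists => /forallP H.
  rewrite bb; apply/eqP; congr pair; apply/ffunP => i.
  by have := H i; rewrite negbK => /eqP.
have gap (a a' : labels) : (a i < a' i)%N ->
    (level r (a i) (moves i m) + h.+1 <= level r (a' i) (moves i m))%N.
  by move=> lt; apply: level_gap => //; rewrite /moves (leq_trans mr) // leq_addr.
have := leq_trans (le_norm1 _ i) a3; have := leq_trans (le_norm1 _ i) b3.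
rewrite !mxE /flow_end /endp /= !add0r !disp_flow //.
have := gap k k'; have := gap k' k; move: ki; rewrite -val_eqE neq_ltn.
move: (level r (k i) (moves i m)) (level r (k' i) (moves i m)) => l l'.
move: ((source e).1 0 i) (moves i m) => x q.
by case/orP => kk g1 g2; [have := g2 kk|have := g1 kk]; lia.
Qed.

Lemma tubes_mgf (kap w : R) m B : (r * h.+1 <= m %/ d)%N ->
  (\int[Q]_c (expR (- (kap * loop_best t0 c (0, 0%N))))%:E <= (expR (- (kap * w)))%:E)%E ->
  (\int[Q]_c (expR (- (kap * \sum_(k : labels) \sum_(b < B)
       loop_best t0 c (later (flow_end k m) b))))%:E <=
   (expR (- (kap * w) * (r ^ d * B)%:R))%:E)%E.
Proof.
move=> mr Hw; pose s := enum {: labels * 'I_B}.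
have e1 (c : conf) : expR (- (kap * \sum_(k : labels) \sum_(b < B)
       loop_best t0 c (later (flow_end k m) b))) =
    \prod_(kb <- s) expR (- (kap * loop_best t0 c (later (flow_end kb.1 m) kb.2))).
  by rewrite -expR_sum sumrN -mulr_sumr pair_big /s big_enum.
under eq_integral do rewrite e1 -prodEFin.
rewrite (independent_prod QE (B := fun kb : labels * 'I_B => tube m (kb.1, val kb.2))
  (F := fun kb (c : conf) =>
    (expR (- (kap * loop_best t0 c (later (flow_end kb.1 m) kb.2))))%:E)) //.
- apply: le_trans (_ : _ <= (expR (\sum_(kb <- s) - (kap * w)))%:E)%E _.
    apply: prode_le_expR => kb _.
      by apply: integral_ge0 => c _; rewrite lee_fin expR_ge0.
    by rewrite integral_loop_best //; exact/later_Xi/flow_end_Xi.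
  rewrite lee_fin ler_expR big_const_seq count_predT iter_addr_0 -[leLHS]mulr_natr.
  by rewrite /s -cardE card_prod card_ffun !card_ord.
- exact: enum_uniq.
- by move=> kb _; exact: measurable_expR_loop.
- move=> kb _ c c' cc'; congr (expR (- (kap * _)))%:E.
  exact: (@loop_best_depends m kb.1 kb.2).
- move=> kb kb' _ _ ne; exact: tube_disjoint.
Qed.

Lemma longest_measurable n v : measurable_fun setT (fun c : conf => longest n c v).
Proof. exact: rint_measurable (longest_rint i0 c0_gt0 Q_exp n v). Qed.

(** The exponential Markov inequality with parameter [kap r ^ d] for the average over labels. Flow
    and loops use edges before and from time [m] on, so their exponential moments multiply. *)
Lemma longest_deviation (kap w y : R) (G : nat -> R) m B : 0 <= kap ->
  (r * h.+1 <= m %/ d)%N -> (forall t, 0 <= G t) ->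
  (forall t, (t < m)%N -> neg_mgf (kap * (crowd (t %/ d) ^ d)%:R) <= (expR (G t))%:E)%E ->
  (\int[Q]_c (expR (- (kap * loop_best t0 c (0, 0%N))))%:E <= (expR (- (kap * w)))%:E)%E ->
  (Q [set c | longest (m + B * h) c (0, 0%N) <= y]%R <=
   (expR (kap * (r ^ d)%:R * (y - w * B%:R) +
      \sum_(t < m) G t * (2 * (t %/ d + 2) ^ d)%:R))%:E)%E.
Proof.
move=> kap0 mr G0 HG Hw; set S := [set c | _].
pose Ff (c : conf) := expR (- (kap * \sum_(k : labels) weight c (0, 0%N) (flow k m))).
pose Ft (c : conf) := expR (- (kap * \sum_(k : labels) \sum_(b < B)
       loop_best t0 c (later (flow_end k m) b))).
have mF : measurable_fun setT (fun c => (Ff c)%:E).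
  apply/measurable_EFinP; apply: measurableT_comp => //.
  apply: measurableT_comp => //; apply: measurable_funM; first exact: measurable_cst.
  by apply: measurable_sum => k; exact: weight_measurable.
have mT : measurable_fun setT (fun c => (Ft c)%:E).
  apply/measurable_EFinP; apply: measurableT_comp => //.
  apply: measurableT_comp => //; apply: measurable_funM; first exact: measurable_cst.
  by apply: measurable_sum => k; apply: measurable_sum => b; exact: loop_best_measurable.
have F0 c : (0 <= (Ff c)%:E)%E by rewrite lee_fin expR_ge0.
have T0 c : (0 <= (Ft c)%:E)%E by rewrite lee_fin expR_ge0.
have mS : measurable S.
  rewrite (_ : S = setT `&` (fun c => longest (m + B * h) c (0, 0%N)) @^-1` `]-oo, y]%classic).
    exact: longest_measurable.
  by rewrite setTI; apply/seteqP; split => c /=; rewrite in_itv.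
pose a := kap * (r ^ d)%:R * y.
have pw c : ((\1_S c)%:E <= (expR a)%:E * ((Ff c)%:E * (Ft c)%:E))%E.
  rewrite -!EFinM lee_fin indicE; have [cS|_] := boolP (c \in S); last first.
    by rewrite !mulr_ge0 ?expR_ge0.
  rewrite inE /S /= in cS; rewrite /Ff /Ft -!expRD -[leLHS]expR0 ler_expR.
  rewrite -opprD -mulrDr -big_split /= /a -mulrA -mulrBr mulr_ge0 // subr_ge0.
  apply: le_trans (_ : _ <= \sum_(k : labels) y) _; last first.
    by rewrite sumr_const card_ffun !card_ord mulr_natl.
  by apply: ler_sum => k _; exact: le_trans (flow_loops_longest c m B k) cS.
have -> : Q S = (\int[Q]_c (\1_S c)%:E)%E by rewrite integral_indic // setIT.
apply: (@le_trans _ _ (\int[Q]_c ((expR a)%:E * ((Ff c)%:E * (Ft c)%:E)))%E).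
  apply: ge0_le_integral => //.
  - by apply/measurable_EFinP; exact: measurable_indic.
  - by apply: emeasurable_funM; [exact: measurable_cst|exact: emeasurable_funM].
rewrite ge0_integralZl //; try exact: emeasurable_funM;
  try by [move=> c _; exact: mule_ge0|rewrite lee_fin expR_ge0].
rewrite (independent2 QE (A := [set e : edge d | ((source e).2 < m)%N])) //; first last.
- move=> c c' cc'; congr (expR (- (kap * _)))%:E.
  apply: eq_bigr => k _; apply: eq_bigr => b _.
  apply: loop_best_depends => e [/= h1 _ _]; apply: cc' => /= h2.
  by move: h1 h2; lia.
- move=> c c' cc'; congr (expR (- (kap * _)))%:E.
  apply: eq_bigr => k _; apply: weight_depends cc' => e /(mem_edges (Xi_origin d))[_ + _].
  by rewrite size_flow.
have -> : kap * (r ^ d)%:R * (y - w * B%:R) +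
      \sum_(t < m) G t * (2 * (t %/ d + 2) ^ d)%:R =
   a + (\sum_(t < m) G t * (2 * (t %/ d + 2) ^ d)%:R + - (kap * w) * (r ^ d * B)%:R).
  by rewrite /a natrM; move: (bigop.body _ _ _) ((r ^ d)%:R) => x z; ring.
rewrite !expRD !EFinM; apply: lee_pmul; [by rewrite lee_fin expR_ge0| |by []|].
  by apply: mule_ge0; apply: integral_ge0.
apply: lee_pmul; [exact: integral_ge0|exact: integral_ge0| |].
  exact: (flow_mgf QE r_gt0 kap0 G0 HG).
exact: tubes_mgf.
Qed.

End tubes.

(** * The convergent case *)

Section dyadic.
Context (R : realType).

Lemma sum_halves (n : nat) : \sum_(j < n) (2^-1 : R) ^+ j <= 2.
Proof.
have -> : \sum_(j < n) (2^-1 : R) ^+ j = 2 - 2 * (2^-1) ^+ n.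
  elim: n => [|n IH]; first by rewrite big_ord0 expr0; lra.
  by rewrite big_ord_recr /= IH exprS; lra.
by rewrite gerBl mulr_ge0 // exprn_ge0.
Qed.

Lemma sum_half_index (g : nat -> R) n :
  \sum_(j < 2 * n) g j./2 = 2 * \sum_(i < n) g i.
Proof.
elim: n => [|n IH]; first by rewrite !big_ord0 mulr0.
rewrite mulnS big_ord_recr big_ord_recr /= IH [in RHS]big_ord_recr /=.
by rewrite mul2n doubleK uphalf_double; ring.
Qed.

Lemma count_le (n : nat) (x : R) : 0 <= x ->
  \sum_(t < n) (if t.+1%:R <= x then 1 else 0) <= x.
Proof.
move=> x0; suff H : \sum_(t < n) (if t.+1%:R <= x then 1 else 0) <= Num.min n%:R x.
  by apply: le_trans H _; rewrite ge_min lexx orbT.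
elim: n => [|n IH]; first by rewrite big_ord0 le_min lexx.
rewrite big_ord_recr /=; case: ifP => nx.
  apply: (@le_trans _ _ (n%:R + 1)).
    by rewrite lerD2r (le_trans IH) // ge_min lexx.
  by rewrite le_min natr1 lexx.
rewrite addr0; apply: le_trans IH _.
by rewrite le_min !ge_min lexx orbT ler_nat leqnSn.
Qed.

(** If [crowd] is in the dyadic class [J], then [2 ^ (J - 1) < crowd], so [t / d] is at most of
    order [r / 2 ^ J]: crowded edges occur only at early times. *)
Lemma crowd_up_log r m C0 d t : (0 < r)%N -> (0 < C0)%N -> (m <= C0 * r)%N ->
  (t < m)%N -> ((t %/ d + 2) * 2 ^ up_log 2 (crowd r (t %/ d)) <= 6 * C0 * r)%N.
Proof.
move=> r0 C00 mC tm; set q := (t %/ d)%N.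
have [c1|c1] := leqP (crowd r q) 1.
  have -> : up_log 2 (crowd r q) = 0%N.
    by have -> : crowd r q = 1%N by apply/eqP; rewrite eqn_leq c1.
  have : (q <= t)%N by exact: leq_div.
  rewrite expn0 muln1 -mulnA; have : (0 < C0 * r)%N by rewrite muln_gt0 C00.
  by move: (C0 * r)%N mC => z; lia.
have /andP[+ _] := up_log_bounds (isT : 1 < 2)%N c1.
have : (0 < up_log 2 (crowd r q))%N by rewrite up_log_gt0 //= c1.
case: (up_log _ _) => // j _ /=; rewrite ltnS leq_divRL; last by lia.
move=> h; have : (2 ^ j * q <= r)%N by apply: leq_trans h; rewrite leq_mul2l leq_maxl orbT.
have : (2 ^ j <= r)%N by apply: leq_trans h; rewrite leq_pmulr //; lia.
rewrite expnS; have : (r <= C0 * r)%N by rewrite leq_pmull.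
rewrite -mulnA; move: (2 ^ j)%N (C0 * r)%N => z w h1 h2 h3.
have -> : ((q + 2) * (2 * z) = 2 * (z * q) + 4 * z)%N by ring.
by lia.
Qed.

(** Sort the times by the dyadic class [j] of their crowd. By [crowd_up_log] class [j] has at most
    [d x j] times with at most [2 (x j) ^ d] edges each, where [x j] is of order [r / 2 ^ j]; this
    produces the weight [2 ^ (- j (d + 1))]. *)
Lemma sum_crowd_le (G : nat -> R) (d C0 r m : nat) (S : R) :
  (0 < d)%N -> (0 < r)%N -> (0 < C0)%N -> (m <= C0 * r)%N -> (forall j, 0 <= G j) ->
  (forall n, \sum_(j < 2 * n) G j * (2^-1) ^+ (j * d.+1) <= S) ->
  \sum_(t < m) G (up_log 2 (crowd r (t %/ d))) * (2 * (t %/ d + 2) ^ d)%:R <=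
  (2 * d * (6 * C0) ^ d.+1)%:R * S * r%:R ^+ d.+1.
Proof.
move=> d0 r0 C00 mC G0 HS.
pose x j : R := (6 * C0 * r)%:R * 2^-1 ^+ j.
have x0 j : 0 <= x j by rewrite mulr_ge0 // exprn_ge0.
pose n := (up_log 2 r.+1).+1.
pose J t := up_log 2 (crowd r (t %/ d)).
have Jn t : (J t < 2 * n)%N.
  have : (J t <= up_log 2 r.+1)%N by apply: leq_up_log; rewrite /crowd ltnS leq_div.
  by rewrite /n; lia.
have Jx t : (t < m)%N -> (t %/ d + 2)%:R <= x (J t).
  move=> tm; have h := crowd_up_log d r0 C00 mC tm.
  rewrite /x exprVn ler_pdivlMr ?exprn_gt0 // -natrX -natrM ler_nat.
  exact: h.
have Jt t : (t < m)%N -> t.+1%:R <= d%:R * x (J t).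
  move=> tm; apply: le_trans (_ : _ <= d%:R * (t %/ d + 2)%:R) _.
    rewrite -natrM ler_nat; have := ltn_ceil t d0; rewrite mulSn mulnC => h.
    by apply: leq_trans h _; rewrite mulnDr mulnC; lia.
  by rewrite ler_wpM2l // Jx.
apply: (@le_trans _ _ (\sum_(t < m) \sum_(j < 2 * n)
   (if t.+1%:R <= d%:R * x j then 1 else 0) * (G j * (2 * x j ^+ d)))).
  apply: ler_sum => t _; rewrite (bigD1 (Ordinal (Jn t))) //= Jt // mul1r.
  apply: ler_wpDr.
    apply: sumr_ge0 => j _; apply: mulr_ge0; first by case: ifP.
    by rewrite !mulr_ge0 // exprn_ge0.
  rewrite ler_wpM2l // natrM natrX ler_wpM2l //; apply: lerXn2r; rewrite ?nnegrE //.
  exact: Jx.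
rewrite exchange_big /=.
apply: (@le_trans _ _ (\sum_(j < 2 * n) (d%:R * x j) * (G j * (2 * x j ^+ d)))).
  apply: ler_sum => j _; rewrite -mulr_suml; apply: ler_wpM2r.
    by rewrite !mulr_ge0 // exprn_ge0.
  by apply: count_le; rewrite mulr_ge0.
apply: (@le_trans _ _ ((2 * d * (6 * C0) ^ d.+1)%:R * r%:R ^+ d.+1 *
   \sum_(j < 2 * n) G j * (2^-1) ^+ (j * d.+1))); last first.
  by rewrite [leRHS]mulrAC ler_wpM2l // mulr_ge0 // exprn_ge0.
rewrite mulr_sumr; apply: ler_sum => j _; rewrite le_eqVlt; apply/orP; left; apply/eqP.
have -> : d%:R * x j * (G j * (2 * x j ^+ d)) = 2 * d%:R * G j * x j ^+ d.+1.
  by rewrite exprS; ring.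
rewrite /x exprMn -exprM !natrM natrX natrM exprMn.
by move: (2^-1 ^+ _) => z; ring.
Qed.

End dyadic.

Section summable.
Context (d : nat) (i0 : 'I_d) (R : realType).
Local Notation conf := (conf (edge d) R).
Local Notation longest := (longest i0).
Variables (Q : probability conf R) (nu : set R -> \bar R).
Hypothesis QE : forall (s : {fset edge d}) (A : edge d -> set R),
  (forall i, measurable (A i)) -> Q (cylinder s A) = (\prod_(i <- s) nu (A i))%E.
Variable c0 : R.
Hypothesis c0_gt0 : 0 < c0.
Hypothesis Q_exp : forall e (a : R), `|a| < c0 ->
  (\int[Q]_c (expR (a * c e))%:E < +oo)%E.
Hypothesis Q_mean : forall e, \int[Q]_c c e = 0.

Variable mu : R.
Hypothesis lower_prob : forall eps del : R, 0 < eps -> 0 < del ->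
  exists N, forall n, (N <= n)%N ->
    (Q [set c | longest n c (0, 0%N) < (mu - eps) * n%:R]%R <= del%:E)%E.
Variables (M0 : R) (f : R -> R).
Hypothesis f_gt0 : forall x, 0 < x -> 0 < f x.
Hypothesis f_incr : forall x y, 0 < x -> x <= y -> f x <= f y.
Hypothesis M0_gt0 : 0 < M0.
Hypothesis Q_tail : forall e (x : R), M0 < x ->
  Q [set c | c e < - x] = (expR (- (ln 2 * (x ^+ d.+1 * f x))))%:E.
Variable S : R.
Hypothesis f_sum : forall n, \sum_(i < n) ((f (2 ^+ i)) `^ (d%:R^-1))^-1 <= S.

Let d_gt0 : (0 < d)%N. Proof. exact: leq_ltn_trans (ltn_ord i0). Qed.

Section slope.
Variable kap : R.
Hypothesis kap0 : 0 < kap.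
Let K := 4 * (kap + 1) / ln 2 + 1.
Let u i := ((f (2 ^+ i)) `^ (d%:R^-1))^-1.
(** [2 ^ j * slope (j / 2)] is the [B] of [neg_mgf_le] for multiplicity [2 ^ (j d)]. The term
    [K * u i] makes [B ^ d * f B] large enough. The summable second term keeps [B] above
    [2 ^ (j / 2)], [M0] and 1 even when [u] is tiny, so that [f B] is at least [f (2 ^ (j / 2))].
    This is the reason for halving the index. *)
Definition slope i : R := K * u i + 2^-1 ^+ i * (M0 + 2).

Let ln20 : 0 < ln (2 : R) := ln2_gt0 R.

Let K1 : 1 <= K.
Proof. by rewrite lerDr divr_ge0 ?mulr_ge0 ?addr_ge0 // ltW. Qed.

Let u_gt0 i : 0 < u i.
Proof. by rewrite invr_gt0 powR_gt0 // f_gt0 // exprn_gt0. Qed.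

Let uX i : u i ^+ d = (f (2 ^+ i))^-1.
Proof.
rewrite /u exprVn; congr (_^-1).
rewrite -[LHS]powR_mulrn ?powR_ge0 // -powRrM mulVf ?pnatr_eq0 -?lt0n //.
by rewrite powRr1 // ltW // f_gt0 // exprn_gt0.
Qed.

Lemma slope_ge0 i : 0 <= slope i.
Proof.
rewrite /slope addr_ge0 // mulr_ge0 ?exprn_ge0 //; last by rewrite addr_ge0 // ltW.
- exact: le_trans K1.
- exact: ltW.
Qed.

Lemma neg_mgf_dyadic j :
  (neg_mgf i0 Q (kap * (2 ^+ j) ^+ d) <=
   (expR (ln 2 + kap * (2 ^+ j) ^+ d.+1 * slope j./2))%:E)%E.
Proof.
set i := j./2; pose B := 2 ^+ j * slope i.
have ij : (i <= j)%N by have := odd_double_half j; rewrite -addnn -/i; lia.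
have j2 : 2 ^+ i * 2^-1 ^+ i = 1 :> R by rewrite -exprMn divff // expr1n.
have p0 n : 0 < 2 ^+ n :> R by rewrite exprn_gt0.
have ji : 2 ^+ i <= 2 ^+ j :> R by rewrite ler_weXn2l // ler1n.
have Ku : 0 <= K * u i by rewrite mulr_ge0 // ?(le_trans _ K1) // ltW.
have B1 : 2 ^+ i * 2 ^+ i * (2^-1 ^+ i * (M0 + 2)) <= B.
  have ij2 : (i + i <= j)%N by have := odd_double_half j; rewrite -addnn -/i; lia.
  rewrite -exprD; apply: ler_pM.
  - exact: ltW.
  - by rewrite mulr_ge0 ?exprn_ge0 // addr_ge0 // ltW.
  - by rewrite ler_weXn2l // ler1n.
  - by rewrite /slope lerDr.
have B2 : 2 ^+ i * (M0 + 2) <= B.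
  apply: le_trans B1; move: j2; move: (2 ^+ i) (2^-1 ^+ i) => x y xy.
  by rewrite -[leRHS]mulrA (mulrA x y) xy mul1r.
have p1 : 1 <= 2 ^+ i :> R by rewrite exprn_ege1 // ler1n.
have M02 : 0 < M0 + 2 by rewrite addr_gt0.
have B3 : M0 + 2 <= B by apply: le_trans B2; rewrite ler_peMl // ltW.
have B4 : 2 ^+ i <= B.
  by apply: le_trans B2; rewrite ler_peMr ?(ltW (p0 _)) // ler_wpDl // ?ler1n // ltW.
have B0 : 0 < B by exact: lt_le_trans B3.
have HB : 4 * (kap * (2 ^+ j) ^+ d + 1) <= ln 2 * (B ^+ d * f B).
  have h1 : (2 ^+ j * (K * u i)) ^+ d <= B ^+ d.
    apply: lerXn2r; first by rewrite nnegrE mulr_ge0 // ltW.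
      by rewrite nnegrE ltW.
    rewrite /B ler_wpM2l // ?(ltW (p0 _)) // /slope lerDl mulr_ge0 ?exprn_ge0 //.
    exact: ltW.
  have h2 : f (2 ^+ i) <= f B by apply: f_incr.
  have f0 : 0 < f (2 ^+ i) by apply: f_gt0.
  (* The power [u i ^+ d] cancels [f (2 ^+ i)], and [K <= K ^+ d] because [K] is at least 1. *)
  have h3 : (2 ^+ j) ^+ d * K <= B ^+ d * f B.
    apply: le_trans (_ : _ <= (2 ^+ j * (K * u i)) ^+ d * f (2 ^+ i)) _.
      rewrite !exprMn uX -!mulrA mulVf ?gt_eqF // mulr1.
      rewrite ler_wpM2l ?exprn_ge0 //; exact: ler_eXnr.
    by apply: ler_pM => //; [rewrite exprn_ge0 // mulr_ge0 // ltW|exact: ltW].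
  apply: le_trans (_ : _ <= ln 2 * ((2 ^+ j) ^+ d * K)) _; last by rewrite ler_pM2l.
  have -> : ln 2 * ((2 ^+ j) ^+ d * K) = (2 ^+ j) ^+ d * (4 * (kap + 1) + ln 2).
    by rewrite /K; field; rewrite gt_eqF.
  have : 1 <= (2 ^+ j) ^+ d :> R by rewrite !exprn_ege1 // ler1n.
  move: ((2 ^+ j) ^+ d) => z z1.
  have : 0 <= z * ln 2 by rewrite mulr_ge0 ?ltW // (lt_le_trans ltr01).
  by move=> ?; lra.
have MB : M0 < B by apply: lt_le_trans B3; rewrite ltrDl.
have B11 : 1 <= B by apply: le_trans B3; rewrite ler_wpDl // ?ler1n // ltW.
have s0 : 0 <= kap * (2 ^+ j) ^+ d by rewrite mulr_ge0 ?exprn_ge0 // ltW.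
apply: le_trans (neg_mgf_le i0 f_gt0 f_incr Q_tail s0 B11 MB HB) _.
rewrite lee_fin expRD lnK ?posrE // ler_pM2l // ler_expR /B exprSr.
by rewrite !mulrA.
Qed.

Lemma slope_sum n :
  \sum_(j < 2 * n) (ln 2 + kap * (2 ^+ j) ^+ d.+1 * slope j./2) * 2^-1 ^+ (j * d.+1) <=
  2 * ln 2 + kap * (2 * (K * S + 2 * (M0 + 2))).
Proof.
apply: (@le_trans _ _ (\sum_(j < 2 * n) (ln 2 * 2^-1 ^+ j + kap * slope j./2))).
  apply: ler_sum => j _; rewrite mulrDl; apply: lerD.
    have x0 : 0 <= 2^-1 ^+ j :> R by rewrite exprn_ge0.
    have x1 : 2^-1 ^+ j <= 1 :> R by rewrite exprn_ile1 // invf_le1 // ler1n.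
    by rewrite ler_wpM2l ?(ltW ln20) // exprM exprS ler_piMr // exprn_ile1.
  have e : (2 ^+ j) ^+ d.+1 * 2^-1 ^+ (j * d.+1) = 1 :> R.
    by rewrite -exprM -exprMn divff // expr1n.
  by rewrite mulrAC -(mulrA kap) e mulr1.
rewrite big_split /= -mulr_sumr -mulr_sumr sum_half_index; apply: lerD.
  by rewrite mulrC ler_wpM2r ?sum_halves // ltW.
rewrite ler_pM2l // ler_pM2l // /slope big_split /= -mulr_sumr -mulr_suml.
have M02 : 0 <= M0 + 2 by rewrite addr_ge0 // ltW.
apply: lerD; last by rewrite ler_wpM2r // sum_halves.
by rewrite ler_wpM2l //; [exact: le_trans K1|exact: f_sum].
Qed.

End slope.

Theorem deviation_summable eps : 0 < eps -> exists2 a : R, 0 < a &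
  exists N, forall n, (N <= n)%N ->
  (Q [set c | longest n c (0, 0%N) <= (mu - eps) * n%:R]%R <=
   (expR (- (a * n%:R ^+ d.+1)))%:E)%E.
Proof.
move=> eps0; pose e := eps / 4; have e0 : 0 < e by rewrite divr_gt0.
have [h [t0 [h0 t00 hm]]] := loop_mean QE c0_gt0 Q_exp Q_mean lower_prob e0.
have eh0 : 0 < e * h%:R by rewrite mulr_gt0 // ltr0n.
have [kap kap0 Hkap] := chernoff_loop QE c0_gt0 Q_exp t00 eh0 hm.
have {}Hkap : (\int[Q]_c (expR (- (kap * loop_best i0 t0 c (0, 0%N))))%:E <=
    (expR (- (kap * ((mu - 2 * e) * h%:R))))%:E)%E.
  by have -> : (mu - 2 * e) * h%:R = (mu - e) * h%:R - e * h%:R by ring.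
pose G j := ln 2 + kap * (2 ^+ j) ^+ d.+1 * slope kap j./2.
have G0 j : 0 <= G j.
  rewrite /G addr_ge0 //; first by rewrite ln_ge0 // ler1n.
  by rewrite !mulr_ge0 ?exprn_ge0 ?slope_ge0 // ltW.
have [SS HSS] : exists SS, forall n, \sum_(j < 2 * n) G j * 2^-1 ^+ (j * d.+1) <= SS.
  by eexists => n; exact: slope_sum.
(* The flow needs [r (h + 1) d] steps to separate the tubes, plus fewer than [h] steps left over
   from division by the loop length. *)
pose C0 := (h.+1 * d + h)%N; have C00 : (0 < C0)%N by rewrite /C0; lia.
pose C1 := (2 * d * (6 * C0) ^ d.+1)%:R * SS.
pose z := `|kap * `|mu| * C0%:R + C1|.
(* The ratio of [n] to [r]: the loops gain [2 kap e n r ^ d], and the flow, of cost at most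
   [(kap |mu| C0 + C1) r ^ (d + 1)], may use half of it. Adding [C0] makes the flow fit into [n]
   steps. *)
pose Rn := (Num.bound (z / (kap * e)) + C0)%N.
have ke0 : 0 < kap * e by rewrite mulr_gt0.
have Rn0 : (0 < Rn)%N by rewrite /Rn addn_gt0 C00 orbT.
have zR : kap * `|mu| * C0%:R + C1 <= kap * e * Rn%:R.
  apply: le_trans (ler_norm _) _; rewrite -/z -ler_pdivrMl // mulrC.
  apply: le_trans (ltW (archi_boundP _)) _; first exact: divr_ge0 (normr_ge0 _) (ltW ke0).
  by rewrite /Rn ler_nat leq_addr.
exists (kap * e / (2 * Rn)%:R ^+ d); first by rewrite divr_gt0 // exprn_gt0 // ltr0n muln_gt0.
exists Rn => n Rnn; pose r := (n %/ Rn)%N.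
have r0 : (0 < r)%N by rewrite divn_gt0.
have rn : (r * Rn <= n)%N by exact: leq_trunc_div.
have nr : (n <= 2 * Rn * r)%N.
  have := ltn_ceil n Rn0; rewrite -/r mulSn => lt; apply: leq_trans (ltnW lt) _.
  have : (Rn <= Rn * r)%N by rewrite leq_pmulr.
  by rewrite (mulnC r) -mulnA; lia.
(* Whole loops are counted backwards from time [n]; the remainder lengthens the flow, so that
   [n = m + B * h] exactly. *)
pose m0 := (r * (h.+1 * d))%N.
have m0n : (m0 <= n)%N.
  by apply: leq_trans rn; rewrite leq_mul2l /Rn /C0; apply/orP; right; lia.
pose B := ((n - m0) %/ h)%N; pose m := (m0 + (n - m0) %% h)%N.
have nE : n = (m + B * h)%N.
  by rewrite /m -addnA [(_ %% _ + _)%N]addnC -divn_eq subnKC.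
have mC : (m <= C0 * r)%N.
  rewrite /m /m0 /C0 mulnDl mulnC leq_add2l; apply: leq_trans (ltnW (ltn_pmod _ h0)) _.
  by rewrite leq_pmulr.
have mr : (r * h.+1 <= m %/ d)%N.
  by rewrite leq_divRL // -mulnA leq_addr.
have HG t : (t < m)%N -> (neg_mgf i0 Q (kap * (crowd r (t %/ d) ^ d)%:R) <=
    (expR (G (up_log 2 (crowd r (t %/ d)))))%:E)%E.
  move=> tm; apply: le_trans (neg_mgf_dyadic kap0 _).
  apply: (le_neg_mgf i0 Q); rewrite ler_wpM2l ?(ltW kap0) // natrX; apply: lerXn2r.
  - by rewrite nnegrE.
  - by rewrite nnegrE exprn_ge0.
  by rewrite -natrX ler_nat up_logP.
have := longest_deviation QE c0_gt0 Q_exp r0 t00 ((mu - eps) * n%:R) B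
  (ltW kap0) mr (fun t => G0 (up_log 2 (crowd r (t %/ d)))) HG Hkap.
rewrite -nE => /le_trans; apply; rewrite lee_fin ler_expR.
have H1 := sum_crowd_le d_gt0 r0 C00 mC G0 HSS; rewrite -/C1 in H1.
apply: le_trans (lerD (lexx _) H1) _.
have rd0 : 0 <= r%:R ^+ d :> R by rewrite exprn_ge0.
have nR : n%:R = m%:R + B%:R * h%:R :> R by rewrite [in LHS]nE natrD natrM.
have mCR : m%:R <= C0%:R * r%:R :> R by rewrite -natrM ler_nat.
have muC : `|mu| * m%:R <= `|mu| * (C0%:R * r%:R) by rewrite ler_wpM2l.
have mum : mu * m%:R <= `|mu| * m%:R by rewrite ler_wpM2r // ler_norm.
have em : 0 <= e * m%:R by rewrite mulr_ge0 // ltW.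
have h1 : (mu - eps) * n%:R - (mu - 2 * e) * h%:R * B%:R <=
    - (2 * e * n%:R) + `|mu| * C0%:R * r%:R.
  have -> : (mu - eps) * n%:R - (mu - 2 * e) * h%:R * B%:R =
     - (2 * e * n%:R) + (mu * m%:R - 2 * (e * m%:R)).
    have -> : eps = 4 * e by rewrite /e; field.
    by rewrite nR; ring.
  by rewrite lerD2l -mulrA; lra.
have h2 : (kap * `|mu| * C0%:R + C1) * r%:R <= kap * e * n%:R.
  apply: le_trans (_ : _ <= kap * e * Rn%:R * r%:R) _; first by rewrite ler_wpM2r.
  by rewrite -[leLHS]mulrA ler_pM2l // -natrM ler_nat mulnC.
apply: (@le_trans _ _ (- (kap * e * n%:R * r%:R ^+ d))).
  rewrite natrX exprS.
  have h3 := ler_wpM2l (mulr_ge0 (ltW kap0) rd0) h1.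
  have h4 := ler_wpM2r rd0 h2.
  by move: h3 h4; move: (r%:R ^+ d) => x; lra.
rewrite lerN2 mulrAC ler_pdivrMr ?exprn_gt0 ?ltr0n ?muln_gt0 //.
rewrite exprS mulrA -[leRHS]mulrA ler_pM2l ?mulr_gt0 ?ltr0n ?(leq_trans Rn0) //.
by rewrite -exprMn lerXn2r ?nnegrE // -natrM ler_nat mulnC.
Qed.

End summable.

(** * The divergent case *)

Section cone.
Context (d : nat) (i0 : 'I_d).
Local Notation step := (step d).

(** A superset of the edges that a path can use at time [t], with coordinates shifted by [t] to
    become naturals. Off [Xi], [mkedge] returns an edge at time 0; the filter discards it when [t]
    is positive, so different times give disjoint lists. *)
Definition cone_edges t : seq (edge d) :=
  undup [seq e <- [seq mkedge i0 (\row_i ((us.1 i)%:Z - t%:Z), t) us.2 |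
    us : {ffun 'I_d -> 'I_(2 * t + 1)} * step <-
      enum {: {ffun 'I_d -> 'I_(2 * t + 1)} * step}] | (source e).2 == t].

Lemma size_cone_edges t : (size (cone_edges t) <= (2 * t + 1) ^ d * (2 * d))%N.
Proof.
apply: leq_trans (size_undup _) _; rewrite size_filter; apply: leq_trans (count_size _ _) _.
by rewrite size_map -cardE card_prod card_ffun card_prod card_bool !card_ord (mulnC d).
Qed.

Lemma time_cone_edges t e : e \in cone_edges t -> (source e).2 = t.
Proof. by rewrite mem_undup mem_filter => /andP[/eqP]. Qed.

Lemma mem_cone_edges (x : 'rV[int]_d) t s : Xi (x, t) -> (norm1 x <= t)%N ->
  mkedge i0 (x, t) s \in cone_edges t.
Proof.
move=> Xx xt; rewrite mem_undup mem_filter source_mkedge // eqxx /=.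
have lt i : (`|(x 0 i + t%:Z)%R|%N < 2 * t + 1)%N.
  by have := leq_trans (le_norm1 x i) xt; move: (x 0 i) => a; lia.
apply/mapP; exists ([ffun i => Ordinal (lt i)], s); first by rewrite mem_enum.
congr (mkedge _ (_, _) _); apply/rowP => i; rewrite mxE ffunE /=.
by have := leq_trans (le_norm1 x i) xt; move: (x 0 i) => a; lia.
Qed.

End cone.

Section divergent.
Context (d : nat) (i0 : 'I_d) (R : realType).
Local Notation conf := (conf (edge d) R).
Local Notation step := (step d).
Local Notation weight := (weight i0).
Variables (Q : probability conf R) (nu : set R -> \bar R).
Hypothesis QE : forall (s : {fset edge d}) (A : edge d -> set R),
  (forall i, measurable (A i)) -> Q (cylinder s A) = (\prod_(i <- s) nu (A i))%E.
Local Notation cone_edges := (@cone_edges _ i0).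
Variables (M0 : R) (f : R -> R).
Hypothesis f_gt0 : forall x, 0 < x -> 0 < f x.
Hypothesis M0_gt0 : 0 < M0.
Hypothesis Q_tail : forall e (x : R), M0 < x ->
  Q [set c | c e < - x] = (expR (- (ln 2 * (x ^+ d.+1 * f x))))%:E.

(** For [x > M0] this is minus the base 2 logarithm of the probability of a weight below [- x]. *)
Definition cost (x : R) : R := x ^+ d.+1 * f x.

Lemma cost_ge0 x : 0 < x -> 0 <= cost x.
Proof. by move=> x0; rewrite mulr_ge0 ?exprn_ge0 // ltW // f_gt0. Qed.

(** The indicator of the forcing event, written as a product so that independence of edges applies
    factor by factor. *)
Definition forced (a : nat -> R) T (c : conf) : \bar R :=
  (\prod_(t <- iota 0 T) \prod_(e <- cone_edges t) (\1_[set c : conf | c e < - a t] c)%:E)%E.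

Lemma level_set_measurable (e : edge d) (x : R) : measurable [set c : conf | c e < x].
Proof. by apply: strict_sublevel_measurable; exact: conf_eval_measurable. Qed.

Lemma measurable_prode (J : Type) (s : seq J) (F : J -> conf -> \bar R) :
  (forall j, measurable_fun setT (F j)) ->
  measurable_fun setT (fun c => (\prod_(j <- s) F j c)%E).
Proof.
move=> mF; elim: s => [|j s IH].
  apply: (eq_measurable_fun (cst 1%E)); last exact: measurable_cst.
  by move=> c _; rewrite big_nil.
apply: eq_measurable_fun (emeasurable_funM (mF j) IH) => c _.
by rewrite big_cons.
Qed.

Lemma forced_measurable a T : measurable_fun setT (forced a T).
Proof.
apply: measurable_prode => t; apply: measurable_prode => e.
by apply/measurable_EFinP; apply: measurable_indic; exact: level_set_measurable.
Qed.

Lemma forced_depends a T : depends_on [set e : edge d | ((source e).2 < T)%N] (forced a T).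
Proof.
move=> c c' cc'; rewrite /forced big_seq [in RHS]big_seq; apply: eq_bigr => t.
rewrite mem_iota => tT; rewrite big_seq [in RHS]big_seq; apply: eq_bigr => e et.
rewrite !indicE; congr (_%:R)%:E; congr nat_of_bool.
have ce : c e = c' e by apply: cc'; rewrite /= (time_cone_edges et).
by apply/idP/idP; rewrite !inE /= ce.
Qed.

Lemma forced_le1 a T c : (0 <= forced a T c <= 1)%E.
Proof.
have H (J : Type) (s : seq J) (F : J -> \bar R) : (forall j, 0 <= F j <= 1)%E ->
    (0 <= \prod_(j <- s) F j <= 1)%E.
  move=> FF; elim: s => [|j s IH]; first by rewrite big_nil lee01 lexx.
  rewrite big_cons; have /andP[a0 a1] := FF j; have /andP[b0 b1] := IH.
  by rewrite mule_ge0 //= -[leRHS]mule1 lee_pmul.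
apply: (H) => t; apply: (H) => e; rewrite indicE !lee_fin.
by case: (_ \in _); rewrite ?ler01 ?lexx.
Qed.

Lemma forced_in a T c t e : (forced a T c != 0)%E -> (t < T)%N ->
  e \in cone_edges t -> c e < - a t.
Proof.
move=> F0 tT et; rewrite ltNge; apply/negP => ce; move/negP: F0; apply.
have H (J : eqType) (s : seq J) (F : J -> \bar R) j : j \in s -> F j = 0%E ->
    (\prod_(j <- s) F j)%E = 0%E.
  elim: s => // k s IH; rewrite inE => /orP[/eqP <- Fj|js Fj].
    by rewrite big_cons Fj mul0e.
  by rewrite big_cons IH // mule0.
apply/eqP; apply: ((H) _ _ _ t); first by rewrite mem_iota.
apply: ((H) _ _ _ e) => //; rewrite indicE memNset //=.
by apply/negP; rewrite -leNgt.
Qed.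

Lemma integral_forced a T : (forall t, (t < T)%N -> M0 < a t) ->
  ((expR (- (ln 2 * \sum_(t < T) ((2 * t + 1) ^ d * (2 * d))%:R * cost (a t))))%:E <=
   \int[Q]_c forced a T c)%E.
Proof.
move=> aM; have ln20 := ln2_gt0 R.
have ind_dep e (x : R) : depends_on [set e] (fun c : conf => (\1_[set c : conf | c e < x] c)%:E : \bar R).
  move=> c c' cc'; rewrite !indicE; congr (_%:R)%:E; congr nat_of_bool.
  by apply/idP/idP; rewrite !inE /= (cc' e).
have mi e (x : R) : measurable_fun setT (fun c : conf => (\1_[set c : conf | c e < x] c)%:E : \bar R).
  by apply/measurable_EFinP; apply: measurable_indic; exact: level_set_measurable.
rewrite (independent_prod QE (B := fun t => [set e : edge d | (source e).2 = t])
  (F := fun t (c : conf) => \prod_(e <- cone_edges t) (\1_[set c : conf | c e < - a t] c)%:E)%E).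
- rewrite -[in leLHS](big_mkord xpredT
    (fun t => ((2 * t + 1) ^ d * (2 * d))%:R * cost (a t))) /index_iota subn0.
  rewrite -mulrN -sumrN mulr_sumr expR_sum -prodEFin.
  have : {in iota 0 T, forall t, (t < T)%N} by move=> t; rewrite mem_iota.
  elim: (iota 0 T) => [|t s IH] sT; first by rewrite !big_nil.
  rewrite !big_cons; apply: lee_pmul; first by rewrite lee_fin expR_ge0.
  - by apply: prode_ge0 => u _; rewrite lee_fin expR_ge0.
  - rewrite (independent_prod QE (B := fun e : edge d => [set e])
      (F := fun e (c : conf) => (\1_[set c : conf | c e < - a t] c)%:E)) ?undup_uniq //.
    + rewrite (eq_bigr (fun=> (expR (- (ln 2 * cost (a t))))%:E)).
        rewrite prodEFin lee_fin big_const_seq count_predT iter_mulr_1 -expRM_natl ler_expR.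
        rewrite !mulrN lerN2 [leLHS]mulrCA ler_pM2l // ler_wpM2r //.
          by apply/cost_ge0/(lt_trans M0_gt0)/aM/sT; exact: mem_head.
        by rewrite ler_nat size_cone_edges.
      move=> e _; rewrite integral_indic //; last exact: level_set_measurable.
      rewrite setIT; apply: (Q_tail e); apply/aM/sT; exact: mem_head.
    + by move=> e e' _ _ ne; apply/seteqP; split => // x [/= -> /eqP]; rewrite (negbTE ne).
  - by apply: IH => u us; apply: sT; rewrite inE us orbT.
- exact: iota_uniq.
- by move=> t _; exact: measurable_prode.
- by move=> t c; apply: prode_ge0 => e _; rewrite lee_fin.
- move=> t _ c c' cc'; rewrite big_seq [in RHS]big_seq; apply: eq_bigr => e et.
  by apply: ind_dep => _ ->; apply: cc'; exact: (time_cone_edges et).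
- by move=> t u _ _ tu; apply/seteqP; split => // e [/= -> /eqP]; rewrite (negbTE tu).
Qed.

Lemma forced_weight a T c (ss : seq step) : (forced a T c != 0)%E ->
  (size ss <= T)%N -> weight c (0, 0%N) ss <= - \sum_(t < size ss) a t.
Proof.
move=> F0; elim/last_ind: ss => [|ss s IH]; first by rewrite weight_nil big_ord0 oppr0.
rewrite size_rcons => sT; rewrite -cats1 weight_cat big_ord_recr /= opprD.
apply: lerD; first by apply: IH; exact: ltnW.
rewrite weightE /= big_seq1; apply: ltW; apply: (forced_in F0 sT).
have Xe := Xi_endp ss (Xi_origin d).
rewrite {1}/endp /= add0r add0n; apply: mem_cone_edges; last exact: norm1_disp.
by move: Xe; rewrite /endp /= add0r add0n.
Qed.

End divergent.

(** * Upper bound on the weights after the forced times *)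

Section late.
Context (d : nat) (i0 : 'I_d) (R : realType).
Local Notation conf := (conf (edge d) R).
Local Notation step := (step d).
Local Notation weight := (weight i0).
Variables (Q : probability conf R) (nu : set R -> \bar R).
Hypothesis QE : forall (s : {fset edge d}) (A : edge d -> set R),
  (forall i, measurable (A i)) -> Q (cylinder s A) = (\prod_(i <- s) nu (A i))%E.
Variable c0 : R.
Hypothesis c0_gt0 : 0 < c0.
Hypothesis Q_exp : forall e (a : R), `|a| < c0 ->
  (\int[Q]_c (expR (a * c e))%:E < +oo)%E.

Local Notation mgf := (@mgf _ i0 R Q).

(** A union bound over the paths by exponential moments. [Cl] is independent of [T], and the event
    concerns only edges from time [T] on, hence is independent of the forcing. *)
Lemma late_weights : exists Cl : R, forall n T, (0 < n)%N -> (T <= n)%N ->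
  exists L : set conf, [/\ measurable L,
    depends_on (~` [set e : edge d | ((source e).2 < T)%N]) L,
    ((2^-1)%:E <= Q L)%E &
    forall c (ss : seq step), L c -> size ss = n ->
      weight c (endp (0, 0%N) (take T ss)) (drop T ss) <= Cl * n%:R].
Proof.
pose th := c0 / 2; have th0 : 0 < th by rewrite divr_gt0.
have thc : `|th| < c0.
  by rewrite gtr0_norm // /th ltr_pdivrMr // ltr_pMr // ltr1n.
(* Adding 1 gives [M >= 1], so that a tail of a path, shorter than [n], is also bounded by
   [M ^+ n]. *)
pose M := mgf th + 1; pose S := #|{: step}|%:R * M.
have M0 : 0 <= mgf th by exact: mgf_ge0.
have M1 : 1 <= M by rewrite lerDr.
have Mp : 0 <= M by exact: le_trans M1.
have S0 : 0 <= S by rewrite mulr_ge0.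
(* Then [th * Cl = 2 * S], and the union bound has the base [S * expR (- (2 * S)) <= 1 / 2]. *)
pose Cl := 2 * S / th; exists Cl => n T n0 Tn.
have X0 := Xi_origin d.
pose lw (c : conf) (ss : seq step) := weight c (endp (0, 0%N) (take T ss)) (drop T ss).
pose Y (c : conf) := \sum_(ss : n.-tuple step) expR (- (th * (Cl * n%:R))) * expR (th * lw c ss).
have rw (ss : n.-tuple step) : rint Q (fun c => expR (th * lw c ss)).
  by apply: (expR_weight_rint i0 QE Q_exp) => //; exact: Xi_endp.
have rY : rint Q Y by apply: rint_sum => ss _; exact: rintZ.
pose L := [set c | Y c < 1].
have mL : measurable L.
  rewrite (_ : L = setT `&` Y @^-1` `]-oo, 1[%classic).
    exact: (rint_measurable rY).
  by rewrite setTI; apply/seteqP; split => c /=; rewrite in_itv.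
have SC : S * expR (- (th * Cl)) <= 2^-1.
  have thCl : th * Cl = 2 * S by rewrite /Cl mulrC mulfVK // gt_eqF.
  rewrite thCl expRN ler_pdivrMr ?expR_gt0 // ler_pdivlMl //.
  by apply: le_trans (expR_ge1Dx _); rewrite lerDr.
have IY : \int[Q]_c Y c <= 2^-1.
  rewrite Rintegral_sum; last by move=> ss _; exact: rintZ.
  apply: (@le_trans _ _ (\sum_(ss : n.-tuple step) expR (- (th * Cl)) ^+ n * M ^+ n)).
    apply: ler_sum => ss _; rewrite RintegralZl //; last exact: rw.
    rewrite (Rintegral_expR_weight i0 QE Q_exp) //; last exact: Xi_endp.
    apply: ler_pM; rewrite ?expR_ge0 ?exprn_ge0 //.
      by rewrite -expRM_natr mulNr mulrA.
    apply: (@le_trans _ _ (M ^+ size (drop T ss))).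
      by apply: lerXn2r; rewrite ?nnegrE // lerDl.
    by apply: ler_weXn2l => //; rewrite size_drop size_tuple leq_subr.
  rewrite sumr_const card_tuple -[leLHS]mulr_natl natrX -exprMn -exprMn.
  have -> : #|{: step}|%:R * (expR (- (th * Cl)) * M) = S * expR (- (th * Cl)).
    by rewrite mulrCA mulrC.
  have q0 : 0 <= S * expR (- (th * Cl)) by rewrite mulr_ge0 ?expR_ge0.
  apply: (le_trans _ SC); case: (n) n0 => // k _; rewrite exprS ler_piMr // exprn_ile1 //.
  by apply: le_trans SC _; rewrite invf_le1 // ler1n.
exists L; split => //.
- move=> c c' cc'; rewrite /L /=; congr (_ < 1 : Prop); apply: eq_bigr => ss _.
  congr (_ * expR (th * _)); apply: weight_depends cc' => e.
  move=> /(mem_edges (Xi_endp (take T ss) X0))[h1 h2 _] /=; apply/negP; rewrite -leqNgt.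
  by move: h1; rewrite /= add0n size_takel // size_tuple.
- have riL : rint Q (fun c => \1_L c : R) by exact: integrable_indic.
  have h : \int[Q]_c (1 - \1_L c) <= \int[Q]_c Y c.
    apply: le_Rintegral => //; first by apply: rintB => //; exact: rint_cst.
    move=> c _; rewrite indicE; have [cL|cL] := boolP (c \in L).
      rewrite subrr; apply: sumr_ge0 => ss _.
      by rewrite mulr_ge0 ?expR_ge0.
    by rewrite subr0 leNgt; apply: contra cL => h; rewrite inE.
  rewrite RintegralB // in h; last exact: rint_cst.
  rewrite Rintegral_const in h.
  have QL : \int[Q]_c \1_L c = fine (Q L) by rewrite /Rintegral integral_indic // setIT.
  rewrite QL in h; rewrite -[Q L]fineK; last exact: fin_num_measure.
  rewrite lee_fin; have {}h := le_trans h IY.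
  have e2 : 2^-1 + 2^-1 = 1 :> R by field.
  by lra.
- move=> c ss Lc sz.
  pose t : n.-tuple step := tcast sz (in_tuple ss).
  have -> : ss = t by rewrite val_tcast.
  rewrite leNgt; apply/negP => lt.
  have : Y c < 1 by exact: Lc.
  rewrite ltNge => /negP; apply; rewrite /Y (bigD1 t) //=.
  apply: ler_wpDr; first by apply: sumr_ge0 => ? _; rewrite mulr_ge0 ?expR_ge0.
  rewrite -expRD -[leLHS]expR0 ler_expR addrC -mulrBr mulr_ge0 // ?ltW //.
  by rewrite subr_gt0.
Qed.

End late.

Section slabs.
Context (R : realType).

(** The slab of times below [2 ^ (N - j)] contributes through its upper half, of length
    [2 ^ (N - j.+1)]; these halves are disjoint for different [j]. *)
Lemma slab_gain (a al : nat -> R) N J k i : (forall t, 0 <= a t) ->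
  (forall j t, (i <= j < J)%N -> (t < 2 ^ (N - j))%N -> al j <= a t) ->
  (i + k = J)%N -> (J <= N)%N ->
  \sum_(i <= j < J) (2 ^ (N - j.+1))%:R * al j <= \sum_(t < 2 ^ (N - i)) a t.
Proof.
move=> a0; elim: k i => [|k IH] i H e JN.
  by rewrite big_geq; [apply: sumr_ge0|rewrite -e addn0].
have iJ : (i < J)%N by rewrite -e; lia.
rewrite big_ltn //; set p := (2 ^ (N - i.+1))%N.
have pE : (2 ^ (N - i) = p + p)%N.
  have -> : (N - i = (N - i.+1).+1)%N by lia.
  by rewrite expnS mul2n -addnn.
rewrite pE -(big_mkord xpredT a) (big_cat_nat (leq0n p) (leq_addr p p)) /= addrC.
apply: lerD; last first.
  rewrite big_mkord; apply: IH => //; last by rewrite -e addSnnS.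
  by move=> j t /andP[ij jJ]; apply: H; rewrite jJ ltnW.
apply: (@le_trans _ _ (\sum_(p <= t < p + p) al i)).
  by rewrite sumr_const_nat addnK mulr_natl.
apply: ler_sum_nat => t /andP[_ tp]; apply: H; first by rewrite leqnn.
by rewrite pE.
Qed.

(** Each time is charged to one slab that contains it and has its cost; there [K] is at most its
    value at the end of the slab. *)
Lemma slab_cost (g al : nat -> R) N j0 J (K : nat -> R) :
  (J <= N)%N -> (forall j, 0 <= al j) -> (forall t u, (t <= u)%N -> 0 <= K t <= K u) ->
  (forall t, (t < 2 ^ (N - j0))%N -> exists j, [/\ (j0 <= j < J)%N,
     (t < 2 ^ (N - j))%N & g t = al j]) ->
  \sum_(t < 2 ^ (N - j0)) K t * g t <=
  \sum_(j0 <= j < J) (2 ^ (N - j))%:R * (K (2 ^ (N - j))%N * al j).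
Proof.
move=> JN al0 K0 H.
apply: (@le_trans _ _ (\sum_(t < 2 ^ (N - j0)) \sum_(j0 <= j < J)
  (if t.+1%:R <= (2 ^ (N - j))%:R :> R then 1 else 0) * (K (2 ^ (N - j))%N * al j))).
  apply: ler_sum => t _; have [j [jJ tj ->]] := H t (ltn_ord t).
  rewrite (big_rem j) /=; last by rewrite mem_index_iota.
  rewrite ler_nat tj mul1r; apply: ler_wpDr.
    apply: sumr_ge0 => i _; apply: mulr_ge0; first by case: ifP.
    by rewrite mulr_ge0 //; case/andP: (K0 _ _ (leqnn (2 ^ (N - i))%N)).
  by rewrite ler_wpM2r //; case/andP: (K0 _ _ (ltnW tj)).
rewrite exchange_big /=; apply: ler_sum => j _; rewrite -mulr_suml ler_wpM2r //.
  by rewrite mulr_ge0 //; case/andP: (K0 _ _ (leqnn (2 ^ (N - j))%N)).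
exact: count_le.
Qed.

Lemma sum_halves_from j0 J : \sum_(j0 <= j < J) (2^-1 : R) ^+ j <= 2 * 2^-1 ^+ j0.
Proof.
have [Jj|jJ] := leqP J j0; first by rewrite big_geq // mulr_ge0 // exprn_ge0.
rewrite -{1}[j0]add0n big_addn big_mkord.
under eq_bigr do rewrite exprD.
by rewrite -mulr_suml ler_wpM2r ?exprn_ge0 // sum_halves.
Qed.

End slabs.

Section lower.
Context (d : nat) (i0 : 'I_d) (R : realType).
Local Notation conf := (conf (edge d) R).
Local Notation longest := (longest i0).
Variables (Q : probability conf R) (nu : set R -> \bar R).
Hypothesis QE : forall (s : {fset edge d}) (A : edge d -> set R),
  (forall i, measurable (A i)) -> Q (cylinder s A) = (\prod_(i <- s) nu (A i))%E.
Variable c0 : R.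
Hypothesis c0_gt0 : 0 < c0.
Hypothesis Q_exp : forall e (a : R), `|a| < c0 ->
  (\int[Q]_c (expR (a * c e))%:E < +oo)%E.

Variables (M0 : R) (f : R -> R).
Hypothesis f_gt0 : forall x, 0 < x -> 0 < f x.
Hypothesis f_incr : forall x y, 0 < x -> x <= y -> f x <= f y.
Hypothesis M0_gt0 : 0 < M0.
Hypothesis Q_tail : forall e (x : R), M0 < x ->
  Q [set c | c e < - x] = (expR (- (ln 2 * (x ^+ d.+1 * f x))))%:E.

Let d_gt0 : (0 < d)%N. Proof. exact: leq_ltn_trans (ltn_ord i0). Qed.

Let u i := ((f (2 ^+ i)) `^ (d%:R^-1))^-1.
Hypothesis f_div : forall S, exists n, S < \sum_(i < n) u i.

Let p0 n : 0 < 2 ^+ n :> R. Proof. by rewrite exprn_gt0. Qed.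

Let u_gt0 i : 0 < u i.
Proof. by rewrite invr_gt0 powR_gt0 // f_gt0. Qed.

Let uX i : u i ^+ d = (f (2 ^+ i))^-1.
Proof.
rewrite /u exprVn; congr (_^-1).
rewrite -[LHS]powR_mulrn ?powR_ge0 // -powRrM mulVf ?pnatr_eq0 -?lt0n //.
by rewrite powRr1 // ltW // f_gt0.
Qed.

Let u_le i : u i <= u 0%N.
Proof.
rewrite lef_pV2 ?posrE ?powR_gt0 ?f_gt0 //.
have fp n : f (2 ^+ n) \is Num.nneg by rewrite nnegrE ltW // f_gt0.
apply: ge0_ler_powR => //.
by apply: f_incr => //; rewrite expr0 exprn_ege1 // ler1n.
Qed.

(** With [b = rho u j <= 1], monotonicity bounds [f (2 ^ j b)] by [f (2 ^ j)], which cancels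
    [u j ^ d]. What remains is [rho ^ d b], at most [rho b]. *)
Let cost_le (rho : R) (N j : nat) : 0 < rho -> rho <= 1 -> rho * u 0%N <= 1 -> (j <= N)%N ->
  (2 ^ (N - j))%:R ^+ d.+1 * cost d f (2 ^+ j * (rho * u j)) <=
  (2 ^ N)%:R ^+ d.+1 * (rho * (rho * u j)).
Proof.
move=> r0 r1 ru jN; set b := rho * u j.
have b0 : 0 < b by rewrite mulr_gt0.
have b1 : b <= 1 by apply: le_trans ru; rewrite ler_pM2l.
have fj : 0 < f (2 ^+ j) by exact: f_gt0.
have nE : (2 ^ (N - j))%:R * 2 ^+ j = (2 ^ N)%:R :> R by rewrite -natrX -natrM -expnD subnK.
rewrite /cost [leLHS]mulrA -exprMn (mulrA _ (2 ^+ j) b) nE exprMn -[leLHS]mulrA ler_wpM2l ?exprn_ge0 //.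
apply: (@le_trans _ _ (b ^+ d.+1 * f (2 ^+ j))).
  rewrite ler_wpM2l ?exprn_ge0 // ?(ltW b0) //; apply: f_incr; first by rewrite mulr_gt0.
  by rewrite ler_piMr // ltW.
rewrite exprS -mulrA [leRHS]mulrC ler_wpM2l ?(ltW b0) // /b exprMn uX mulfVK ?gt_eqF //.
by case: (d) d_gt0 => // d' _; rewrite exprS ler_piMr ?(ltW r0) // exprn_ile1 // ltW.
Qed.

(* For j0 <= j < J the weights at times t < 2 ^ (N - j) are forced below
   - max (2 ^ j (rho u j), A). The cutoff A > M0 is where the tail assumption
   applies, and its total cost is small because j0 is large. *)
Theorem deviation_divergent (y del : R) : 0 < del -> exists N0, forall N, (N0 <= N)%N ->
  ((expR (- (del * (2 ^ N)%:R ^+ d.+1)))%:E <=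
   Q [set c | longest (2 ^ N) c (0, 0%N) <= y * (2 ^ N)%:R]%R)%E.
Proof.
move=> del0; have [Cl HCl] := late_weights i0 QE c0_gt0 Q_exp.
have ln20 := ln2_gt0 R.
(* The forcing has to bring the bound [Cl n] down to [y n]. The factor 2 is there because
   [slab_gain] keeps only half of each slab. Introducing the constants through existentials keeps
   them opaque. *)
have [Bd BdE] : exists Bd, Bd = 2 * `|Cl - y| + 1 by eexists.
have Bd0 : 0 < Bd by rewrite BdE ltr_wpDl // mulr_ge0.
have [A AM] : exists A, M0 < A by exists (M0 + 1); rewrite ltrDl.
have A0 : 0 < A by exact: lt_trans AM.
have [cA cAE] : exists cA, cA = cost d f A by eexists.
have cA0 : 0 <= cA by rewrite cAE; exact: cost_ge0.
have [Cd CdE] : exists Cd : R, Cd = (3 ^ d * (2 * d))%:R by eexists.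
have Cd0 : 0 < Cd by rewrite CdE ltr0n !muln_gt0 expn_gt0.
have [kk kkE] : exists kk, kk = ln 2 * Cd by eexists.
have kk0 : 0 < kk by rewrite kkE mulr_gt0.
(* The cutoff [A] costs at most [cA 2 ^ (- j)] on slab [j]; starting at a large [j0] makes the sum
   of these negligible. *)
have [j0 j0E] : exists j0, kk * (cA * (2 * 2^-1 ^+ j0)) <= del / 4.
  pose j0 := Num.bound (8 * kk * cA / del); exists j0.
  have : 8 * kk * cA / del <= 2 ^+ j0.
    apply: le_trans (ltW (archi_boundP _)) _.
      apply: divr_ge0 (ltW del0); apply: mulr_ge0 => //; apply: mulr_ge0 => //; exact: ltW.
    by rewrite -natrX ler_nat ltnW // ltn_expl.
  rewrite ler_pdivrMr // exprVn => h.
  have -> : kk * (cA * (2 * (2 ^+ j0)^-1)) = 8 * kk * cA / 2 ^+ j0 / 4.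
    by move: (p0 j0); move: (2 ^+ j0) => x x0; field; rewrite gt_eqF.
  by rewrite ler_pM2r ?invr_gt0 // ler_pdivrMr // [leRHS]mulrC.
have Bd1 : 0 < Bd + 1 by rewrite addr_gt0.
have k4 : 0 < 4 * kk * (Bd + 1) by rewrite !mulr_gt0.
(* The forced sum will lie between [Bd] and [Bd + 1] for any such [rho], while its cost carries one
   more factor [rho]. *)
have [rho [r0 r1 ru rk]] : exists rho, [/\ 0 < rho, rho <= 1, rho * u 0%N <= 1 &
    kk * (rho * (Bd + 1)) <= del / 4].
  exists (Num.min 1 (Num.min (u 0%N)^-1 (del / (4 * kk * (Bd + 1))))); split.
  - by rewrite !lt_min ltr01 invr_gt0 u_gt0 divr_gt0.
  - by rewrite ge_min lexx.
  - by rewrite -ler_pdivlMr // div1r !ge_min lexx orbT.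
  set rho := Num.min _ _.
  have : rho <= del / (4 * kk * (Bd + 1)) by rewrite !ge_min lexx !orbT.
  by move: rho => rho; rewrite ler_pdivlMr // => h; rewrite ler_pdivlMr //; lra.
pose be j := rho * u j.
have be0 j : 0 < be j by rewrite mulr_gt0.
have be1 j : be j <= 1 by apply: le_trans ru; rewrite ler_pM2l.
(* The least [J] that reaches [Bd] overshoots by at most one term, and the terms are at most 1. *)
have [J JB Jmin] : exists2 J, Bd <= \sum_(j0 <= j < J) be j &
    forall J', Bd <= \sum_(j0 <= j < J') be j -> (J <= J')%N.
  have ex : exists J, Bd <= \sum_(j0 <= j < J) be j.
    have [n Hn] := f_div (\sum_(i < j0) u i + Bd / rho).
    have jn : (j0 <= n)%N.
      rewrite leqNgt; apply/negP => nj.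
      have : \sum_(i < n) u i <= \sum_(i < j0) u i.
        rewrite -!(big_mkord xpredT u) (big_cat_nat (leq0n n) (ltnW nj)) /=.
        by rewrite lerDl; apply: sumr_ge0 => i _; exact: ltW.
      have : 0 < Bd / rho by rewrite divr_gt0.
      by move=> ? ?; lra.
    exists n; rewrite /be -mulr_sumr -ler_pdivrMl // mulrC ltW //.
    move: Hn; rewrite -!(big_mkord xpredT u) (big_cat_nat (leq0n j0) jn) /=.
    by rewrite ltrD2l.
  by have [J h1 h2] := ex_minnP ex; exists J.
have jJ : (j0 < J)%N.
  by rewrite ltnNge; apply/negP => Jj; move: JB; rewrite big_geq // leNgt Bd0.
have JB1 : \sum_(j0 <= j < J) be j <= Bd + 1.
  case: J JB Jmin jJ => // J JB Jmin jJ.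
  rewrite big_nat_recr //=; apply: lerD => //; rewrite leNgt; apply/negP => /ltW /Jmin.
  by rewrite ltnn.
(* The second summand makes the probability 1/2 of the late event cost at most [del / 2] of the
   exponent. *)
exists (J + Num.bound (2 / del))%N => N N0N.
have JN : (J <= N)%N by apply: leq_trans N0N; rewrite leq_addr.
have [n nE] : exists n, n = (2 ^ N)%N by eexists.
have [T TE] : exists T, T = (2 ^ (N - j0))%N by eexists.
rewrite -nE.
have n0 : (0 < n)%N by rewrite nE expn_gt0.
have Tn : (T <= n)%N by rewrite nE TE leq_pexp2l // leq_subr.
have [L [mL dL QL HL]] := HCl n T n0 Tn.
pose al j := Num.max (2 ^+ j * be j) A.
have alA j : A <= al j by rewrite le_max lexx orbT.
have al0 j : 0 < al j by exact: lt_le_trans (alA j).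
(* The slabs are nested; each time gets the strictest of its requirements, and 0 from time [T]
   on. *)
pose a t := \big[Num.max/0]_(j0 <= j < J | (t < 2 ^ (N - j))%N) al j.
have a0 t : 0 <= a t by exact: bigmax_ge_id.
have aal j t : (j0 <= j < J)%N -> (t < 2 ^ (N - j))%N -> al j <= a t.
  by move=> jj tj; apply: le_bigmax_seq => //; rewrite mem_index_iota.
have aat t : (t < T)%N -> exists j, [/\ (j0 <= j < J)%N, (t < 2 ^ (N - j))%N & a t = al j].
  move=> tT; have : a t = 0 \/ exists j, [/\ (j0 <= j < J)%N, (t < 2 ^ (N - j))%N & a t = al j].
    rewrite /a big_seq_cond; elim/big_ind : _ => [|x z Hx Hz|j].
    - by left.
    - by rewrite /Num.max; case: ifP.
    - by rewrite mem_index_iota => /andP[? ?]; right; exists j.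
  case=> // at0; have := aal j0 t; rewrite leqnn jJ at0 -TE => /(_ isT tT) /(lt_le_trans (al0 j0)).
  by rewrite ltxx.
have aM t : (t < T)%N -> M0 < a t.
  by move=> /aat[j [_ _ ->]]; exact: lt_le_trans AM (alA j).
have nj j : (j <= N)%N -> (2 ^ (N - j))%:R = n%:R * 2^-1 ^+ j :> R.
  by move=> jN; rewrite exprVn nE -{2}(subnK jN) expnD natrM !natrX mulfK // gt_eqF.
have gain : n%:R * `|Cl - y| <= \sum_(t < T) a t.
  rewrite TE; apply: le_trans (slab_gain a0 aal (subnKC (ltnW jJ)) JN).
  apply: (@le_trans _ _ (\sum_(j0 <= j < J) n%:R / 2 * be j)).
    rewrite -mulr_sumr; apply: le_trans (ler_wpM2l _ JB) => //.
    rewrite BdE -mulrA ler_wpM2l //; move: (`|_|) => x; lra.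
  apply: ler_sum_nat => j /andP[_ jj].
  have jN : (j.+1 <= N)%N by exact: leq_trans jj JN.
  rewrite nj // exprS; apply: (@le_trans _ _ (n%:R * (2^-1 * 2^-1 ^+ j) * (2 ^+ j * be j))).
    have e : 2^-1 ^+ j * 2 ^+ j = 1 :> R by rewrite -exprMn mulVf // expr1n.
    rewrite le_eqVlt; apply/orP; left; apply/eqP; move: e.
    move: (2^-1 ^+ j) (2 ^+ j) (be j) => x z b e.
    have -> : n%:R * (2^-1 * x) * (z * b) = n%:R * 2^-1 * (x * z) * b.
      by rewrite !mulrA (mulrAC _ x z) -!mulrA.
    by rewrite e mulr1.
  by rewrite ler_wpM2l ?mulr_ge0 ?exprn_ge0 // le_max lexx.
pose Kt t : R := ((2 * t + 1) ^ d * (2 * d))%:R.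
have costs : \sum_(t < T) Kt t * cost d f (a t) <=
    Cd * (n%:R ^+ d.+1 * (rho * (Bd + 1) + cA * (2 * 2^-1 ^+ j0))).
  rewrite TE; apply: le_trans (@slab_cost _ (fun t => cost d f (a t)) (fun j => cost d f (al j)) N j0 J Kt JN _ _ _) _.
  - by move=> j; exact: cost_ge0.
  - move=> t v tv; rewrite /Kt ler0n ler_nat leq_mul2r; apply/orP; right.
    by rewrite leq_exp2r // leq_add2r leq_mul2l tv orbT.
  - by move=> t; rewrite -TE => /aat[j [? ? ->]]; exists j.
  apply: (@le_trans _ _ (\sum_(j0 <= j < J) Cd * (n%:R ^+ d.+1 * (rho * be j + cA * 2^-1 ^+ j)))).
    apply: ler_sum_nat => j /andP[_ jj].
    have jN : (j <= N)%N by rewrite (leq_trans (ltnW jj)).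
    set p := (2 ^ (N - j))%N; have p0' : (0 < p)%N by rewrite expn_gt0.
    have Kp : Kt p <= Cd * p%:R ^+ d.
      rewrite /Kt CdE -natrX -natrM ler_nat mulnAC leq_mul2r -expnMn leq_exp2r //.
      by rewrite -[3%N]/(2 + 1)%N mulnDl mul1n leq_add2l p0' orbT.
    have c0' : 0 <= cost d f (al j) by exact: cost_ge0.
    apply: (@le_trans _ _ (Cd * (p%:R ^+ d.+1 * cost d f (al j)))).
      have h := ler_wpM2l (ler0n R p) (ler_wpM2r c0' Kp).
      apply: le_trans h _; rewrite exprS le_eqVlt; apply/orP; left; apply/eqP.
      by move: (p%:R : R) (p%:R ^+ d) (cost _ _ _) => x z w; ring.
    rewrite ler_pM2l //.
    apply: (@le_trans _ _ (p%:R ^+ d.+1 * (cost d f (2 ^+ j * be j) + cA))).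
      rewrite ler_wpM2l ?exprn_ge0 // /al /Num.max; case: ifP => _.
        by rewrite -cAE lerDr cost_ge0 // mulr_gt0.
      by rewrite lerDl.
    rewrite mulrDr mulrDr; apply: lerD; first by rewrite nE; exact: cost_le.
    rewrite nj // exprMn -mulrA ler_wpM2l ?exprn_ge0 // mulrC ler_wpM2l //.
    have x0 : 0 <= 2^-1 ^+ j :> R by rewrite exprn_ge0.
    have x1 : 2^-1 ^+ j <= 1 :> R by rewrite exprn_ile1 // invf_le1 // ler1n.
    by rewrite exprS ler_piMr // exprn_ile1.
  rewrite -mulr_sumr ler_pM2l // -mulr_sumr ler_wpM2l ?exprn_ge0 //.
  rewrite big_split /=; apply: lerD; first by rewrite -mulr_sumr ler_pM2l.
  by rewrite -mulr_sumr ler_wpM2l // sum_halves_from.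
set S := [set c | _].
have mS : measurable S.
  rewrite (_ : S = setT `&` (fun c => longest n c (0, 0%N)) @^-1` `]-oo, y * n%:R]%classic).
    exact: (longest_measurable i0 c0_gt0 Q_exp).
  by rewrite setTI; apply/seteqP; split => c /=; rewrite in_itv.
have mI : measurable_fun setT (fun c : conf => (\1_L c)%:E : \bar R).
  by apply/measurable_EFinP; exact: measurable_indic.
have mF := forced_measurable i0 a T.
have pw c : (forced i0 a T c * (\1_L c)%:E <= (\1_S c)%:E)%E.
  have /andP[F0 F1] := forced_le1 i0 a T c.
  have [->|Fn0] := eqVneq (forced i0 a T c) 0%E; first by rewrite mul0e lee_fin.
  rewrite !indicE; have [cL|cL] := boolP (c \in L); last by rewrite mule0 lee_fin.
  rewrite mem_set ?mule1 // /S /=; rewrite inE in cL.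
  have [ss sz ->] := longest_attained i0 n c (0, 0%N).
  rewrite -(cat_take_drop T ss) weight_cat.
  have szT : size (take T ss) = T by rewrite size_takel // sz.
  have h1 := forced_weight Fn0 (eq_leq szT).
  have h2 := HL c ss cL sz; rewrite szT in h1.
  have h3 : (Cl - y) * n%:R <= n%:R * `|Cl - y| by rewrite mulrC ler_wpM2l // ler_norm.
  lra.
have QS : (\int[Q]_c (forced i0 a T c * (\1_L c)%:E) <= Q S)%E.
  have -> : Q S = (\int[Q]_c (\1_S c)%:E)%E by rewrite integral_indic // setIT.
  apply: ge0_le_integral => //.
  - by move=> c _; apply: mule_ge0; [case/andP: (forced_le1 i0 a T c)|rewrite lee_fin].
  - exact: emeasurable_funM.
  - by apply/measurable_EFinP; exact: measurable_indic.
apply: le_trans QS; rewrite (independent2 QE (A := [set e : edge d | ((source e).2 < T)%N])) //.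
- have -> : (\int[Q]_c (\1_L c)%:E = Q L)%E by rewrite integral_indic // setIT.
  have -> : - (del * n%:R ^+ d.+1) = - (del / 2 * n%:R ^+ d.+1) + - (del / 2 * n%:R ^+ d.+1).
    by field.
  rewrite expRD EFinM; apply: lee_pmul; rewrite ?lee_fin ?expR_ge0 //.
    apply: le_trans (integral_forced i0 QE f_gt0 M0_gt0 Q_tail aM).
    rewrite lee_fin ler_expR lerN2; apply: le_trans (ler_wpM2l (ltW ln20) costs) _.
    have -> : ln 2 * (Cd * (n%:R ^+ d.+1 * (rho * (Bd + 1) + cA * (2 * 2^-1 ^+ j0)))) =
      (kk * (rho * (Bd + 1)) + kk * (cA * (2 * 2^-1 ^+ j0))) * n%:R ^+ d.+1.
      by rewrite -mulrDr kkE; move: (rho * _ + _) => z; ring.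
    by rewrite ler_wpM2r ?exprn_ge0 //; lra.
  apply: le_trans QL; rewrite lee_fin expRN lef_pV2 ?posrE ?expR_gt0 //.
  apply: le_trans (expR_ge1Dx _).
  have Nn : (N <= n)%N by rewrite nE ltnW // ltn_expl.
  have h : 2 / del <= n%:R.
    apply: le_trans (ltW (archi_boundP _)) _; first by rewrite divr_ge0 // ltW.
    by rewrite ler_nat (leq_trans _ Nn) // (leq_trans _ N0N) // leq_addl.
  have h2 : n%:R <= n%:R ^+ d.+1 :> R.
    by rewrite exprS ler_peMr // exprn_ege1 // ler1n.
  have := le_trans h h2; rewrite ler_pdivrMr // mulrC => h3; lra.
- by move=> c; case/andP: (forced_le1 i0 a T c).
- exact: forced_depends.
- move=> c c' cc'; rewrite !indicE; congr (_%:R)%:E; congr nat_of_bool.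
  by apply/idP/idP; rewrite !inE (dL c c' cc').
Qed.

End lower.

(** * Transfer to the theorem *)

Section limsup.
Context (R : realType).
Implicit Type u : (\bar R)^nat.

Lemma limn_esup_le u (b : \bar R) N :
  (forall n, (N <= n)%N -> (u n <= b)%E) -> (limn_esup u <= b)%E.
Proof.
move=> ub; rewrite limn_esup_lim; apply: lime_le; first exact: is_cvg_esups.
near=> m; rewrite /esups; apply: ge_ereal_sup => _ [n /= mn <-].
apply: ub; apply: leq_trans mn; near: m; exact: nbhs_infty_ge.
Unshelve. all: by end_near. Qed.

Lemma limn_esup_ge u (b : \bar R) :
  (forall m, exists2 n, (m <= n)%N & (b <= u n)%E) -> (b <= limn_esup u)%E.
Proof.
move=> bu; rewrite limn_esup_lim; apply: lime_ge; first exact: is_cvg_esups.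
near=> m; have [n mn /le_trans] := bu m; apply; apply: ereal_sup_ubound.
by exists n.
Unshelve. all: by end_near. Qed.

Lemma log2_expR (x : R) : log2 (expR x)%:E = (x / ln 2)%:E.
Proof. by rewrite /log2 lne_EFin ?expR_gt0 // expRK -EFinM. Qed.

Lemma le_log2 (p q : \bar R) : (0 <= p)%E -> (p <= q)%E -> (log2 p <= log2 q)%E.
Proof.
move=> p0 pq; rewrite /log2 lee_wpmul2r ?lee_fin ?invr_ge0 ?(ltW (ln2_gt0 R)) //.
by rewrite lee_lne // in_itv /= leey andbT // (le_trans p0).
Qed.

Lemma log2_fin (p : \bar R) (y : R) : (0 <= p)%E -> p \is a fin_num ->
  log2 p = y%:E -> p = (expR (ln 2 * y))%:E.
Proof.
case: p => // r; rewrite lee_fin => r0 _; rewrite /log2.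
have [->|rn0] := eqVneq r 0.
  by rewrite le0_lneNy // gt0_mulNye // lte_fin invr_gt0 ln2_gt0.
have rp : 0 < r by rewrite lt_def rn0.
rewrite lne_EFin // -EFinM => -[<-].
by rewrite mulrCA divff ?mulr1 ?lnK // gt_eqF ?ln2_gt0.
Qed.

End limsup.

Section series.
Context (R : realType) (v : nat -> R).
Hypothesis v_ge0 : forall n, 0 <= v n.

(** The series starts at 1 and the partial sums used in the proof at 0, so [v 0] goes into the
    bound. *)
Lemma nneseries_finP :
  (\sum_(1 <= n <oo) (v n)%:E < +oo)%E ->
  exists S, forall n, \sum_(i < n) v i <= S.
Proof.
set s := (X in (X < _)%E) => sfin.
have v0 n : (1 <= n)%N -> true -> (0 <= (v n)%:E)%E by rewrite lee_fin.
have s0 : (0 <= s)%E by apply: nneseries_ge0.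
have sE : s \is a fin_num by rewrite ge0_fin_numE.
exists (v 0%N + fine s) => -[|n].
  by rewrite big_ord0 addr_ge0 // fine_ge0.
rewrite big_ord_recl lerD2l -lee_fin fineK //.
apply: le_trans (nneseries_lim_ge n.+1 v0).
by rewrite sumEFin lee_fin big_add1 /= big_mkord.
Qed.

Lemma nneseries_infP :
  ~ (\sum_(1 <= n <oo) (v n)%:E < +oo)%E ->
  forall S, exists n, S < \sum_(i < n) v i.
Proof.
move=> Hv S; apply: contrapT => nS; apply: Hv.
apply: (@le_lt_trans _ _ S%:E); last exact: ltry.
apply: lime_le; first by apply: is_cvg_nneseries => n _ _; rewrite lee_fin.
near=> n; rewrite sumEFin lee_fin; apply: (@le_trans _ _ (\sum_(0 <= i < n) v i)).
  have [->|n0] := posnP n; first by rewrite !big_geq.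
  by rewrite [leRHS]big_ltn // lerDr.
rewrite big_mkord leNgt; apply/negP => h; apply: nS; by exists n.
Unshelve. all: by end_near. Qed.

End series.

Section joint_law.
Context (R : realType) (disp : measure_display) (Omega : measurableType disp).
Context (P : probability Omega R) (I : choiceType) (X : I -> {RV P >-> R}).

Definition joint (w : Omega) : conf I R := fun e => X e w.

Lemma joint_measurable : measurable_fun setT joint.
Proof. by apply: conf_measurableP => i; exact: measurable_funPT. Qed.

HB.instance Definition _ := isMeasurableFun.Build _ _ _ _ joint joint_measurable.

Definition joint_law : probability (conf I R) R := distribution P joint.

Lemma joint_lawE (A : set (conf I R)) : joint_law A = P (joint @^-1` A).
Proof. by []. Qed.

Lemma joint_law_cylinder i (X_indep : mutually_independent X)
    (X_ident : identically_distributed X) (s : {fset I}) (A : I -> set R) :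
  (forall j, measurable (A j)) ->
  joint_law (cylinder s A) = (\prod_(j <- s) distribution P (X i) (A j))%E.
Proof.
move=> mA; rewrite (eq_bigr (fun j => distribution P (X j) (A j))); last first.
  by move=> j _; exact: X_ident.
by rewrite -X_indep.
Qed.

Lemma joint_law_mean i : P.-integrable setT (EFin \o X i) ->
  \int[joint_law]_c c i = fine ('E_P[X i])%E.
Proof.
move=> iX; rewrite /Rintegral /joint_law integral_distribution //.
  by rewrite unlock.
by apply: measurableT_comp => //; exact: conf_eval_measurable.
Qed.

End joint_law.

(** The indicators of the bad events tend to 0 almost surely and are bounded by 1, so dominated
    convergence applies. *)
Lemma ae_cvg_lower_prob (R : realType) (disp : measure_display)
    (T : measurableType disp) (P : probability T R) (Y : nat -> T -> R) (mu eps del : R) :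
  (forall n, measurable_fun setT (Y n)) ->
  {ae P, forall w, Y ^~ w @ \oo --> mu} -> 0 < eps -> 0 < del ->
  exists N, forall n, (N <= n)%N -> (P [set w | Y n w < mu - eps]%R <= del%:E)%E.
Proof.
move=> mY Ymu eps0 del0; pose A n := [set w | Y n w < mu - eps].
have mA n : measurable (A n).
  exact: strict_sublevel_measurable.
have [|||||_ _ +] := @dominated_convergence _ _ R P setT measurableT
  (fun n w => (\1_(A n) w)%:E) (cst 0%E) (cst 1%E); last 1 first.
- rewrite integral0_eq // => /fine_cvgP[_] /cvgrPdist_lt /(_ _ del0) [N _ H].
  exists N => n /H /=; rewrite integral_indic // setIT.
  rewrite sub0r normrN ger0_norm ?fine_ge0 // => /ltW.
  by rewrite -lee_fin fineK // fin_num_measure.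
- by move=> n; apply: measurableT_comp => //; exact: measurable_indic.
- exact: measurable_cst.
- apply: filterS Ymu => w /cvgrPdist_lt /(_ _ eps0) [N _ H] _.
  apply: cvg_near_cst; exists N => // n /H /=; rewrite ltr_distlC => /andP[h _].
  by rewrite indicE memNset //= /A /=; apply/negP; rewrite -leNgt ltW.
- by apply: finite_measure_integrable_cst.
- apply: aeW => w n _; rewrite abse_EFin lee_fin indicE.
  by case: (_ \in _); rewrite ?normr1 ?normr0.
Qed.

Theorem theorem1p1 (R : realType) (disp : measure_display)
    (Omega : measurableType disp) (P : probability Omega R)
    (d : nat) (d_ge1 : (1 <= d)%N)
    (X : edge d -> {RV P >-> R})
    (X_indep : mutually_independent X)
    (X_ident : identically_distributed X)
    (X_mean0 : forall e, ('E_P[X e] = 0)%E)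
    (c0 : R) (c0_gt0 : 0 < c0)
    (X_expmom : forall e (c : R), `|c| < c0 ->
       ('E_P[fun w => expR (c * X e w)] < +oo)%E)
    (mu : R)
    (mu_lim : {ae P, forall w,
       (fun n : nat => passage X n w / n%:R) @ \oo --> mu})
    (M0 : R) (M0_gt0 : 0 < M0)
    (f : R -> R)
    (f_gt0 : forall x, 0 < x -> 0 < f x)
    (f_incr : forall x y, 0 < x -> x <= y -> f x <= f y)
    (X_tail : forall e (x : R), x < - M0 ->
       log2 (P [set w | X e w < x]) = (- ((- x) ^+ d.+1 * f (- x)))%:E) :
  exists eps0 : R, 0 < eps0 /\
    forall eps : R, 0 < eps -> eps < eps0 ->
      ((limn_esup (fun n : nat =>
          ((n%:R ^+ d.+1)^-1)%:E *
          log2 (P [set w | (passage X n w <= (mu - eps) * n%:R)%R])) < 0)%E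
       <->
       (\sum_(1 <= n <oo) ((f (2 ^+ n) `^ (d%:R^-1))^-1)%:E < +oo)%E).
Proof.
pose i0 : 'I_d := Ordinal d_ge1.
pose Q := joint_law X.
have QE := joint_law_cylinder (origin_edge i0) X_indep X_ident.
have mX e : measurable_fun setT (X e) by exact: measurable_funPT.
have mc e : measurable_fun setT (fun c : conf (edge d) R => c e).
  exact: conf_eval_measurable.
have Q_exp e (a : R) : `|a| < c0 -> (\int[Q]_c (expR (a * c e))%:E < +oo)%E.
  move=> /(X_expmom e); rewrite unlock /Q /joint_law ge0_integral_distribution //.
  apply: measurableT_comp => //; apply: measurableT_comp => //.
  exact: measurable_funM.
(* Integrability comes from the exponential moments, by way of [coord_rint] for the joint law. *)
have Xint e : P.-integrable setT (EFin \o X e).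
  apply/integrableP; split; first exact: measurableT_comp.
  have /integrableP[_] := coord_rint c0_gt0 Q_exp e.
  rewrite /Q /joint_law ge0_integral_distribution //.
  by do 2 apply: measurableT_comp => //.
have Q_mean e : \int[Q]_c c e = 0 by rewrite joint_law_mean // X_mean0.
have Q_tail e (x : R) : M0 < x ->
    Q [set c | c e < - x] = (expR (- (ln 2 * (x ^+ d.+1 * f x))))%:E.
  move=> Mx; rewrite -mulrN; apply: log2_fin => //.
    by apply: fin_num_measure; exact: strict_sublevel_measurable.
  by have := X_tail e (- x); rewrite opprK ltrN2; exact.
have PQ n y : P [set w | passage X n w <= y] =
    Q [set c | longest i0 n c (0, 0%N) <= y].
  rewrite /Q joint_lawE; congr (P _); apply/seteqP; split => w /=;
    by rewrite (passage_longest i0).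
have v_ge0 n : 0 <= (f (2 ^+ n) `^ (d%:R^-1))^-1 by rewrite invr_ge0 powR_ge0.
exists 1; split=> // eps eps_gt0 _; split.
- move=> Hlim; apply: contrapT => /(nneseries_infP v_ge0) f_div.
  suff /(lt_le_trans Hlim) : (0 <= limn_esup (fun n : nat =>
      ((n%:R ^+ d.+1)^-1)%:E *
      log2 (P [set w | (passage X n w <= (mu - eps) * n%:R)%R])))%E by rewrite ltxx.
  (* It is enough to exceed [- del] infinitely often, here along the powers of 2. *)
  apply/lee_addgt0Pr => del del_gt0.
  rewrite -leeBlDr // add0e; apply: limn_esup_ge => m.
  have dl : 0 < del * ln 2 by rewrite mulr_gt0 // ln2_gt0.
  have [N0 HN0] := deviation_divergent i0 QE c0_gt0 Q_exp f_gt0 f_incr M0_gt0 Q_tail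
    f_div (mu - eps) dl.
  pose N := maxn N0 m; have /HN0 H : (N0 <= N)%N by rewrite leq_maxl.
  exists (2 ^ N)%N.
    by rewrite (leq_trans (leq_maxr N0 m)) // ltnW // ltn_expl.
  have n_gt0 : 0 < (2 ^ N)%:R ^+ d.+1 :> R by rewrite exprn_gt0 // ltr0n expn_gt0.
  rewrite PQ; apply: (@le_trans _ _ (((2 ^ N)%:R ^+ d.+1)^-1%:E *
      log2 (expR (- (del * ln 2 * (2 ^ N)%:R ^+ d.+1)))%:E)%E); last first.
    by apply: lee_wpmul2l; [rewrite lee_fin invr_ge0 ltW|rewrite le_log2 // lee_fin expR_ge0].
  rewrite log2_expR -EFinM lee_fin le_eqVlt; apply/orP; left; apply/eqP.
  by field; rewrite !gt_eqF ?ln2_gt0.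
- move=> /(nneseries_finP v_ge0) [S f_sum].
  have lower_prob e del : 0 < e -> 0 < del -> exists N, forall n, (N <= n)%N ->
      (Q [set c | longest i0 n c (0, 0%N) < (mu - e) * n%:R]%R <= del%:E)%E.
    move=> e0 del0.
    have [|N HN] := @ae_cvg_lower_prob _ _ _ P
      (fun n w => passage X n w / n%:R) mu e del _ mu_lim e0 del0.
      move=> n; apply: measurable_funM => //.
      rewrite (_ : passage X n = (fun c => longest i0 n c (0, 0%N)) \o joint X).
        by apply: measurableT_comp => //; exact: longest_measurable c0_gt0 Q_exp _ _.
      by apply/funext => w /=; rewrite (passage_longest i0).
    exists N.+1 => n Nn; apply: le_trans (HN n (ltnW Nn)).
    rewrite /Q joint_lawE le_eqVlt; apply/orP; left; apply/eqP; congr (P _).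
    apply/seteqP; split => w /=;
      by rewrite (passage_longest i0) ltr_pdivrMr // ltr0n (leq_trans _ Nn).
  have [a a_gt0 [N HN]] := deviation_summable QE c0_gt0 Q_exp Q_mean lower_prob
    f_gt0 f_incr M0_gt0 Q_tail f_sum eps_gt0.
  apply: (@le_lt_trans _ _ (- (a / ln 2))%:E); last first.
    by rewrite lte_fin oppr_lt0 divr_gt0 // ln2_gt0.
  apply: (@limn_esup_le _ _ _ N.+1) => n Nn; rewrite PQ.
  have n_gt0 : 0 < n%:R ^+ d.+1 :> R by rewrite exprn_gt0 // ltr0n (leq_trans _ Nn).
  apply: (@le_trans _ _ ((n%:R ^+ d.+1)^-1%:E *
      log2 (expR (- (a * n%:R ^+ d.+1)))%:E)%E).
    by apply: lee_wpmul2l; [rewrite lee_fin invr_ge0 ltW|rewrite le_log2 // HN // ltnW].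
  rewrite log2_expR -EFinM lee_fin le_eqVlt; apply/orP; left; apply/eqP.
  by field; rewrite !gt_eqF ?ln2_gt0.
Qed.
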